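(* Let $$H^{(N)}=s_0+d_0+\sum_{i\in I}[s_i,d_i],\qquad s_i\in\mathfrak{scont}(J^1(\mathbb{R}^n)),\ d_i\in\mathfrak{pdiff}(J^1(\mathbb{R}^n)),$$ where $I$ is a finite index set and $[\cdot,\cdot]$ is the contact-Jacobi bracket, and let $U\subset J^1(\mathbb{R}^n)$ be compact. Assume that, for all sufficiently small positive and negative times required by the composition coefficients, the exact subflows of each generator $s_i$ and $d_i$ are well-defined on a neighborhood of $U$, and that all finite compositions of them used in constructing the map $\Psi^{(k)}_{N,h}$ below remain in a fixed compact subset of that neighborhood. Then, for any order $k\in\mathbb{N}$, there exists a contact one-step map $\Psi^{(k)}_{N,h}$, given by a finite composition of exact flows of the strict and prolonged generators $s_i,d_i$, such that $$\Psi^{(k)}_{N,h}=\Phi^h_{H^{(N)}}+O(h^{k+1})$$ in the $C^r(U)$ topology for every finite $r$, as $h\to0$.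
   Context: $J^1(\mathbb{R}^n)\cong\mathbb{R}^{2n+1}$ has global coordinates $(x^i,u,p_i)$ and contact form $\alpha=du-p_i\,dx^i$ (summation convention). A smooth function $H$ generates the contact Hamiltonian vector field $$X_H=\frac{\partial H}{\partial p_i}\frac{\partial}{\partial x^i}-\Big(\frac{\partial H}{\partial x^i}+p_i\frac{\partial H}{\partial u}\Big)\frac{\partial}{\partial p_i}+\Big(p_i\frac{\partial H}{\partial p_i}-H\Big)\frac{\partial}{\partial u},$$ with flow $\Phi^t_H$. The contact-Jacobi bracket is $$[H,K]=\{H,K\}+\frac{\partial H}{\partial u}\Big(K-p_i\frac{\partial K}{\partial p_i}\Big)-\frac{\partial K}{\partial u}\Big(H-p_i\frac{\partial H}{\partial p_i}\Big),\qquad \{H,K\}=\sum_{i}\Big(\frac{\partial H}{\partial p_i}\frac{\partial K}{\partial x^i}-\frac{\partial H}{\partial x^i}\frac{\partial K}{\partial p_i}\Big).$$ $\mathfrak{scont}(J^1(\mathbb{R}^n))$ is the set of smooth $H$ with $\partial H/\partial u=0$; $\mathfrak{pdiff}(J^1(\mathbb{R}^n))$ is the set of $H=f(x,u)+g^i(x,u)p_i$ with $f,g^i$ smooth. The Hamiltonian $H^{(N)}$ is a polynomial in $p$ of degree at most $N$ with smooth coefficients in $(x,u)$. A contact one-step map is a family, parametrized by the step size $h$, of (local) contactomorphisms, i.e. diffeomorphisms $\psi$ with $\psi^*\alpha=e^{\lambda}\alpha$ for a function $\lambda$. The norm is $\|F\|_{C^r(U)}=\max_{0\le k\le r}\sup_{z\in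 U}\|D^kF(z)\|$. The times of the exact flows in the composition are allowed to depend on $h$ (e.g. to be multiples of fractional powers of $h$) and to be negative. *)

(* Defs.v *)
From HB Require Import structures.
From mathcomp Require Import all_boot all_order all_algebra.
From mathcomp Require Import all_classical all_reals all_analysis.
Set Implicit Arguments.
Unset Strict Implicit.
Unset Printing Implicit Defensive.
Import Order.TTheory GRing.Theory Num.Theory.
Import numFieldNormedType.Exports.
Local Open Scope classical_set_scope.
Local Open Scope ring_scope.

Section Smooth.
Context {R : realType} {V W : normedModType R}.

(* [:: v1; ...; vk] gives D_v1 (... (D_vk F)), that is, for smooth F, the value
   of the symmetric k-linear map D^k F on (v1, ..., vk). *)
Definition iter_derive (F : V -> W) (vs : seq V) : V -> W :=
  foldr (fun v G z => 'D_v G z) F vs.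

(* C^oo on A, meant for open A *)
Definition smooth_on (A : set V) (F : V -> W) : Prop :=
  forall (vs : seq V) (z : V), A z -> differentiable (iter_derive F vs) z.

(* operator norm of D^k F(z) as a k-linear map *)
Definition opnorm_derive (k : nat) (F : V -> W) (z : V) : \bar R :=
  ereal_sup [set (`|iter_derive F vs z|)%:E | vs in
    [set vs : seq V | size vs = k /\ forall v, v \in vs -> `|v| <= 1]].

(* The initial value 0 of the maximum only matters when U is empty. *)
Definition Cr_norm (r : nat) (U : set V) (F : V -> W) : \bar R :=
  \big[maxe/0%E]_(k < r.+1) ereal_sup [set opnorm_derive k F z | z in U].

End Smooth.

(* J^1(R^n) with coordinates ((x, u), p), so that z.1 is the pair (x, u) *)
Notation jet1 R n := ('rV[R]_n * R * 'rV[R]_n)%type.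

Section Jet.
Context {R : realType} {n : nat}.
Local Notation jet1 := (jet1 R n).

Definition jx (z : jet1) : 'rV[R]_n := z.1.1.
Definition ju (z : jet1) : R := z.1.2.
Definition jp (z : jet1) : 'rV[R]_n := z.2.
Definition jxu (z : jet1) : 'rV[R]_n * R := z.1.

Definition d_x (i : 'I_n) (H : jet1 -> R) (z : jet1) : R :=
  'D_((delta_mx 0 i, 0, 0) : jet1) H z.
Definition d_u (H : jet1 -> R) (z : jet1) : R :=
  'D_((0, 1, 0) : jet1) H z.
Definition d_p (i : 'I_n) (H : jet1 -> R) (z : jet1) : R :=
  'D_((0, 0, delta_mx 0 i) : jet1) H z.

Definition contact_form (z v : jet1) : R :=
  ju v - \sum_(i < n) jp z 0 i * jx v 0 i.

Definition contact_vf (H : jet1 -> R) (z : jet1) : jet1 :=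
  (\row_i d_p i H z,
   \sum_(i < n) jp z 0 i * d_p i H z - H z,
   \row_i - (d_x i H z + jp z 0 i * d_u H z)).

Definition poisson (H K : jet1 -> R) (z : jet1) : R :=
  \sum_(i < n) (d_p i H z * d_x i K z - d_x i H z * d_p i K z).

Definition contact_jacobi (H K : jet1 -> R) (z : jet1) : R :=
  poisson H K z
  + d_u H z * (K z - \sum_(i < n) jp z 0 i * d_p i K z)
  - d_u K z * (H z - \sum_(i < n) jp z 0 i * d_p i H z).

Definition scont (H : jet1 -> R) : Prop :=
  smooth_on setT H /\ forall z, d_u H z = 0.

Definition pdiff (H : jet1 -> R) : Prop :=
  exists (f : 'rV[R]_n * R -> R) (g : 'I_n -> 'rV[R]_n * R -> R),
    [/\ smooth_on setT f, forall i, smooth_on setT (g i) &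
        forall z, H z = f (jxu z) + \sum_(i < n) g i (jxu z) * jp z 0 i].

Definition poly_in_p (N : nat) (H : jet1 -> R) : Prop :=
  exists c : {ffun 'I_n -> 'I_N.+1} -> 'rV[R]_n * R -> R,
    (forall a, smooth_on setT (c a)) /\
    forall z, H z = \sum_(a : {ffun 'I_n -> 'I_N.+1} | (\sum_i a i <= N)%N)
                      c a (jxu z) * \prod_i jp z 0 i ^+ a i.

(* an integral curve of X_H joins z (time 0) to w (time t) *)
Definition flow_rel (H : jet1 -> R) (t : R) (z w : jet1) : Prop :=
  exists gamma : R -> jet1, [/\ gamma 0 = z, gamma t = w &
    forall s : R, Num.min 0 t <= s <= Num.max 0 t ->
      is_derive s 1 gamma (contact_vf H (gamma s))].

Definition flow_defined (H : jet1 -> R) (t : R) (z : jet1) : Prop :=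
  exists w, flow_rel H t z w.

(* The exact flow; the value z is a dummy one when the flow is undefined. *)
Definition flow (H : jet1 -> R) (t : R) (z : jet1) : jet1 :=
  xget z [set w | flow_rel H t z w].

(* composition of exact flows, the head of the list being applied first *)
Definition flow_comp (w : seq ((jet1 -> R) * R)) (z : jet1) : jet1 :=
  foldl (fun y Ht => flow Ht.1 Ht.2 y) z w.

Fixpoint flow_comp_defined (w : seq ((jet1 -> R) * R)) (z : jet1) : Prop :=
  if w is Ht :: w' then
    flow_defined Ht.1 Ht.2 z /\ flow_comp_defined w' (flow Ht.1 Ht.2 z)
  else True.

Definition local_diffeo (V : set jet1) (psi : jet1 -> jet1) : Prop :=
  [/\ open V, smooth_on V psi, open (psi @` V) &
      exists phi : jet1 -> jet1, smooth_on (psi @` V) phi /\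
        forall z, V z -> phi (psi z) = z].

Definition local_contactomorphism (V : set jet1) (psi : jet1 -> jet1) : Prop :=
  local_diffeo V psi /\
  exists lambda : jet1 -> R, forall z v, V z ->
    contact_form (psi z) ('d psi z v) = expR (lambda z) * contact_form z v.

(* The index None stands for the index 0 of the free terms s_0 and d_0;
   inl and inr select the strict and the prolonged generators. *)
Definition generator (I : Type) (s d : option I -> jet1 -> R)
    (g : option I + option I) : jet1 -> R :=
  match g with inl i => s i | inr i => d i end.

End Jet.

(* Main.v *)
Require Import Defs.
From HB Require Import structures.
From mathcomp Require Import all_boot all_order all_algebra.
From mathcomp Require Import all_classical all_reals all_analysis.
From mathcomp Require Import ring lra.
Set Implicit Arguments.
Unset Strict Implicit.
Unset Printing Implicit Defensive.
Import Order.TTheory GRing.Theory Num.Theory.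
Import numFieldNormedType.Exports.
Local Open Scope classical_set_scope.
Local Open Scope ring_scope.

(* For smooth fields the flow is smooth in time and space, and the loop
   exp(-tB) exp(-tA) exp(tB) exp(tA) equals id + t^2 [A,B] + O(t^3). As
   X_[H,K] = [X_H, X_K], running the flows of s_0 and d_0 for the time t^2 and then
   one loop for each bracket gives a word in the generators which follows the flow
   of H for the time t^2 up to O(t^3). If a word is accurate up to O(t^m), m > 2,
   with leading error t^m e, then repeating it 2^m times with parameter k t and
   running it once backwards with parameter 2 k t cancels t^m e; choosing k so that
   (2^m - 4) k^2 = 1 restores the total time t^2. Put t = sqrt h; for h < 0 use the
   inverse word at sqrt (-h). A smooth family which is O(t^m) pointwise, locally
   uniformly, has all its space derivatives O(t^m), which gives the C^r estimate.
   Every flow preserves the contact structure since alpha(D Phi v) solves a linear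
   homogeneous ODE along its curves. *)

(** * Smooth maps and coordinates *)

(** Orders are counted in t, in which words are smooth families, and not in h, in which the times
    involve square roots; accuracy O(t^(2k+2)) becomes O(h^(k+1)). No Baker-Campbell-Hausdorff
    series is needed. A smooth family that is O(t^m) has zero time derivatives of order below m at t
    = 0, so Taylor's formula supplies a smooth leading coefficient e for any word, however long.
    Under composition of families close to the identity these coefficients add, since shifting their
    base point by O(t) costs only O(t^(m+1)); inversion changes their sign, and replacing t by k t
    multiplies e by k^m but the flow time by k^2. This mismatch of exponents lets e cancel while
    time survives: 2^m copies of k^m e balance one copy of (2 k)^m e for either parity of m, and 2^m
    - 4 is positive from m = 3 on, exactly where the loops start. All this concerns values only;
    space derivatives follow because they commute with time derivatives. Flows are merely local,
    hence identities between families hold near each point (0, z), and compactness of balls makes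
    them uniform only at the end. *)

Section Calculus.
Context {R : realType}.

Lemma differentiable_eps (V W : normedModType R) (f : V -> W) (x : V) :
  differentiable f x -> forall e, 0 < e ->
  \forall v \near (0 : V), `|f (x + v) - f x - 'd f x v| <= e * `|v|.
Proof.
move=> /diff_locallyP[_ /eqaddoP h] e e0.
have := h e e0; apply: filterS => v /=.
by rewrite /cst !fctE /shift/= (addrC v) opprD addrA.
Qed.

Lemma eps_differentiable (V W : normedModType R) (f : V -> W) (x : V)
    (L : {linear V -> W}) :
  continuous L -> (forall e, 0 < e ->
  \forall v \near (0 : V), `|f (x + v) - f x - L v| <= e * `|v|) ->
  differentiable f x /\ 'd f x = L :> (V -> W).
Proof.
move=> cL h.
have hL : f \o shift x = cst (f x) + L +o_ 0 id.
  apply/eqaddoP => e e0; have := h e e0; apply: filterS => v /=.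
  by rewrite /cst !fctE /shift/= (addrC v) opprD addrA.
have dL := diff_unique cL hL.
by split=> //; apply/diff_locallyP; rewrite dL; split.
Qed.

Lemma near_eq_differentiable (V W : normedModType R) (f g : V -> W) (x : V) :
  (\forall y \near x, f y = g y) -> differentiable f x -> differentiable g x.
Proof.
move=> fg df; have [cL _] := (diff_locallyP _ _).1 df.
apply: (eps_differentiable (L := 'd f x) cL _).1 => e e0.
have := differentiable_eps df e0.
have : \forall v \near (0 : V), f (x + v) = g (x + v).
  have : (x + v) @[v --> (0 : V)] --> x.
    by rewrite -[X in _ --> X]addr0; apply: cvgD; [exact: cvg_cst|exact: cvg_id].
  by move=> /(_ _ fg).
by apply: filterS2 => v ->; rewrite (nbhs_singleton fg).
Qed.

(** Finite-order form of [smooth_on] that peels off the innermost direction first, so that closure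
    properties go by induction on [k]. All iterated derivatives of order below [k] are
    differentiable; [Ck 0] is void. *)
Fixpoint Ck (V W : normedModType R) (k : nat) (A : set V) (F : V -> W) : Prop :=
  if k is k'.+1 then
    (forall z, A z -> differentiable F z) /\ forall v, Ck k' A ('D_v F)
  else True.

Lemma iter_derive_rcons (V W : normedModType R) (F : V -> W) vs v :
  iter_derive F (rcons vs v) = iter_derive ('D_v F) vs.
Proof. by rewrite /iter_derive foldr_rcons. Qed.

Lemma smooth_onP (V W : normedModType R) (A : set V) (F : V -> W) :
  smooth_on A F <-> forall k, Ck k A F.
Proof.
split=> [sF k|cF vs].
  elim: k F sF => //= k IH F sF; split=> [z Az|v]; first exact: (sF [::] z Az).
  by apply: IH => vs z Az; rewrite -iter_derive_rcons; exact: sF.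
have : Ck (size vs).+1 A F by [].
elim/last_ind: vs F {cF} => [F [] // |vs v IH F].
by rewrite size_rcons iter_derive_rcons => -[_ /(_ v)]; exact: IH.
Qed.

Lemma near_open (V : normedModType R) (A : set V) (x : V) (P : V -> Prop) :
  open A -> A x -> (forall y, A y -> P y) -> \forall y \near x, P y.
Proof. by move=> oA Ax AP; apply: filterS AP _; exact: open_nbhs_nbhs. Qed.

Section fixedA.
Context {V : normedModType R} (A : set V) (oA : open A).

Lemma CkW (W : normedModType R) k (F : V -> W) : Ck k.+1 A F -> Ck k A F.
Proof.
elim: k F => // k IH F [dF cF]; split=> // v; exact/IH/cF.
Qed.

Lemma Ck_ext (W : normedModType R) k (F G : V -> W) :
  (forall z, A z -> F z = G z) -> Ck k A F -> Ck k A G.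
Proof.
elim: k F G => //= k IH F G FG [dF cF]; split=> [z Az|v].
  by apply: (near_eq_differentiable _ (dF _ Az)); exact: near_open FG.
by apply: IH (cF v) => z Az; apply: near_eq_derive; exact: near_open FG.
Qed.

Lemma Ck_cst (W : normedModType R) k (a : W) : Ck k A (fun=> a).
Proof.
elim: k a => //= k IH a; split=> [z _|v]; first exact: differentiable_cst.
by apply: Ck_ext (IH 0) => z _; rewrite derive_cst.
Qed.

Lemma CkD (W : normedModType R) k (F G : V -> W) :
  Ck k A F -> Ck k A G -> Ck k A (fun z => F z + G z).
Proof.
elim: k F G => //= k IH F G [dF cF] [dG cG]; split=> [z Az|v].
  by apply: differentiableD; [exact: dF|exact: dG].
apply: Ck_ext (IH _ _ (cF v) (cG v)) => z Az.
by rewrite -deriveD //; apply: diff_derivable; [exact: dF|exact: dG].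
Qed.

Lemma Ck_lin (W X : normedModType R) k (L : {linear W -> X}) (F : V -> W) :
  continuous L -> Ck k A F -> Ck k A (fun z => L (F z)).
Proof.
move=> cL; elim: k F => //= k IH F [dF cF].
have dL w : differentiable L w by exact: linear_differentiable.
split=> [z Az|v]; first exact: (differentiable_comp (dF z Az)).
apply: Ck_ext (IH _ (cF v)) => z Az.
have dFz := dF z Az; have dLz := dL (F z).
rewrite (deriveE _ dFz) (deriveE _ (differentiable_comp dFz dLz)).
by rewrite (diff_comp dFz dLz) /= diff_lin.
Qed.

Lemma Ck_pair (W X : normedModType R) k (F : V -> W) (G : V -> X) :
  Ck k A F -> Ck k A G -> Ck k A (fun z => (F z, G z)).
Proof.
elim: k F G => //= k IH F G [dF cF] [dG cG]; split=> [z Az|v].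
  exact: differentiable_pair (dF z Az) (dG z Az).
apply: Ck_ext (IH _ _ (cF v) (cG v)) => z Az.
have dF' := dF _ Az; have dG' := dG _ Az.
rewrite !deriveE //; last exact: differentiable_pair.
by rewrite diff_pair.
Qed.

Lemma CkM k (F G : V -> R) :
  Ck k A F -> Ck k A G -> Ck k A (fun z => F z * G z).
Proof.
elim: k F G => // k IH F G cF cG.
have [dF cF'] := cF; have [dG cG'] := cG; split=> [z Az|v].
  exact: differentiableM (dF z Az) (dG z Az).
apply: Ck_ext (CkD (IH _ _ (CkW cF) (cG' v)) (IH _ _ (CkW cG) (cF' v))) => z Az.
by rewrite -deriveM //; apply: diff_derivable; [exact: dF|exact: dG].
Qed.

End fixedA.

(* The difference quotients agree whether or not [L] is continuous. *)
Lemma derive_affine (V V' W : normedModType R) (L : {linear V' -> V}) (a : V)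
    (F : V -> W) v :
  'D_v (fun x => F (a + L x)) = fun x => 'D_(L v) F (a + L x).
Proof.
apply/funext => x; rewrite /derive.
set f := (X in lim (X @ _) = _); set g := (X in _ = lim (X @ _)).
by have -> : f = g by apply/funext => h; rewrite /f /g /= (linearD L) (linearZZ L) addrCA.
Qed.

Lemma iter_derive_affine (V V' W : normedModType R) (L : {linear V' -> V})
    (a : V) (F : V -> W) vs :
  iter_derive (fun x => F (a + L x)) vs =
  fun x => iter_derive F (map L vs) (a + L x).
Proof. by elim: vs => //= v vs ->; rewrite derive_affine. Qed.

End Calculus.

(* Finitely many coordinates for which the norm is the sup norm. *)
Record coordsys (R : realType) (V : normedModType R) := Coordsys {
  cidx : finType;
  cvec : cidx -> V;
  coord : cidx -> {linear V -> R};
  coord_vec : forall i j, coord i (cvec j) = (i == j)%:R;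
  coord_sum : forall v, v = \sum_j coord j v *: cvec j;
  coord_norm : forall v b, 0 <= b -> (forall j, `|coord j v| <= b) -> `|v| <= b;
  coord_le : forall j v, `|coord j v| <= `|v|;
  coord_compact : forall M, compact [set v : V | `|v| <= M] }.

Arguments cvec {R V} c _.
Arguments coord {R V} c _.
Arguments coord_sum {R V} c _.
Arguments coord_vec {R V} c _ _.
Arguments coord_le {R V} c _ _.
Arguments coord_norm {R V} c _ _.

Section Coordinates.
Context {R : realType}.

Lemma linear_le_continuous (V W : normedModType R) (L : {linear V -> W}) C :
  (forall v, `|L v| <= C * `|v|) -> continuous L.
Proof.
move=> hL; apply/linear_bounded_continuous/linear_boundedP.
exists C; split; first by rewrite num_real.
move=> r Cr x; apply: le_trans (hL x) _.
by apply: ler_wpM2r => //; exact: ltW.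
Qed.

Lemma continuous_coord (V : normedModType R) (cV : coordsys V) j :
  continuous (coord cV j).
Proof.
by apply: (linear_le_continuous (C := 1)) => v; rewrite mul1r coord_le.
Qed.

Lemma closed_norm_le (V : normedModType R) M : closed [set v : V | `|v| <= M].
Proof.
apply: (@closed_comp _ _ (fun v : V => `|v| : R) [set x : R | x <= M]); last exact: closed_le.
by move=> v _; exact: norm_continuous.
Qed.

#[local] Obligation Tactic := idtac.

Program Definition coordsysR : coordsys R :=
  @Coordsys R R unit (fun=> 1) (fun=> idfun) _ _ _ _ _.
Next Obligation. by move=> [] []. Qed.
Next Obligation. move=> v /=; rewrite (bigD1 tt) //= big1 ?addr0 => [|[]//].
by rewrite [RHS]mulr1. Qed.
Next Obligation. by move=> v b b0 /(_ tt). Qed.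
Next Obligation. by []. Qed.
Next Obligation.
move=> M; suff -> : [set v : R | `|v| <= M] = `[-M, M]%classic by exact: segment_compact.
by apply/seteqP; split => v /=; rewrite in_itv /= ler_norml.
Qed.

Lemma norm_rV n (v : 'rV[R]_n) b :
  0 <= b -> (`|v| <= b <-> forall j, `|v 0 j| <= b).
Proof.
move=> b0; rewrite [`|v|]mx_normrE; split=> [h j|h].
  by move/bigmax_leP : h => [_ /(_ (0, j) isT)].
by apply/bigmax_leP; split=> // -[i j] _ /=; rewrite (ord1 i).
Qed.

Definition rV_coord n (j : 'I_n) (v : 'rV[R]_n) : R := v 0 j.

Lemma rV_coord_is_linear n (j : 'I_n) : linear (rV_coord j).
Proof. by move=> a u v; rewrite /rV_coord !mxE. Qed.

HB.instance Definition _ n (j : 'I_n) :=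
  GRing.isLinear.Build R 'rV[R]_n R *:%R (rV_coord j) (rV_coord_is_linear j).

Program Definition coordsys_rV n : coordsys 'rV[R]_n :=
  @Coordsys R _ 'I_n (fun j => delta_mx 0 j) (@rV_coord n) _ _ _ _ _.
Next Obligation. by move=> n i j; rewrite /= /rV_coord mxE eqxx. Qed.
Next Obligation. by move=> n v; exact: row_sum_delta. Qed.
Next Obligation. by move=> n v b b0 h; apply/norm_rV. Qed.
Next Obligation. by move=> n j v; exact: (norm_rV _ _).1. Qed.
Next Obligation.
move=> n M; apply: bounded_closed_compact.
  exists M; split; first by rewrite num_real.
  by move=> r Mr v /= /le_trans; apply; exact: ltW.
exact: closed_norm_le.
Qed.

Definition sum_coord (V W : normedModType R) (cV : coordsys V) (cW : coordsys W)
    (j : cidx cV + cidx cW) (v : V * W) : R :=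
  match j with inl i => coord cV i v.1 | inr i => coord cW i v.2 end.

Lemma sum_coord_is_linear (V W : normedModType R) (cV : coordsys V)
  (cW : coordsys W) j : linear (@sum_coord V W cV cW j).
Proof. by case: j => i a u v /=; rewrite linearP. Qed.

HB.instance Definition _ (V W : normedModType R) (cV : coordsys V)
  (cW : coordsys W) j := GRing.isLinear.Build R (V * W)%type R *:%R
    (@sum_coord V W cV cW j) (sum_coord_is_linear j).

Lemma norm_pair_le (V W : normedModType R) (v : V * W) b :
  (`|v| <= b) = (`|v.1| <= b) && (`|v.2| <= b).
Proof. by rewrite prod_normE ge_max. Qed.

Program Definition coordsys_prod (V W : normedModType R) (cV : coordsys V)
    (cW : coordsys W) : coordsys (V * W)%type :=
  @Coordsys R _ (cidx cV + cidx cW)%type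
    (fun j => match j with inl i => (cvec cV i, 0) | inr i => (0, cvec cW i) end)
    (@sum_coord V W cV cW) _ _ _ _ _.
Next Obligation.
move=> V W cV cW [i|i] [j|j] /=; rewrite ?linear0 ?coord_vec //.
Qed.
Next Obligation.
move=> V W cV cW [v w]; rewrite big_sumType /=.
have -> : (v, w) = (v, 0) + (0, w) by rewrite /GRing.add /= /add_pair /= addr0 add0r.
congr (_ + _).
  rewrite {1}(coord_sum cV v) (big_morph (fun x => (x, 0 : W)) (id1 := 0) (op1 := +%R)) //.
    by apply: eq_bigr => i _; congr pair; rewrite /= scaler0.
  by move=> x y; congr pair; rewrite addr0.
rewrite {1}(coord_sum cW w) (big_morph (fun x => (0 : V, x)) (id1 := 0) (op1 := +%R)) //.
  by apply: eq_bigr => i _; congr pair; rewrite /= scaler0.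
by move=> x y; congr pair; rewrite addr0.
Qed.
Next Obligation.
move=> V W cV cW v b b0 h; rewrite norm_pair_le; apply/andP; split.
  by apply: (coord_norm cV) => // j; exact: (h (inl j)).
by apply: (coord_norm cW) => // j; exact: (h (inr j)).
Qed.
Next Obligation.
move=> V W cV cW [j|j] v /=.
  apply: le_trans (coord_le (cV) j v.1) _.
  by have := lexx `|v|; rewrite norm_pair_le => /andP[].
apply: le_trans (coord_le (cW) j v.2) _.
by have := lexx `|v|; rewrite norm_pair_le => /andP[].
Qed.
Next Obligation.
move=> V W cV cW M.
rewrite (_ : mkset _ = [set v : V | `|v| <= M] `*` [set w : W | `|w| <= M]).
  by apply: compact_setX; exact: coord_compact.
by apply/seteqP; split=> v /=; rewrite norm_pair_le => /andP.
Qed.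

End Coordinates.

Lemma derive_coord (R : realType) (V W : normedModType R) (cV : coordsys V) (F : V -> W) z v :
  differentiable F z ->
  'D_v F z = \sum_j coord cV j v *: 'D_(cvec cV j) F z.
Proof.
move=> dF; rewrite deriveE // {1}(coord_sum cV v) linear_sum.
by apply: eq_bigr => j _; rewrite linearZ /= deriveE.
Qed.

Section SmoothClosure.
Context {R : realType} {V : normedModType R} (A : set V) (oA : open A).

Lemma Ck_sum (W : normedModType R) (I : finType) k (F : I -> V -> W) :
  (forall i, Ck k A (F i)) -> Ck k A (fun z => \sum_i F i z).
Proof.
move=> cF; elim: (index_enum I) => [|i s IH].
  by apply: (Ck_ext oA (F := fun=> 0)) => [z _|]; [rewrite big_nil|exact: Ck_cst].
by apply: (Ck_ext oA (F := fun z => F i z + \sum_(i <- s) F i z)) => [z _|];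
  [rewrite big_cons|exact: CkD].
Qed.

Lemma Ck_scalel (W : normedModType R) k (f : V -> R) (w : W) :
  Ck k A f -> Ck k A (fun z => f z *: w).
Proof.
have lin : linear (fun a : R => a *: w).
  by move=> a u v; rewrite scalerDl scalerA.
pose L : {linear R -> W} :=
  HB.pack (fun a : R => a *: w) (GRing.isLinear.Build R R W *:%R _ lin).
apply: (@Ck_lin R V A oA R W k L).
by apply: (linear_le_continuous (C := `|w|)) => a; rewrite /= normrZ mulrC.
Qed.

Lemma Ck_coord (W : normedModType R) (cW : coordsys W) k (F : V -> W) :
  Ck k A F <-> forall j, Ck k A (fun z => coord cW j (F z)).
Proof.
split=> [cF j|cF]; first exact: (Ck_lin oA (@continuous_coord _ _ cW j) cF).
apply: (Ck_ext oA (F := fun z => \sum_j coord cW j (F z) *: cvec cW j)) => [z _|].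
  by rewrite -coord_sum.
by apply: Ck_sum => j; exact: Ck_scalel.
Qed.

Lemma CkZ (W : normedModType R) (cW : coordsys W) k (f : V -> R) (G : V -> W) :
  Ck k A f -> Ck k A G -> Ck k A (fun z => f z *: G z).
Proof.
move=> cf /(Ck_coord cW) cG; apply/(Ck_coord cW) => j.
by apply: (Ck_ext oA _ (CkM oA cf (cG j))) => z _; rewrite linearZ.
Qed.

(** The chain rule is written in coordinates of [W]: each term is a scalar of class [Ck k] times a
    partial derivative of [G] composed with [F], and the induction hypothesis applies to that
    composite. *)
Lemma Ck_comp (W X : normedModType R) (cW : coordsys W) (cX : coordsys X)
    (B : set W) k (F : V -> W) (G : W -> X) :
  (forall z, A z -> B (F z)) -> Ck k A F -> Ck k B G -> Ck k A (G \o F).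
Proof.
move=> FB; elim: k G => // k IH G cF cG.
have [dF cF'] := cF; have [dG cG'] := cG.
split=> [z Az|v]; first exact: differentiable_comp (dF z Az) (dG _ (FB z Az)).
apply: (Ck_ext oA (F := fun z => \sum_j coord cW j ('D_v F z)
                                 *: (('D_(cvec cW j) G) \o F) z)).
  move=> z Az; have dFz := dF z Az; have dGz := dG _ (FB z Az).
  rewrite (deriveE _ (differentiable_comp dFz dGz)) (diff_comp dFz dGz) /=.
  by rewrite -!deriveE // (derive_coord cW _ dGz).
apply: Ck_sum => j; apply: (CkZ cX); first exact: (Ck_coord cW _ _).1 (cF' v) j.
by apply: IH; [exact: CkW cF|exact: cG'].
Qed.

End SmoothClosure.

Section SmoothOn.
Context {R : realType}.
Implicit Types V W X : normedModType R.

Lemma smooth_on_differentiable V W (A : set V) (F : V -> W) z :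
  smooth_on A F -> A z -> differentiable F z.
Proof. by move=> sF; exact: (sF [::]). Qed.

Lemma smooth_on_continuous V W (A : set V) (F : V -> W) z :
  smooth_on A F -> A z -> {for z, continuous F}.
Proof.
by move=> sF Az; apply/differentiable_continuous/(smooth_on_differentiable sF Az).
Qed.

Lemma smooth_on_derive V W (A : set V) (F : V -> W) v :
  smooth_on A F -> smooth_on A ('D_v F).
Proof. by move=> sF vs z Az; rewrite -iter_derive_rcons; exact: sF. Qed.

Lemma smooth_onS V W (A B : set V) (F : V -> W) :
  B `<=` A -> smooth_on A F -> smooth_on B F.
Proof. by move=> BA sF vs z /BA; exact: sF. Qed.

Lemma smooth_on_ext V W (A : set V) (F G : V -> W) : open A ->
  (forall z, A z -> F z = G z) -> smooth_on A F -> smooth_on A G.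
Proof.
move=> oA FG /smooth_onP sF; apply/smooth_onP => k; exact: Ck_ext FG (sF k).
Qed.

Lemma smooth_on_cst V W (A : set V) (a : W) : open A -> smooth_on A (fun=> a).
Proof. by move=> oA; apply/smooth_onP => k; exact: Ck_cst. Qed.

Lemma smooth_onD V W (A : set V) (F G : V -> W) : open A ->
  smooth_on A F -> smooth_on A G -> smooth_on A (fun z => F z + G z).
Proof.
by move=> oA /smooth_onP sF /smooth_onP sG; apply/smooth_onP => k; exact: CkD.
Qed.

Lemma smooth_on_sum V W (A : set V) (I : finType) (F : I -> V -> W) : open A ->
  (forall i, smooth_on A (F i)) -> smooth_on A (fun z => \sum_i F i z).
Proof.
move=> oA sF; apply/smooth_onP => k; apply: Ck_sum => // i.
exact: (smooth_onP _ _).1.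
Qed.

Lemma smooth_on_lin V W X (A : set V) (L : {linear W -> X}) (F : V -> W) :
  open A -> continuous L -> smooth_on A F -> smooth_on A (fun z => L (F z)).
Proof.
by move=> oA cL /smooth_onP sF; apply/smooth_onP => k; exact: Ck_lin.
Qed.

Lemma smooth_on_pair V W X (A : set V) (F : V -> W) (G : V -> X) : open A ->
  smooth_on A F -> smooth_on A G -> smooth_on A (fun z => (F z, G z)).
Proof.
by move=> oA /smooth_onP sF /smooth_onP sG; apply/smooth_onP => k; exact: Ck_pair.
Qed.

Lemma smooth_on_coord V W (A : set V) (cW : coordsys W) (F : V -> W) : open A ->
  smooth_on A F <-> forall j, smooth_on A (fun z => coord cW j (F z)).
Proof.
move=> oA; split=> [/smooth_onP sF j|sF]; apply/smooth_onP => k.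
  exact: (Ck_coord oA cW k F).1.
by apply/(Ck_coord oA cW) => j; exact: (smooth_onP _ _).1.
Qed.

Lemma smooth_onZ V W (A : set V) (cW : coordsys W) (f : V -> R) (G : V -> W) :
  open A -> smooth_on A f -> smooth_on A G -> smooth_on A (fun z => f z *: G z).
Proof.
move=> oA /smooth_onP sf /smooth_onP sG; apply/smooth_onP => k.
exact: (CkZ oA cW).
Qed.

Lemma smooth_on_comp V W X (cW : coordsys W) (cX : coordsys X) (A : set V)
    (B : set W) (F : V -> W) (G : W -> X) : open A ->
  (forall z, A z -> B (F z)) -> smooth_on A F -> smooth_on B G ->
  smooth_on A (fun z => G (F z)).
Proof.
move=> oA FB /smooth_onP sF /smooth_onP sG; apply/smooth_onP => k.
exact: (Ck_comp oA cW cX FB).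
Qed.

Lemma smooth_on_id V (A : set V) : open A -> smooth_on A (fun z => z).
Proof.
move=> oA; apply: (smooth_on_ext (F := fun z => (idfun : {linear V -> V}) z)) => //.
apply/smooth_onP => -[//|k]; split=> [z _|v]; first by have [] := @is_diff_id R V z.
by apply: (Ck_ext oA _ (Ck_cst oA k v)) => z _; rewrite derive_id.
Qed.

Lemma smooth_onN V W (A : set V) (cW : coordsys W) (F : V -> W) : open A ->
  smooth_on A F -> smooth_on A (fun z => - F z).
Proof.
move=> oA sF; apply: (smooth_on_ext (F := fun z => (-1) *: F z)) => // [z _|].
  by rewrite scaleN1r.
by apply: smooth_onZ => //; exact: smooth_on_cst.
Qed.

End SmoothOn.

(** * Mean value estimates *)

Section CoordVec.
Context {R : realType} {V : normedModType R} (cV : coordsys V).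

Lemma coord_inj (x y : V) : (forall j, coord cV j x = coord cV j y) -> x = y.
Proof.
by move=> h; rewrite (coord_sum cV x) (coord_sum cV y); apply: eq_bigr => j _; rewrite h.
Qed.

Lemma coordD j (x y : V) : coord cV j (x + y) = coord cV j x + coord cV j y.
Proof. exact: linearD. Qed.

Lemma coordN j (x : V) : coord cV j (- x) = - coord cV j x.
Proof. exact: linearN. Qed.

Lemma coordZ j (a : R) (x : V) : coord cV j (a *: x) = a * coord cV j x.
Proof. exact: linearZ. Qed.

Lemma coord0 j : coord cV j 0 = 0.
Proof. exact: linear0. Qed.

End CoordVec.

(* For equalities between linear combinations of vectors. *)
Ltac vec cV := apply: (coord_inj (cV := cV)) => ?;
  rewrite ?(coordD, coordN, coordZ, coord0); ring.

Section MeanValue.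
Context {R : realType}.
Implicit Types V W X : normedModType R.

Lemma is_derive_comp V W (F : V -> W) (g : R -> V) (t : R) (dg : V) :
  is_derive t 1 g dg -> differentiable F (g t) ->
  is_derive t 1 (fun s => F (g s)) ('D_dg F (g t)).
Proof.
move=> [dgt <-] dF.
have dg' : differentiable g t by apply/derivable1_diffP.
have dFg : differentiable (F \o g) t := differentiable_comp dg' dF.
apply: DeriveDef; first by apply/derivable1_diffP.
by rewrite -[LHS]/('D_1 (F \o g) t) (deriveE _ dFg) (diff_comp dg' dF) /= -!deriveE.
Qed.

Lemma is_derive_lin V W (L : {linear V -> W}) (g : R -> V) (t : R) (dg : V) :
  continuous L -> is_derive t 1 g dg -> is_derive t 1 (fun s => L (g s)) (L dg).
Proof.
move=> cL dgt; have dL : differentiable L (g t) by exact: linear_differentiable.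
by have := is_derive_comp dgt dL; rewrite deriveE // diff_lin.
Qed.

Lemma is_derive_line V (x v : V) (t : R) : is_derive t 1 (fun s : R => x + s *: v) v.
Proof.
have lin : linear (fun a : R => a *: v) by move=> a u w; rewrite scalerDl scalerA.
pose L : {linear R -> V} :=
  HB.pack (fun a : R => a *: v) (GRing.isLinear.Build R R V *:%R _ lin).
have cL : continuous L.
  by apply: (linear_le_continuous (C := `|v|)) => a; rewrite /= normrZ mulrC.
have h := is_derive_lin cL (is_derive_id t (1 : R)).
by apply: (is_derive_eq (is_deriveD (is_derive_cst x t 1) h)); rewrite /= add0r scale1r.
Qed.

Lemma is_derive_along V W (F : V -> W) (x v : V) (t : R) :
  differentiable F (x + t *: v) ->
  is_derive t 1 (fun s : R => F (x + s *: v)) ('D_v F (x + t *: v)).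
Proof. exact: is_derive_comp (is_derive_line x v t). Qed.

Lemma derive_ge0_le (f df : R -> R) (T : R) : 0 <= T ->
  (forall t, 0 <= t <= T -> is_derive t (1 : R) f (df t)) ->
  (forall t, 0 <= t <= T -> 0 <= df t) -> f 0 <= f T.
Proof.
move=> T0 hf hd.
have : exists2 c, c \in `[0, T] & f T - f 0 = df c * (T - 0).
  apply: MVT_segment T0 _ _ => [t /[!in_itv]/= /andP[/ltW t0 /ltW tT]|].
    by apply: hf; rewrite t0.
  apply: derivable_within_continuous => t /[!in_itv]/= tT.
  by have [] := hf t tT.
move=> [c /[!in_itv]/= cT e]; rewrite -subr_ge0 e subr0.
by apply: mulr_ge0 => //; exact: hd.
Qed.

(** For each coordinate g_j, both b + g_j and b - g_j have nonnegative derivative; the norm is the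
    sup of the coordinates, so the scalar bounds combine without loss. *)
Lemma mean_value_ineq V (cV : coordsys V) (g dg : R -> V) (b db : R -> R)
    (T : R) : 0 <= T ->
  (forall t, 0 <= t <= T -> is_derive t 1 g (dg t)) ->
  (forall t, 0 <= t <= T -> is_derive t (1 : R) b (db t)) ->
  (forall t, 0 <= t <= T -> `|dg t| <= db t) ->
  `|g T - g 0| <= b T - b 0.
Proof.
move=> T0 hg hb hd.
have hc j t : 0 <= t <= T ->
    is_derive t (1 : R) (fun s => coord cV j (g s)) (coord cV j (dg t)).
  by move=> tT; apply: is_derive_lin (hg t tT); exact: continuous_coord.
have hl j t : 0 <= t <= T -> `|coord cV j (dg t)| <= db t.
  by move=> tT; apply: le_trans (hd t tT); exact: coord_le.
apply: (coord_norm cV) => [|j].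
  rewrite subr_ge0; apply: (derive_ge0_le T0 hb) => t tT.
  exact: le_trans (hd t tT).
have hD t : 0 <= t <= T -> is_derive t (1 : R)
    (fun s => b s + coord cV j (g s)) (db t + coord cV j (dg t)).
  by move=> tT; apply: is_deriveD; [exact: hb|exact: hc].
have hB t : 0 <= t <= T -> is_derive t (1 : R)
    (fun s => b s - coord cV j (g s)) (db t - coord cV j (dg t)).
  by move=> tT; apply: is_deriveB; [exact: hb|exact: hc].
have hl' t : 0 <= t <= T -> - db t <= coord cV j (dg t) <= db t.
  by move=> tT; rewrite -ler_norml; exact: hl.
have leD := derive_ge0_le T0 hD _; have leB := derive_ge0_le T0 hB _.
rewrite linearB ler_norml; apply/andP; split.
  suff : b 0 + coord cV j (g 0) <= b T + coord cV j (g T) by rewrite /=; lra.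
  by apply: leD => t /hl'; lra.
suff : b 0 - coord cV j (g 0) <= b T - coord cV j (g T) by rewrite /=; lra.
by apply: leB => t /hl'; lra.
Qed.

Lemma mean_value_segment V W (cW : coordsys W) (F : V -> W) (x v : V) (M : R) :
  (forall s : R, 0 <= s <= 1 -> differentiable F (x + s *: v)) ->
  (forall s : R, 0 <= s <= 1 -> `|'D_v F (x + s *: v)| <= M) ->
  `|F (x + v) - F x| <= M.
Proof.
move=> dF hM.
have hb (t : R) : 0 <= t <= 1 -> is_derive t (1 : R) (fun s : R => s * M) M.
  by move=> _; apply: is_derive_eq; rewrite /= scaler0 add0r [_ *: _]mulr1.
have hg (t : R) : 0 <= t <= 1 -> is_derive t (1 : R)
    (fun s : R => F (x + s *: v)) ('D_v F (x + t *: v)).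
  by move=> /dF; exact: is_derive_along.
have := mean_value_ineq cW ler01 hg hb hM.
by rewrite scale1r scale0r addr0 mul0r mul1r subr0.
Qed.

(** Merges constants obtained separately for each coordinate. The summand 1 keeps the result
    positive when [I] is empty. *)
Lemma finite_bound (I : finType) (P : I -> R -> Prop) :
  (forall j, exists C, 0 < C /\ P j C) ->
  (forall j C C', C <= C' -> P j C -> P j C') ->
  exists C, 0 < C /\ forall j, P j C.
Proof.
move=> /choice[f hf] mono; exists (1 + \sum_j f j).
have f0 j : 0 < f j by have [] := hf j.
split; first by rewrite ltr_pwDl // sumr_ge0 // => j _; exact: ltW.
move=> j; apply: mono (hf j).2; rewrite (bigD1 j) //=.
have : 0 <= \sum_(i | i != j) f i by apply: sumr_ge0 => i _; exact: ltW.
by have := f0 j; lra.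
Qed.

Definition convex_region V (A : set V) :=
  forall x v (s : R), A x -> A (x + v) -> 0 <= s <= 1 -> A (x + s *: v).

Lemma convex_ball V (cV : coordsys V) (p : V) (e : R) :
  convex_region [set z | `|z - p| <= e].
Proof.
move=> x v s /= xe xve /andP[s0 s1].
have -> : x + s *: v - p = (1 - s) *: (x - p) + s *: (x + v - p) by vec cV.
apply: le_trans (ler_normD _ _) _.
rewrite !normrZ (ger0_norm s0) ger0_norm ?subr_ge0 //.
have := ler_wpM2l s0 xve; have := ler_wpM2l (_ : 0 <= 1 - s) xe.
by rewrite subr_ge0 => /(_ s1); lra.
Qed.

Lemma derive_le_coord V W (cV : coordsys V) (F : V -> W) z v (C : R) :
  differentiable F z -> (forall j, `|'D_(cvec cV j) F z| <= C) ->
  `|'D_v F z| <= #|cidx cV|%:R * C * `|v|.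
Proof.
move=> dF hC; rewrite (derive_coord cV _ dF).
apply: le_trans (ler_norm_sum _ _ _) _.
apply: le_trans (_ : \sum_(j : cidx cV) C * `|v| <= _); last first.
  by rewrite sumr_const -mulrA mulr_natl.
apply: ler_sum => j _; rewrite normrZ mulrC.
by apply: ler_pM => //; exact: coord_le.
Qed.

Lemma lipschitz_convex V W (cV : coordsys V) (cW : coordsys W) (A : set V)
    (F : V -> W) (C : R) : convex_region A ->
  (forall z, A z -> differentiable F z) ->
  (forall j z, A z -> `|'D_(cvec cV j) F z| <= C) ->
  forall x y, A x -> A y -> `|F y - F x| <= #|cidx cV|%:R * C * `|y - x|.
Proof.
move=> cA dF hC x y Ax Ay.
have yE : y = x + (y - x) by rewrite addrC subrK.
have Axy s : 0 <= s <= 1 -> A (x + s *: (y - x)) by apply: cA => //; rewrite -yE.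
rewrite {1}yE; apply: mean_value_segment => // s /Axy As; first exact: dF.
by apply: derive_le_coord => [|j]; [exact: dF|exact: hC].
Qed.

(** The mean value estimate is applied to s |-> F(x + s v) - s D_v F(x), whose derivative is
    controlled by the Lipschitz constant of the partial derivatives. *)
Lemma taylor2_convex V W (cV : coordsys V) (cW : coordsys W) (A : set V)
    (F : V -> W) (C : R) : convex_region A -> 0 <= C ->
  (forall z, A z -> differentiable F z) ->
  (forall j x y, A x -> A y ->
     `|'D_(cvec cV j) F y - 'D_(cvec cV j) F x| <= C * `|y - x|) ->
  forall x v, A x -> A (x + v) ->
  `|F (x + v) - F x - 'D_v F x| <= #|cidx cV|%:R * C * `|v| ^+ 2.
Proof.
move=> cA C0 dF hC x v Ax Axv.
have As s : 0 <= s <= 1 -> A (x + s *: v) by exact: cA.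
set K := #|cidx cV|%:R * C * `|v| ^+ 2.
have hb (t : R) : 0 <= t <= 1 -> is_derive t (1 : R) (fun s : R => s * K) K.
  by move=> _; apply: is_derive_eq; rewrite /= scaler0 add0r [_ *: _]mulr1.
have hg (t : R) : 0 <= t <= 1 -> is_derive t (1 : R)
    (fun s : R => F (x + s *: v) - s *: 'D_v F x) ('D_v F (x + t *: v) - 'D_v F x).
  move=> tT; apply: is_deriveB; first exact: is_derive_along (dF _ (As t tT)).
  have := is_derive_line 0 ('D_v F x) t.
  by under eq_fun do rewrite add0r.
have hM (t : R) : 0 <= t <= 1 -> `|'D_v F (x + t *: v) - 'D_v F x| <= K.
  move=> /[dup] tT /andP[t0 t1].
  rewrite !(derive_coord cV _ (dF _ _)) //; last exact: As.
  rewrite -sumrB; apply: le_trans (ler_norm_sum _ _ _) _.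
  apply: le_trans (_ : \sum_(j : cidx cV) C * `|v| ^+ 2 <= _); last first.
    by rewrite sumr_const /K -[leRHS]mulrA mulr_natl.
  apply: ler_sum => j _; rewrite -scalerBr normrZ mulrC expr2 mulrA.
  apply: ler_pM => //; last exact: coord_le.
  apply: le_trans (hC _ _ _ Ax (As _ tT)) _; apply: ler_wpM2l => //.
  rewrite addrC addKr normrZ ger0_norm //.
  by rewrite -[leRHS]mul1r; apply: ler_wpM2r.
have := mean_value_ineq cW ler01 hg hb hM.
by rewrite !scale1r !scale0r addr0 subr0 mul0r mul1r subr0 [F (x + v) - _ - _]addrAC.
Qed.

Lemma continuous_bounded_ball V W (cV : coordsys V) (G : V -> W) (M : R) :
  (forall z, `|z| <= M -> {for z, continuous G}) ->
  exists C : R, 0 < C /\ forall z, `|z| <= M -> `|G z| <= C.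
Proof.
move=> cG.
have cGA : {within [set z : V | `|z| <= M], continuous G}.
  by apply: continuous_in_subspaceT => z /[!inE]; exact: cG.
have /compact_bounded[C [_ hC]] := continuous_compact cGA (@coord_compact R V cV M).
exists (`|C| + 1); split; first by have := normr_ge0 C; lra.
move=> z zM; apply: (hC (`|C| + 1)); last by exists z.
by have := ler_norm C; lra.
Qed.

Lemma smooth_derive_bounded_ball V W (cV : coordsys V) (F : V -> W) (M : R) :
  smooth_on setT F ->
  exists C : R, 0 < C /\ forall j z, `|z| <= M -> `|'D_(cvec cV j) F z| <= C.
Proof.
move=> sF.
apply: (@finite_bound (cidx cV)
  (fun j C => forall z, `|z| <= M -> `|'D_(cvec cV j) F z| <= C)) => [j|j C C' CC' h z zM].
  apply: (continuous_bounded_ball cV) => z _.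
  exact: (smooth_on_continuous (A := setT) (smooth_on_derive _ sF)).
by apply: le_trans (h z zM) CC'.
Qed.

Lemma mulrn_add1_gt0 (n : nat) (C : R) : 0 < C -> 0 < n%:R * C + 1.
Proof. by move=> C0; rewrite ltr_wpDl // mulr_ge0 // ltW. Qed.

Lemma lipschitz_ball V W (cV : coordsys V) (cW : coordsys W) (F : V -> W) (M : R) :
  smooth_on setT F -> exists L : R, 0 < L /\
  forall x y, `|x| <= M -> `|y| <= M -> `|F y - F x| <= L * `|y - x|.
Proof.
move=> sF; have [C [C0 hC]] := smooth_derive_bounded_ball cV M sF.
exists (#|cidx cV|%:R * C + 1); split.
  exact: mulrn_add1_gt0.
move=> x y xM yM; apply: (@le_trans _ _ (#|cidx cV|%:R * C * `|y - x|)).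
  have cA := convex_ball cV (p := 0) (e := M).
  apply: (lipschitz_convex cW (F := F) (C := C) cA) => [z _|j z /=| |];
    rewrite /= ?subr0 //; last exact: hC.
  exact: (smooth_on_differentiable (A := setT)).
by apply: ler_wpM2r => //; lra.
Qed.

Lemma taylor2_ball V W (cV : coordsys V) (cW : coordsys W) (F : V -> W) (M : R) :
  smooth_on setT F -> exists C : R, 0 < C /\
  forall x v, `|x| <= M -> `|x + v| <= M ->
  `|F (x + v) - F x - 'D_v F x| <= C * `|v| ^+ 2.
Proof.
move=> sF.
have [L [L0 hL]] : exists C : R, 0 < C /\ forall j x y, `|x| <= M -> `|y| <= M ->
    `|'D_(cvec cV j) F y - 'D_(cvec cV j) F x| <= C * `|y - x|.
  apply: (@finite_bound (cidx cV) (fun j C => forall x y, `|x| <= M -> `|y| <= M ->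
    `|'D_(cvec cV j) F y - 'D_(cvec cV j) F x| <= C * `|y - x|)) => [j|j C C' CC' h x y xM yM].
    by apply: lipschitz_ball => //; exact: smooth_on_derive.
  by apply: le_trans (h x y xM yM) _; exact: ler_wpM2r.
exists (#|cidx cV|%:R * L + 1); split.
  exact: mulrn_add1_gt0.
move=> x v xM vM; apply: (@le_trans _ _ (#|cidx cV|%:R * L * `|v| ^+ 2)).
  have cA := convex_ball cV (p := 0) (e := M).
  apply: (taylor2_convex (F := F) cW cA (ltW L0)) => [z _|j a b /=| |];
    rewrite /= ?subr0 //; last exact: hL.
  exact: (smooth_on_differentiable (A := setT)).
by apply: ler_wpM2r; [exact: exprn_ge0|lra].
Qed.

Lemma nbhs_ball_le V (A : set V) (p : V) : nbhs p A ->
  exists2 e : R, 0 < e & forall z, `|z - p| <= e -> A z.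
Proof.
move=> /nbhs_normP[e /= e0 eA]; exists (e / 2); first by rewrite divr_gt0.
move=> z ze; apply: eA; rewrite /= distrC; apply: le_lt_trans ze _; lra.
Qed.

Lemma ball_le_nbhs V (A : set V) (p : V) (e : R) : 0 < e ->
  (forall z, `|z - p| <= e -> A z) -> nbhs p A.
Proof.
move=> e0 eA; apply/nbhs_normP; exists e => //= z ze.
by apply: eA; rewrite distrC; exact: ltW.
Qed.

Lemma continuous_bounded_near V W (G : V -> W) (p : V) :
  {for p, continuous G} -> exists2 C : R, 0 < C & \forall z \near p, `|G z| <= C.
Proof.
move=> cG; exists (`|G p| + 1); first by have := normr_ge0 (G p); lra.
have /cvgrPdist_le/(_ 1 ltr01) := cG; apply: filterS => z h.
rewrite -[G z](subrK (G p)); apply: le_trans (ler_normD _ _) _.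
by rewrite addrC lerD2l distrC.
Qed.

Lemma lipschitz_near V W (cV : coordsys V) (cW : coordsys W) (A : set V)
    (F : V -> W) (p : V) : open A -> A p -> smooth_on A F ->
  exists (L e : R), [/\ 0 < L, 0 < e & forall x y, `|x - p| <= e -> `|y - p| <= e ->
    `|F y - F x| <= L * `|y - x|].
Proof.
move=> oA Ap sF.
have [C [C0 hC]] : exists C : R, 0 < C /\
    forall j, \forall z \near p, `|'D_(cvec cV j) F z| <= C.
  apply: (@finite_bound (cidx cV) (fun j C =>
    \forall z \near p, `|'D_(cvec cV j) F z| <= C)) => [j|j C C' CC'].
    have [C C0 hC] := continuous_bounded_near
      (smooth_on_continuous (smooth_on_derive (cvec cV j) sF) Ap).
    by exists C.
  by apply: filterS => z /le_trans; apply.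
have [e e0 he] : exists2 e : R, 0 < e & forall z, `|z - p| <= e ->
    A z /\ forall j, `|'D_(cvec cV j) F z| <= C.
  apply: nbhs_ball_le; apply: filterI; first exact: open_nbhs_nbhs.
  exact: filter_forall.
exists (#|cidx cV|%:R * C + 1), e; split=> //.
  exact: mulrn_add1_gt0.
move=> x y xe ye; apply: (@le_trans _ _ (#|cidx cV|%:R * C * `|y - x|)).
  have cA := convex_ball cV (p := p) (e := e).
  apply: (lipschitz_convex cW (F := F) (C := C) cA) => //= [z /he[Az _]|j z /he[_]] //.
  exact: smooth_on_differentiable sF Az.
by apply: ler_wpM2r => //; lra.
Qed.

End MeanValue.

(** * Symmetry of second derivatives *)

Section Schwarz.
Context {R : realType}.
Implicit Types V W X : normedModType R.

Lemma derive_lin V W X (L : {linear W -> X}) (F : V -> W) z v :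
  continuous L -> differentiable F z -> 'D_v (fun y => L (F y)) z = L ('D_v F z).
Proof.
move=> cL dF; have dL : differentiable L (F z) by exact: linear_differentiable.
rewrite -[LHS]/('D_v (L \o F) z) (deriveE _ (differentiable_comp dF dL)).
by rewrite (diff_comp dF dL) /= diff_lin // -deriveE.
Qed.

(** Two mean value theorems: one in direction [v] for the difference of [F] and its translate by s
    w, then one in direction [w] for D_v F. The intermediate point lies in any prescribed
    neighborhood once s is small. *)
Lemma near_mixed_difference V (A : set V) (F : V -> R) (z v w : V) :
  open A -> A z -> smooth_on A F ->
  forall P : set V, nbhs z P -> \forall s \near (0 : R)^'+,
  exists2 y, P y & F (z + s *: v + s *: w) - F (z + s *: v)
    - (F (z + s *: w) - F z) = s ^+ 2 * 'D_w ('D_v F) y.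
Proof.
move=> oA Az sF P zP.
have [e e0 he] : exists2 e : R, 0 < e & forall y, `|y - z| <= e -> A y /\ P y.
  by apply: nbhs_ball_le; apply: filterI => //; exact: open_nbhs_nbhs.
(* Bounds |v| + |w|, so that the parallelogram with sides s v and s w stays within distance e of z
   as soon as s < e / B. *)
pose B := `|v| + `|w| + 1.
have B0 : 0 < B by rewrite /B; have := normr_ge0 v; have := normr_ge0 w; lra.
have eB0 : 0 < e / B by rewrite divr_gt0.
near=> s.
have s0 : 0 < s by near: s; exact: nbhs_right_gt.
have se : s < e / B by near: s; exact: nbhs_right_lt.
have box (a b : R) : 0 <= a <= s -> 0 <= b <= s ->
    A (z + a *: v + b *: w) /\ P (z + a *: v + b *: w).
  move=> /andP[a0 as_] /andP[b0 bs]; apply: he.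
  rewrite -[z + _ + _]addrA [z + _]addrC addrK; apply: le_trans (ler_normD _ _) _.
  rewrite !normrZ !ger0_norm //.
  have := ler_wpM2r (normr_ge0 v) as_; have := ler_wpM2r (normr_ge0 w) bs.
  move: se; rewrite ltr_pdivlMr // /B => se; nra.
have dF y : A y -> differentiable F y by move=> Ay; exact: smooth_on_differentiable sF Ay.
have dFv y : A y -> differentiable ('D_v F) y.
  by move=> Ay; exact: smooth_on_differentiable (smooth_on_derive v sF) Ay.
have mvt (f df : R -> R) : (forall t, 0 <= t <= s -> is_derive t (1 : R) f (df t)) ->
    exists2 c, 0 <= c <= s & f s - f 0 = s * df c.
  move=> hf; have [||c /[!in_itv]/= cs e'] := @MVT_segment R f df 0 s (ltW s0).
  - by move=> t /[!in_itv]/= /andP[t0 ts]; apply: hf; rewrite !ltW.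
  - apply: derivable_within_continuous => t /[!in_itv]/= ts.
    by have [] := hf t ts.
  - by exists c; rewrite // e' subr0 mulrC.
have [|a as_ ha] := mvt (fun t => F (z + s *: w + t *: v) - F (z + t *: v))
  (fun t => 'D_v F (z + s *: w + t *: v) - 'D_v F (z + t *: v)).
  move=> t ts; apply: is_deriveB; apply: is_derive_along; apply: dF.
    by rewrite addrAC; have [] := box t s ts; rewrite ?lexx ?ltW.
  by have [] := box t 0 ts; rewrite ?lexx ?ltW // scale0r addr0.
have [|b bs hb] := mvt (fun t => 'D_v F (z + a *: v + t *: w))
  (fun t => 'D_w ('D_v F) (z + a *: v + t *: w)).
  by move=> t ts; apply: is_derive_along; apply: dFv; have [] := box a t as_ ts.
exists (z + a *: v + b *: w); first by have [] := box a b as_ bs.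
rewrite expr2 -mulrA -hb scale0r addr0 [z + a *: v + _]addrAC -ha.
by rewrite !scale0r !addr0 [z + s *: v + _]addrAC.
Unshelve. all: by end_near. Qed.

Lemma dist_half (a b y e : R) :
  `|a - y| <= e / 2 -> `|b - y| <= e / 2 -> `|a - b| <= e.
Proof. by rewrite !ler_norml => /andP[? ?] /andP[? ?]; apply/andP; split; lra. Qed.

(** The second difference is symmetric in [v] and [w]. Dividing its two expressions by s^2
    identifies values of the two mixed derivatives at points tending to z, and both are
    continuous. *)
Lemma schwarz_scalar V (A : set V) (F : V -> R) (z v w : V) :
  open A -> A z -> smooth_on A F -> 'D_w ('D_v F) z = 'D_v ('D_w F) z.
Proof.
move=> oA Az sF; apply/eqP; rewrite -subr_eq0 -normr_le0; apply/ler_addgt0Pl => e e0.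
have e20 : 0 < e / 2 by rewrite divr_gt0.
have near_val u u' : \forall y \near z, `|'D_u ('D_u' F) z - 'D_u ('D_u' F) y| <= e / 2.
  have /cvgrPdist_le/(_ _ e20) // := smooth_on_continuous
    (smooth_on_derive u (smooth_on_derive u' sF)) Az.
have h1 := near_mixed_difference v w oA Az sF (near_val w v).
have h2 := near_mixed_difference w v oA Az sF (near_val v w).
have h3 : \forall s \near (0 : R)^'+, 0 < s by exact: nbhs_right_gt.
have [s [[[y1 hy1 e1] [y2 hy2 e2]] s0]] := filter_ex (filterI (filterI h1 h2) h3).
have swap (a b c d : R) : a - b - (c - d) = a - c - (b - d) by ring.
have ey : 'D_w ('D_v F) y1 = 'D_v ('D_w F) y2.
  have s20 : s ^+ 2 != 0 by rewrite expf_neq0 // lt0r_neq0.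
  move: e1; rewrite [z + s *: v + _]addrAC swap e2; move: s20.
  by move: (s ^+ 2) ('D_w _ _) ('D_v _ _) => a b c a0 /(mulfI a0).
rewrite addr0; move: hy1 hy2; rewrite /= ey.
exact: dist_half.
Qed.

Lemma schwarz V W (cW : coordsys W) (A : set V) (F : V -> W) (z v w : V) :
  open A -> A z -> smooth_on A F -> 'D_w ('D_v F) z = 'D_v ('D_w F) z.
Proof.
move=> oA Az sF.
have cc j u u' : coord cW j ('D_u ('D_u' F) z) = 'D_u ('D_u' (fun y => coord cW j (F y))) z.
  have cL := @continuous_coord _ _ cW j.
  have dF := smooth_on_differentiable (smooth_on_derive u' sF) Az.
  rewrite -(derive_lin _ cL dF).
  apply: near_eq_derive; apply: near_open oA Az _ => y Ay.
  by rewrite -(derive_lin _ cL (smooth_on_differentiable sF Ay)).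
apply: (coord_inj (cV := cW)) => j; rewrite !cc.
exact: schwarz_scalar (smooth_on_lin oA (@continuous_coord _ _ cW j) sF).
Qed.

(** Gronwall's inequality produces quadratic remainders, and C |v|^2 <= e |v| as soon as |v| is
    small. *)
Lemma quadratic_differentiable V W (F : V -> W) (z : V) (L : {linear V -> W})
    (K C : R) :
  (forall v, `|L v| <= K * `|v|) ->
  (\forall v \near (0 : V), `|F (z + v) - F z - L v| <= C * `|v| ^+ 2) ->
  differentiable F z /\ forall v, 'D_v F z = L v.
Proof.
move=> hL hF.
have [dF dFL] : differentiable F z /\ 'd F z = L :> (V -> W).
  apply: eps_differentiable; first exact: linear_le_continuous hL.
  move=> e e0.
  have C1 : 0 < `|C| + 1 by have := normr_ge0 C; lra.
  have : \forall v \near (0 : V), `|v| <= e / (`|C| + 1).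
    apply/nbhs_normP; exists (e / (`|C| + 1)); first by rewrite /= divr_gt0.
    by move=> v /=; rewrite sub0r normrN => /ltW.
  apply: filterS2 hF => v hv ve; apply: le_trans hv _.
  rewrite expr2 mulrA; apply: ler_wpM2r => //.
  move: ve; rewrite ler_pdivlMr // => ve.
  have := ler_wpM2r (normr_ge0 v) (ler_norm C); have := normr_ge0 v; lra.
by split=> // v; rewrite deriveE // dFL.
Qed.

End Schwarz.

(** * Flows of smooth vector fields *)

Section ODE.
Context {R : realType}.
Implicit Types V W X : normedModType R.

Lemma primitive (f : R -> R) : continuous f ->
  exists G : R -> R, G 0 = 0 /\
    forall t : R, 0 <= t <= 1 -> is_derive t (1 : R) G (f t).
Proof.
move=> cf.
(* The integral starts at -1, and the integrand is taken integrable up to 2, so that every point of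
   [0, 1] is interior and the derivative is two-sided at both ends. *)
pose F (x : R) := (\int[lebesgue_measure]_(t in [set` Interval (BLeft (- 1 : R)) (BRight x)]) f t).
have dF (t : R) : 0 <= t <= 1 -> is_derive t (1 : R) F (f t).
  move=> /andP[t0 t1].
  have t2 : t < 2 by lra.
  have fi : lebesgue_measure.-integrable
      [set` Interval (BLeft (- 1 : R)) (BRight (2 : R))] (EFin \o f).
    apply: continuous_compact_integrable; first exact: segment_compact.
    exact: continuous_subspaceT.
  have [|dF dFE] := continuous_FTC1 t2 fi _ (cf t).
    by rewrite /= lte_fin; lra.
  by apply: DeriveDef; [exact: dF|rewrite -derive1E; exact: dFE].
exists (fun t => F t - F 0); split=> [|t tT]; first by rewrite subrr.
have := is_deriveB (dF t tT) (is_derive_cst (F 0) t (1 : R)).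
by rewrite subr0.
Qed.

Lemma primitive_vec V (cV : coordsys V) (f : R -> V) : continuous f ->
  exists G : R -> V, G 0 = 0 /\ forall t : R, 0 <= t <= 1 -> is_derive t 1 G (f t).
Proof.
move=> cf.
have /choice[G hG] j : exists G : R -> R, G 0 = 0 /\
    forall t : R, 0 <= t <= 1 -> is_derive t (1 : R) G (coord cV j (f t)).
  apply: primitive => t; apply: continuous_comp; first exact: cf.
  exact: continuous_coord.
exists (fun t => \sum_j G j t *: cvec cV j); split.
  by rewrite big1 // => j _; rewrite (hG j).1 scale0r.
move=> t tT; rewrite (coord_sum cV (f t)).
have hj j : is_derive t (1 : R) (fun s => G j s *: cvec cV j)
    (coord cV j (f t) *: cvec cV j).
  have lin : linear (fun a : R => a *: cvec cV j).
    by move=> a u w; rewrite scalerDl scalerA.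
  pose L : {linear R -> V} := HB.pack (fun a : R => a *: cvec cV j)
    (GRing.isLinear.Build R R V *:%R _ lin).
  have cL : continuous L.
    by apply: (linear_le_continuous (C := `|cvec cV j|)) => a; rewrite /= normrZ mulrC.
  exact: is_derive_lin cL ((hG j).2 t tT).
elim: (index_enum _) => [|i s IH].
  rewrite big_nil; have := is_derive_cst (0 : V) t (1 : R).
  by congr is_derive; apply/funext => x; rewrite big_nil.
rewrite big_cons; have := is_deriveD (hj i) IH.
by congr is_derive; apply/funext => x; rewrite big_cons.
Qed.

Lemma is_derive_scale (k : R) (f : R -> R) (t df : R) :
  is_derive t (1 : R) f df -> is_derive t (1 : R) (fun s => k * f s) (k * df).
Proof. exact: (@is_deriveZ R R R f k t 1 df). Qed.

Lemma is_derive_mulr_line (t e : R) : is_derive t (1 : R) (fun s : R => s * e) e.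
Proof. by apply: is_derive_eq; rewrite /= scaler0 add0r [_ *: _]mulr1. Qed.

Lemma is_derive_exp (K t : R) :
  is_derive t (1 : R) (fun s => expR (K * s)) (K * expR (K * t)).
Proof.
have h := is_derive1_comp (is_derive_expR (K * t)) (is_deriveZ K (is_derive_id t (1 : R))).
by apply: is_derive_eq h _; rewrite [_ *: _]mulr1 mulrC.
Qed.

(** Instead of an integral inequality, the maximum S of |g| / exp(2 L t) over [0, 1] is estimated at
    the point where it is attained; the weight 2 L makes the linear term contribute at most half of
    the maximum, which is absorbed. *)
Lemma gronwall V (cV : coordsys V) (g dg : R -> V) (L e : R) : 0 < L -> 0 <= e ->
  (forall t : R, 0 <= t <= 1 -> is_derive t 1 g (dg t)) ->
  (forall t : R, 0 <= t <= 1 -> `|dg t| <= L * `|g t| + e) ->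
  forall t : R, 0 <= t <= 1 -> `|g t| <= 2 * (`|g 0| + e) * expR (2 * L).
Proof.
move=> L0 e0 hg hd.
pose E t : R := expR (2 * L * t).
have E0 t : 0 < E t by exact: expR_gt0.
have E00 : E 0 = 1 by rewrite /E mulr0 expR0.
have cg : {within `[0, 1], continuous g}.
  by apply: derivable_within_continuous => t /[!in_itv]/= /hg[].
have [c /[!in_itv]/= c01 hc] : exists2 c, c \in `[0, 1] &
    forall t, t \in `[0, 1] -> `|g t| / E t <= `|g c| / E c.
  apply: (@EVT_max R (fun t => `|g t| / E t)) => //.
  move=> t; apply: cvgM; first by apply: cvg_norm; exact: cg.
  apply: cvgV; first exact: lt0r_neq0.
  apply: continuous_subspaceT => s; apply: differentiable_continuous.
  by apply/derivable1_diffP; have [] := is_derive_exp (2 * L) s.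
set S := `|g c| / E c in hc.
have S0 : 0 <= S by rewrite divr_ge0 // ltW.
have gS t : 0 <= t <= 1 -> `|g t| <= S * E t.
  by move=> tT; rewrite -ler_pdivrMr //; apply: hc; rewrite in_itv.
(* The derivative of (S / 2) exp(2 L s) is L S exp(2 L s), which dominates L |g s| by the choice of
   S. *)
have hb (t : R) : 0 <= t <= c -> is_derive t (1 : R)
    (fun s => S / 2 * E s + s * e) (L * (S * E t) + e).
  move=> _; have h := is_deriveD (is_derive_scale (S / 2) (is_derive_exp (2 * L) t))
    (is_derive_mulr_line t e).
  by apply: is_derive_eq h _; rewrite /E; field.
case/andP: c01 => c0 c1.
have T (t : R) : 0 <= t <= c -> 0 <= t <= 1 by move=> /andP[-> /le_trans ->].
have hgc (t : R) : 0 <= t <= c -> is_derive t 1 g (dg t) by move=> /T /hg.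
have hdc (t : R) : 0 <= t <= c -> `|dg t| <= L * (S * E t) + e.
  move=> /T tT; apply: le_trans (hd t tT) _; rewrite lerD2r.
  by rewrite ler_pM2l //; exact: gS.
have gc : `|g c| <= `|g 0| + (S / 2 * E c + c * e - (S / 2 * E 0 + 0 * e)).
  rewrite -lerBlDl; apply: le_trans (mean_value_ineq cV c0 hgc hb hdc).
  exact: lerB_dist.
have Sc : `|g c| = S * E c by rewrite /S divfK // lt0r_neq0.
have E1 : 1 <= E c by rewrite /E -expR0 ler_expR !mulr_ge0 // ltW.
have ce : c * e <= e by rewrite -[leRHS]mul1r ler_wpM2r.
have SE : S <= 2 * (`|g 0| + e).
  have hS : S <= S * E c by rewrite ler_peMr.
  move: gc; rewrite Sc E00 [S / 2 * E c]mulrAC.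
  by move: (S * E c) hS (`|g 0|) (c * e) ce => a hS b ce; lra.
move=> t /[dup] tT /andP[t0 t1]; apply: le_trans (gS t tT) _.
apply: ler_pM => //; first by rewrite expR_ge0.
by rewrite /E ler_expR -[leRHS]mulr1 ler_wpM2l // mulr_ge0 // ltW.
Qed.

End ODE.

(** * Existence of integral curves *)

Section Picard.
Context {R : realType}.
Implicit Types V W X : normedModType R.

Lemma geometric_eq0 (a C : R) : (forall n, a <= C / 2 ^+ n) -> a <= 0.
Proof.
move=> h; rewrite leNgt; apply/negP => a0.
have /cvgrPdist_lt/(_ a a0)[n _ hn] : (C / 2 ^+ k) @[k --> \oo] --> (0 : R).
  rewrite -[X in _ --> X](mulr0 C); apply: cvgM; first exact: cvg_cst.
  under eq_fun do rewrite -exprVn.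
  by apply: cvg_expr; rewrite ger0_norm ?invr_ge0 // invf_lt1 // ltr1n.
have := hn n (leqnn n); rewrite /= sub0r normrN => h'.
by have := lt_le_trans (le_lt_trans (ler_norm _) h') (h n); rewrite ltxx.
Qed.

Lemma geometric_small (e C : R) : 0 < e -> exists n : nat, C / 2 ^+ n <= e.
Proof.
move=> e0; have [//|/forallNP h] := pselect (exists n : nat, C / 2 ^+ n <= e).
have := @geometric_eq0 e C; rewrite leNgt e0 /= => /(_ _)/negP; case=> // n.
by have /negP := h n; rewrite -ltNge => /ltW.
Qed.

(** The increments after the n-th sum to at most 2 C / 2^n, so subtracting or adding this bound
    turns u into an increasing or a decreasing sequence; the limit is the supremum of the former. *)
Lemma geometric_limit (u : nat -> R) (C : R) : 0 <= C ->
  (forall n, `|u n.+1 - u n| <= C / 2 ^+ n) ->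
  exists l, forall n, `|u n - l| <= 2 * C / 2 ^+ n.
Proof.
move=> C0 hu.
have E n : 2 * C / 2 ^+ n.+1 = C / 2 ^+ n :> R.
  by rewrite exprS; field; rewrite expf_neq0.
pose v n := u n - 2 * C / 2 ^+ n; pose w n := u n + 2 * C / 2 ^+ n.
have hd n : 2 * C / 2 ^+ n = C / 2 ^+ n + C / 2 ^+ n by field; rewrite expf_neq0.
have vS n : v n <= v n.+1 /\ w n.+1 <= w n.
  rewrite /v /w E hd; have := hu n; rewrite ler_norml => /andP[].
  by move: (C / 2 ^+ n) (u n) (u n.+1) => a b c; split; lra.
have vmono : {homo v : m n / (m <= n)%N >-> m <= n}.
  by apply: homo_leq => [//|? ? ? /le_trans|n]; [exact|have [] := vS n].
have wmono : {homo w : m n / (m <= n)%N >-> n <= m}.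
  by apply: homo_leq => [//|? ? ? h /le_trans|n]; [apply|have [] := vS n].
have vw m n : v m <= w n.
  apply: (@le_trans _ _ (v (maxn m n))); first by apply: vmono; exact: leq_maxl.
  apply: (@le_trans _ _ (w (maxn m n))); last by apply: wmono; exact: leq_maxr.
  rewrite /v /w; have : 0 <= 2 * C / 2 ^+ maxn m n.
    by rewrite divr_ge0 ?mulr_ge0 // exprn_ge0.
  by move: (2 * C / _) (u _) => a b; lra.
exists (sup (range v)) => n.
have hs : has_sup (range v).
  split; first by exists (v 0%N), 0%N.
  by exists (w 0%N) => _ [m _ <-]; exact: vw.
have h1 : v n <= sup (range v) by apply: ub_le_sup; [exact: hs.2|exists n].
have h2 : sup (range v) <= w n.
  by apply: ge_sup; [exact: hs.1|move=> _ [m _ <-]; exact: vw].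
move: h1 h2; rewrite /v /w ler_norml.
by move: (sup _) (2 * C / _) (u n) => a b c h1 h2; apply/andP; split; lra.
Qed.

Lemma geometric_limit_vec V (cV : coordsys V) (u : nat -> V) (C : R) : 0 <= C ->
  (forall n, `|u n.+1 - u n| <= C / 2 ^+ n) ->
  exists l, forall n, `|u n - l| <= 2 * C / 2 ^+ n.
Proof.
move=> C0 hu.
have /choice[l hl] j : exists l, forall n, `|coord cV j (u n) - l| <= 2 * C / 2 ^+ n.
  apply: geometric_limit => // n; rewrite -linearB.
  exact: le_trans (coord_le _ _ _) (hu n).
exists (\sum_j l j *: cvec cV j) => n.
apply: (coord_norm cV) => [|j].
  by rewrite divr_ge0 ?mulr_ge0 // exprn_ge0.
have -> : coord cV j (u n - \sum_i l i *: cvec cV i) = coord cV j (u n) - l j.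
  rewrite linearB linear_sum (bigD1 j) //= big1 => [|i ij].
    by rewrite linearZ /= coord_vec eqxx addr0 [_ *: _]mulr1.
  by rewrite linearZ /= coord_vec eq_sym (negbTE ij) scaler0.
exact: hl.
Qed.

(** Projection onto [a, b], 1-Lipschitz. It extends curves given on [0, 1] continuously to the line
    and, applied to coordinates, truncates vector fields. *)
Definition clamp (a b x : R) : R := Num.max a (Num.min b x).

Lemma clamp_itv a b x : a <= b -> a <= clamp a b x <= b.
Proof. by move=> ab; rewrite /clamp le_max lexx /= ge_max ab ge_min lexx. Qed.

Lemma clamp_id a b x : a <= x <= b -> clamp a b x = x.
Proof. by move=> /andP[ax xb]; rewrite /clamp min_r // max_r. Qed.

Lemma clamp_lip a b x y : `|clamp a b x - clamp a b y| <= `|x - y|.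
Proof.
wlog yx : x y / y <= x.
  move=> h; have [/h //|/ltW/h] := leP y x.
  by rewrite distrC [leRHS]distrC.
rewrite (@ger0_norm _ (x - y)) ?subr_ge0 // /clamp.
case: (leP b x) => ?; case: (leP b y) => ?; case: (leP a b) => ?;
case: (leP a x) => ?; case: (leP a y) => ?;
by rewrite ler_norml; apply/andP; split; lra.
Qed.

Lemma lip_continuous V W (F : V -> W) (L : R) :
  (forall x y, `|F x - F y| <= L * `|x - y|) -> continuous F.
Proof.
move=> hL x; apply/cvgrPdist_le => e e0.
have L0 : 0 < `|L| + 1 by have := normr_ge0 L; lra.
have eL : 0 < e / (`|L| + 1) by rewrite divr_gt0.
apply: (ball_le_nbhs eL) => y; rewrite ler_pdivlMr // distrC => xy.
apply: le_trans (hL x y) _; apply: le_trans xy; rewrite mulrC.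
by apply: ler_wpM2l => //; have := ler_norm L; lra.
Qed.

Lemma clamp_continuous a b : continuous (clamp a b).
Proof.
by apply: (@lip_continuous R R _ 1) => x y; rewrite mul1r clamp_lip.
Qed.

Lemma continuous_clamp V (g : R -> V) a b : a <= b ->
  (forall t, a <= t <= b -> {for t, continuous g}) ->
  continuous (fun t => g (clamp a b t)).
Proof.
move=> ab cg t; apply: (@continuous_comp _ _ _ (clamp a b) g).
  exact: clamp_continuous.
by apply: cg; exact: clamp_itv.
Qed.

Lemma is_derive_continuous V (g : R -> V) (t : R) dg :
  is_derive t 1 g dg -> {for t, continuous g}.
Proof. by move=> [dt _]; apply/differentiable_continuous/derivable1_diffP. Qed.

(* The Picard iteration contracts by 1/2 in the sup norm weighted by
   [expR (- 2 L t)], so one interval of existence suffices. *)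
Lemma picard V (cV : coordsys V) (f : R -> V -> V) (L : R) (x0 : V) : 0 < L ->
  (forall t x y, `|f t x - f t y| <= L * `|x - y|) ->
  (forall x : R -> V, continuous x -> continuous (fun s => f s (x s))) ->
  exists g : R -> V, g 0 = x0 /\
    forall t : R, 0 <= t <= 1 -> is_derive t 1 g (f t (g t)).
Proof.
move=> L0 lf cf.
(* The primitive is chosen as a total operator on functions, with a dummy value on discontinuous
   ones. *)
have /choice[P hP] (h : R -> V) : exists G : R -> V, continuous h ->
    G 0 = 0 /\ forall t : R, 0 <= t <= 1 -> is_derive t 1 G (h t).
  have [ch|nch] := pselect (continuous h); last by exists h.
  by have [G hG] := primitive_vec cV ch; exists G.
pose y (x : R -> V) t := x0 + P (fun s => f s (x s)) t.
have yd x : continuous x ->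
    forall t : R, 0 <= t <= 1 -> is_derive t 1 (y x) (f t (x t)).
  move=> cx t tT; have [_ /(_ t tT) h] := hP _ (cf x cx).
  by have := is_deriveD (is_derive_cst x0 t (1 : R)) h; rewrite add0r.
have y0 x : continuous x -> y x 0 = x0.
  by move=> cx; rewrite /y (hP _ (cf x cx)).1 addr0.
(* The iterates are frozen outside [0, 1], because primitives are taken of functions continuous on
   the whole line. *)
pose yc x (t : R) := y x (clamp 0 1 t).
have ycc x : continuous x -> continuous (yc x).
  by move=> cx; apply: continuous_clamp ler01 _ => t tT; exact: is_derive_continuous (yd x cx t tT).
pose u n := iter n yc (fun=> x0).
have uc n : continuous (u n).
  by elim: n => [|n IH]; [move=> t; exact: cvg_cst|exact: ycc].
have uS n t : u n.+1 t = y (u n) (clamp 0 1 t) by [].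
have uy n (t : R) : 0 <= t <= 1 -> u n.+1 t = y (u n) t by move=> tT; rewrite uS clamp_id.
pose E (t : R) := expR (2 * L * t).
have E0 t : 0 < E t by exact: expR_gt0.
have [M [M0 hM]] : exists M : R, 0 < M /\
    forall t : R, 0 <= t <= 1 -> `|u 1%N t - u 0%N t| <= M * E t.
  have [M [M0 hM]] : exists M : R, 0 < M /\
      forall t : R, `|t| <= 1 -> `|u 1%N t - u 0%N t| <= M.
    apply: (continuous_bounded_ball (@coordsysR R)) => t _.
    by apply: continuousB; [exact: (uc 1%N)|exact: (uc 0%N)].
  exists M; split=> // t /andP[t0 t1].
  apply: le_trans (hM t _) _; first by rewrite ger0_norm.
  rewrite ler_peMr //; first exact: ltW.
  by rewrite /E -expR0 ler_expR !mulr_ge0 // ltW.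
have hu n (t : R) : 0 <= t <= 1 -> `|u n.+1 t - u n t| <= M / 2 ^+ n * E t.
  elim: n t => [|n IH] t tT; first by rewrite expr0 divr1 hM.
  have t0 : 0 <= t by case/andP: tT.
  have sub (s : R) : 0 <= s <= t -> 0 <= s <= 1.
    by move=> /andP[-> /le_trans ->] //; case/andP: tT.
  have hg (s : R) : 0 <= s <= t -> is_derive s 1 (fun s => y (u n.+1) s - y (u n) s)
      (f s (u n.+1 s) - f s (u n s)).
    by move=> /sub sT; apply: is_deriveB; exact: yd.
  have hb (s : R) : 0 <= s <= t -> is_derive s (1 : R)
      (fun s => M / 2 ^+ n.+1 * E s) (L * (M / 2 ^+ n * E s)).
    move=> _; have h := is_derive_scale (M / 2 ^+ n.+1) (is_derive_exp (2 * L) s).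
    by apply: is_derive_eq h _; rewrite exprS /E; field; rewrite expf_neq0.
  have hd (s : R) : 0 <= s <= t ->
      `|f s (u n.+1 s) - f s (u n s)| <= L * (M / 2 ^+ n * E s).
    move=> /sub sT; apply: le_trans (lf _ _ _) _.
    by rewrite ler_pM2l //; exact: IH.
  have := mean_value_ineq cV t0 hg hb hd.
  rewrite !y0 // subrr subr0 -!uy // => /le_trans; apply.
  by rewrite gerBl mulr_ge0 ?divr_ge0 // ?ltW // exprn_gt0.
set C := M * E 1.
have C0 : 0 <= C by rewrite mulr_ge0 // ltW.
(* From [u 1] on, all iterates factor through [clamp], so the contraction estimate on [0, 1] bounds
   the increments on the whole line. *)
have hC n t : `|u n.+2 t - u n.+1 t| <= C / 2 ^+ n.
  rewrite (uS n.+1) (uS n); have cT := clamp_itv t (@ler01 R).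
  rewrite -!uy //; apply: le_trans (hu n.+1 _ cT) _.
  rewrite /C mulrAC; apply: ler_pM; rewrite ?mulr_ge0 ?invr_ge0 ?exprn_ge0 ?(ltW (E0 _)) ?(ltW M0) //.
    apply: ler_wpM2l; first exact: ltW.
    rewrite /E ler_expR ler_wpM2l ?mulr_ge0 ?(ltW L0) //; first by case/andP: cT.
  by rewrite lef_pV2 ?posrE ?exprn_gt0 // ler_eXn2l // ltr1n.
have /choice[x hx] t := geometric_limit_vec cV C0 (hC ^~ t).
have cx : continuous x.
  move=> t; apply/cvgrPdist_le => e e0.
  have [n hn] := geometric_small (2 * C) (divr_gt0 e0 (@ltr0n R 3)).
  have /cvgrPdist_le/(_ _ (divr_gt0 e0 (@ltr0n R 3))) := uc n.+1 t.
  apply: filterS => s hs.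
  have -> : x t - x s = (x t - u n.+1 t) + (u n.+1 t - u n.+1 s) + (u n.+1 s - x s).
    by vec cV.
  have := hx t n; rewrite distrC => ht; have hs' := hx s n.
  apply: le_trans (ler_normD _ _) _; have := ler_normD (x t - u n.+1 t) (u n.+1 t - u n.+1 s).
  move: (le_trans ht hn) (le_trans hs' hn) hs.
  by move: (`|x t - u n.+1 t + _|) (`|_|) (`|_|) (`|_|) => a b c d; lra.
(* The limit is a fixed point: y x is compared with y (u (n+1)) = u (n+2), and both that difference
   and u (n+2) - x are O(1 / 2^n). *)
have yx (t : R) : 0 <= t <= 1 -> y x t = x t.
  move=> tT; apply/eqP; rewrite -subr_eq0 -normr_le0.
  apply: (@geometric_eq0 _ (L * (2 * C) + 2 * C)) => n.
  have t0 : 0 <= t by case/andP: tT.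
  have sub (s : R) : 0 <= s <= t -> 0 <= s <= 1.
    by move=> /andP[-> /le_trans ->] //; case/andP: tT.
  have hg (s : R) : 0 <= s <= t -> is_derive s 1 (fun s => y x s - y (u n.+1) s)
      (f s (x s) - f s (u n.+1 s)).
    by move=> /sub sT; apply: is_deriveB; exact: yd.
  have hb (s : R) : 0 <= s <= t -> is_derive s (1 : R)
      (fun s => s * (L * (2 * C / 2 ^+ n))) (L * (2 * C / 2 ^+ n)).
    by move=> _; exact: is_derive_mulr_line.
  have hd (s : R) : 0 <= s <= t ->
      `|f s (x s) - f s (u n.+1 s)| <= L * (2 * C / 2 ^+ n).
    by move=> _; apply: le_trans (lf _ _ _) _; rewrite ler_pM2l // distrC.
  have := mean_value_ineq cV t0 hg hb hd.
  rewrite !y0 // subrr subr0 -uy // mul0r subr0 => h1.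
  have h2 := hx t n.+1.
  have -> : y x t - x t = (y x t - u n.+2 t) + (u n.+2 t - x t) by rewrite addrA subrK.
  apply: le_trans (ler_normD _ _) _.
  rewrite mulrDl -(mulrA L); apply: lerD.
    apply: le_trans h1 _; rewrite -[leRHS]mul1r; apply: ler_wpM2r.
      apply: mulr_ge0; first exact: ltW.
      by apply: divr_ge0; [exact: mulr_ge0|exact: exprn_ge0].
    by case/andP: tT.
  apply: le_trans h2 _; apply: ler_wpM2l; first by rewrite mulr_ge0.
  by rewrite lef_pV2 ?posrE ?exprn_gt0 // ler_eXn2l // ltr1n.
exists (y x); split; first exact: y0.
by move=> t tT; rewrite yx //; exact: yd.
Qed.

End Picard.

(** * Dependence on initial values and the variational equation *)

Section SmoothFlow.
Context {R : realType}.
Implicit Types V W X : normedModType R.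

Definition fst_lin V W (q : V * W) : V := q.1.

Definition snd_lin V W (q : V * W) : W := q.2.

HB.instance Definition _ V W := GRing.isLinear.Build R (V * W)%type V *:%R
  (@fst_lin V W) (fun a x y => erefl).

HB.instance Definition _ V W := GRing.isLinear.Build R (V * W)%type W *:%R
  (@snd_lin V W) (fun a x y => erefl).

Lemma fst_lin_continuous V W : continuous (@fst_lin V W).
Proof.
apply: (linear_le_continuous (C := 1)) => v; rewrite mul1r.
by have := lexx `|v|; rewrite norm_pair_le => /andP[].
Qed.

Lemma snd_lin_continuous V W : continuous (@snd_lin V W).
Proof.
apply: (linear_le_continuous (C := 1)) => v; rewrite mul1r.
by have := lexx `|v|; rewrite norm_pair_le => /andP[].
Qed.

Lemma smooth_fst V W (A : set (V * W)) : open A -> smooth_on A (fun q => q.1).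
Proof.
by move=> oA; exact: (smooth_on_lin oA (@fst_lin_continuous V W) (smooth_on_id oA)).
Qed.

Lemma smooth_snd V W (A : set (V * W)) : open A -> smooth_on A (fun q => q.2).
Proof.
by move=> oA; exact: (smooth_on_lin oA (@snd_lin_continuous V W) (smooth_on_id oA)).
Qed.

Lemma is_derive_pair V W (f : R -> V) (g : R -> W) (t : R) df dg :
  is_derive t 1 f df -> is_derive t 1 g dg ->
  is_derive t 1 (fun s => (f s, g s)) (df, dg).
Proof.
move=> [dft <-] [dgt <-].
have f' : differentiable f t by apply/derivable1_diffP.
have g' : differentiable g t by apply/derivable1_diffP.
have fg' : differentiable (fun s => (f s, g s)) t := differentiable_pair f' g'.
apply: DeriveDef; first by apply/derivable1_diffP.
by rewrite (deriveE _ fg') (diff_pair f' g') /= -!deriveE.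
Qed.

Lemma derive_dirD V W (F : V -> W) z u v : differentiable F z ->
  'D_(u + v) F z = 'D_u F z + 'D_v F z.
Proof. by move=> dF; rewrite !deriveE // linearD. Qed.

Lemma derive_dirZ V W (F : V -> W) z (a : R) v : differentiable F z ->
  'D_(a *: v) F z = a *: 'D_v F z.
Proof. by move=> dF; rewrite !deriveE // linearZ. Qed.

Lemma derive_dirB V W (F : V -> W) z u v : differentiable F z ->
  'D_(u - v) F z = 'D_u F z - 'D_v F z.
Proof. by move=> dF; rewrite !deriveE // linearB. Qed.

Lemma smooth_derive_dir V W (cV : coordsys V) (cW : coordsys W) (F : V -> W) :
  smooth_on setT F -> smooth_on setT (fun q : V * V => 'D_(q.2) F q.1).
Proof.
move=> sF; have oT : open [set: V * V] by exact: openT.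
apply: (@smooth_on_ext _ _ _ _ (fun q : V * V =>
  \sum_j coord cV j q.2 *: 'D_(cvec cV j) F q.1)) => // [q _|].
  rewrite (derive_coord cV _ (smooth_on_differentiable (A := setT) sF _)) //.
apply: smooth_on_sum => // j; apply: (smooth_onZ cW) => //.
  exact: (smooth_on_lin oT (@continuous_coord _ _ cV j) (smooth_snd oT)).
apply: (smooth_on_comp (F := fun q : V * V => q.1) (G := 'D_(cvec cV j) F)
  cV cW (B := setT)) => //; first exact: smooth_fst.
exact: smooth_on_derive.
Qed.

(** Time is normalized to [0, 1]; a curve of [F] up to time t, of either sign, is recovered as a
    curve of the field t F. *)
Definition is_curve V (F : V -> V) (g : R -> V) :=
  forall t : R, 0 <= t <= 1 -> is_derive t 1 g (F (g t)).

Lemma curve_bounded V (F : V -> V) g : is_curve F g ->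
  exists M : R, forall t : R, 0 <= t <= 1 -> `|g t| <= M.
Proof.
move=> hg; have cg : continuous (fun t => g (clamp 0 1 t)).
  by apply: continuous_clamp ler01 _ => t /hg; exact: is_derive_continuous.
have [M [_ hM]] := continuous_bounded_ball (@coordsysR R) (M := 1) (fun t _ => cg t).
exists M => t /[dup] tT /andP[t0 t1].
by have := hM t; rewrite clamp_id // ger0_norm //; apply.
Qed.

Section OneField.
Context {V : normedModType R} (cV : coordsys V) (F : V -> V).
Hypothesis sF : smooth_on setT F.

Lemma field_differentiable z : differentiable F z.
Proof. exact: (smooth_on_differentiable (A := setT)). Qed.

Lemma derive_field_bounded (M : R) : exists L : R, 0 < L /\
  forall z v, `|z| <= M -> `|'D_v F z| <= L * `|v|.
Proof.
have [C [C0 hC]] := smooth_derive_bounded_ball cV M sF.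
exists (#|cidx cV|%:R * C + 1); split; first exact: mulrn_add1_gt0.
move=> z v zM; apply: le_trans (derive_le_coord (C := C) v (field_differentiable z) _) _.
  by move=> j; exact: hC.
by apply: ler_wpM2r => //; rewrite lerDl.
Qed.

(** Gronwall for the difference of two curves. The constant depends only on the ball containing
    them, as differentiating the flow requires. *)
Lemma curve_dist (M : R) : exists K : R, 0 < K /\ forall g1 g2 : R -> V,
  is_curve F g1 -> is_curve F g2 ->
  (forall t : R, 0 <= t <= 1 -> `|g1 t| <= M) ->
  (forall t : R, 0 <= t <= 1 -> `|g2 t| <= M) ->
  forall t : R, 0 <= t <= 1 -> `|g1 t - g2 t| <= K * `|g1 0 - g2 0|.
Proof.
have [L [L0 hL]] := lipschitz_ball cV cV M sF.
exists (2 * expR (2 * L)); split; first by rewrite mulr_gt0 // expR_gt0.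
move=> g1 g2 h1 h2 b1 b2 t tT.
have := gronwall cV (g := fun t => g1 t - g2 t)
  (dg := fun t => F (g1 t) - F (g2 t)) L0 (lexx 0) _ _ tT.
rewrite addr0 mulrAC; apply.
  by move=> s sT; apply: is_deriveB; [exact: h1|exact: h2].
by move=> s sT; rewrite addr0; apply: hL; [exact: b2|exact: b1].
Qed.

Lemma curve_unique g1 g2 : is_curve F g1 -> is_curve F g2 -> g1 0 = g2 0 ->
  forall t : R, 0 <= t <= 1 -> g1 t = g2 t.
Proof.
move=> h1 h2 g0 t tT.
have [M1 b1] := curve_bounded h1; have [M2 b2] := curve_bounded h2.
have [K [K0 hK]] := curve_dist (Num.max M1 M2).
apply/eqP; rewrite -subr_eq0 -normr_le0.
apply: le_trans (hK _ _ h1 h2 _ _ t tT) _.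
- by move=> s sT; rewrite le_max b1.
- by move=> s sT; rewrite le_max b2 // orbT.
- by rewrite g0 subrr normr0 mulr0.
Qed.

(** The linearized equation along a bounded curve is globally Lipschitz in its unknown, so the
    Picard theorem gives a solution on all of [0, 1]. *)
Lemma variational_exists g v : is_curve F g -> exists e : R -> V,
  e 0 = v /\ forall t : R, 0 <= t <= 1 -> is_derive t 1 e ('D_(e t) F (g t)).
Proof.
move=> hg; have [M gM] := curve_bounded hg.
have [L [L0 hL]] := derive_field_bounded M.
pose gc t := g (clamp 0 1 t).
have cg : continuous gc.
  by apply: continuous_clamp ler01 _ => t /hg; exact: is_derive_continuous.
have [||e [e0 he]] := @picard R V cV (fun t v => 'D_v F (gc t)) L v L0.
- move=> t x y; rewrite -derive_dirB; last exact: field_differentiable.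
  by apply: hL; apply: gM; exact: clamp_itv.
- move=> x cx t.
  apply: (@continuous_comp _ _ _ (fun s => (gc s, x s)) (fun q : V * V => 'D_(q.2) F q.1)).
    by apply: cvg_pair; [exact: cg|exact: cx].
  exact: (smooth_on_continuous (A := setT) (smooth_derive_dir cV cV sF)).
- by exists e; split=> // t tT; have := he t tT; rewrite /gc clamp_id.
Qed.

Lemma variational_bounded (M : R) : exists K : R, 0 < K /\ forall g e : R -> V,
  (forall t : R, 0 <= t <= 1 -> `|g t| <= M) ->
  (forall t : R, 0 <= t <= 1 -> is_derive t 1 e ('D_(e t) F (g t))) ->
  forall t : R, 0 <= t <= 1 -> `|e t| <= K * `|e 0|.
Proof.
have [L [L0 hL]] := derive_field_bounded M.
exists (2 * expR (2 * L)); split; first by rewrite mulr_gt0 // expR_gt0.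
move=> g e gM he t tT.
have := gronwall cV L0 (lexx 0) he _ tT; rewrite addr0 mulrAC; apply.
by move=> s sT; rewrite addr0; apply: hL; exact: gM.
Qed.

End OneField.

End SmoothFlow.

Section TimeOne.
Context {R : realType}.
Implicit Types V W X : normedModType R.

(** The tangent lift of [F]: its curves are pairs of a curve of [F] and a solution of the
    variational equation along it. *)
Definition tangent_field V (F : V -> V) (q : V * V) : V * V :=
  (F q.1, 'D_(q.2) F q.1).

Lemma smooth_tangent_field V (cV : coordsys V) (F : V -> V) :
  smooth_on setT F -> smooth_on setT (tangent_field F).
Proof.
move=> sF; have oT : open [set: V * V] by exact: openT.
apply: smooth_on_pair => //; last exact: smooth_derive_dir.
exact: (smooth_on_comp (F := fun q : V * V => q.1) cV cV (B := setT) oT _ (smooth_fst oT)).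
Qed.

(** The defect e3 - (a e1 + e2) solves the variational equation with zero initial value, hence
    vanishes. This makes the candidate derivative of the time-one map linear. *)
Lemma variational_linear V (cV : coordsys V) (F : V -> V) (g e1 e2 e3 : R -> V)
    (a : R) : smooth_on setT F -> is_curve F g ->
  (forall t : R, 0 <= t <= 1 -> is_derive t 1 e1 ('D_(e1 t) F (g t))) ->
  (forall t : R, 0 <= t <= 1 -> is_derive t 1 e2 ('D_(e2 t) F (g t))) ->
  (forall t : R, 0 <= t <= 1 -> is_derive t 1 e3 ('D_(e3 t) F (g t))) ->
  e3 0 = a *: e1 0 + e2 0 -> e3 1 = a *: e1 1 + e2 1.
Proof.
move=> sF hg h1 h2 h3 e0; have [M gM] := curve_bounded hg.
have dF := field_differentiable sF.
have [K [K0 hK]] := variational_bounded cV sF M.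
have h (t : R) : 0 <= t <= 1 -> is_derive t 1 (fun t => e3 t - (a *: e1 t + e2 t))
    ('D_(e3 t - (a *: e1 t + e2 t)) F (g t)).
  move=> tT; rewrite derive_dirB // derive_dirD // derive_dirZ //.
  apply: is_deriveB; first exact: h3.
  apply: is_deriveD; last exact: h2.
  exact: (@is_deriveZ R R V e1 a t 1 _ (h1 t tT)).
have T1 : 0 <= (1 : R) <= 1 by rewrite ler01 lexx.
have := hK _ _ gM h 1 T1; rewrite e0 subrr normr0 mulr0 normr_le0 subr_eq0.
by move=> /eqP.
Qed.

Lemma open_prod V W (A : set V) (B : set W) : open A -> open B ->
  open [set q : V * W | A q.1 /\ B q.2].
Proof.
move=> oA oB.
rewrite (_ : mkset _ = (@fst_lin R V W) @^-1` A `&` (@snd_lin R V W) @^-1` B) //.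
apply: openI; apply: open_comp => // q _.
  exact: fst_lin_continuous.
exact: snd_lin_continuous.
Qed.

Lemma open_ball_norm V (e : R) : open [set v : V | `|v| < e].
Proof.
rewrite (_ : mkset _ = (fun v : V => `|v|) @^-1` [set x : R | x < e]) //.
apply: open_comp => [v _|]; first exact: norm_continuous.
exact: open_lt.
Qed.

(* The derivative of the time-one map along [v] is the time-one value of the
   variational equation, that is, a component of the time-one map of the tangent
   field on [V * V], to which the induction hypothesis applies. *)
Lemma Ck_time_one k : forall V (cV : coordsys V) (F : V -> V) (A : set V) (M : R)
    (phi : V -> R -> V),
  smooth_on setT F -> open A ->
  (forall z, A z -> [/\ phi z 0 = z, is_curve F (phi z) &
     forall t : R, 0 <= t <= 1 -> `|phi z t| <= M]) ->
  Ck k A (fun z => phi z 1).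
Proof.
elim: k => [//|k IH] V cV F A M phi sF oA hphi.
have T1 : 0 <= (1 : R) <= 1 by rewrite ler01 lexx.
have dF := field_differentiable sF.
have /choice[eta heta] (q : V * V) : exists e : R -> V, A q.1 -> e 0 = q.2 /\
    forall t : R, 0 <= t <= 1 -> is_derive t 1 e ('D_(e t) F (phi q.1 t)).
  have [Aq|nAq] := pselect (A q.1); last by exists (fun=> 0).
  have [_ hc _] := hphi _ Aq.
  by have [e he] := variational_exists cV sF q.2 hc; exists e.
have [K [K0 hK]] := variational_bounded cV sF M.
have etaK q t : A q.1 -> 0 <= t <= 1 -> `|eta q t| <= K * `|q.2|.
  move=> Aq tT; have [e0 he] := heta q Aq; have [_ _ hM] := hphi _ Aq.
  by rewrite -e0; exact: hK hM he t tT.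
have der z : A z -> differentiable (fun z => phi z 1) z /\
    forall v, 'D_v (fun z => phi z 1) z = eta (z, v) 1.
  move=> Az; have [p0 pc pM] := hphi z Az.
  have lin : linear (fun v => eta (z, v) 1).
    move=> a u v; have h w := heta (z, w) Az.
    apply: (variational_linear cV sF pc (h u).2 (h v).2 (h _).2).
    by rewrite !(h _).1.
  pose L : {linear V -> V} := HB.pack (fun v => eta (z, v) 1)
    (GRing.isLinear.Build R V V *:%R _ lin).
  have hL v : `|L v| <= K * `|v| by have := etaK (z, v) 1 Az T1.
  have [C [C0 hC]] := taylor2_ball cV cV M sF.
  have [B [B0 hB]] := derive_field_bounded cV sF M.
  have [D [D0 hD]] := curve_dist cV sF M.
  apply: (quadratic_differentiable (L := L) (K := K)
    (C := 2 * (C * D ^+ 2) * expR (2 * B)) hL).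
  have : \forall v \near (0 : V), A (z + v).
    have : z + v @[v --> (0 : V)] --> z.
      by rewrite -[X in _ --> X]addr0; apply: cvgD; [exact: cvg_cst|exact: cvg_id].
    by apply; exact: open_nbhs_nbhs.
  apply: filterS => v Azv; have [q0 qc qM] := hphi _ Azv.
  have [e0 he] := heta (z, v) Az.
  (* The remainder of the first-order expansion of the flow solves the variational equation up to a
     forcing term bounded by C D^2 |v|^2, so Gronwall bounds it by a multiple of |v|^2. *)
  pose g t := phi (z + v) t - phi z t - eta (z, v) t.
  have g0 : g 0 = 0 by rewrite /g q0 p0 e0 [z + v]addrC addrK subrr.
  have hdist (t : R) : 0 <= t <= 1 -> `|phi (z + v) t - phi z t| <= D * `|v|.
    by move=> tT; have := hD _ _ qc pc qM pM t tT; rewrite q0 p0 [z + v]addrC addrK.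
  have hg (t : R) : 0 <= t <= 1 -> is_derive t 1 g
      (F (phi (z + v) t) - F (phi z t) - 'D_(eta (z, v) t) F (phi z t)).
    move=> tT; apply: is_deriveB; last exact: he.
    by apply: is_deriveB; [exact: qc|exact: pc].
  have hdg (t : R) : 0 <= t <= 1 ->
      `|F (phi (z + v) t) - F (phi z t) - 'D_(eta (z, v) t) F (phi z t)|
      <= B * `|g t| + C * D ^+ 2 * `|v| ^+ 2.
    move=> tT; set w := phi (z + v) t - phi z t.
    have pw : phi (z + v) t = phi z t + w by rewrite /w addrCA subrr addr0.
    have -> : F (phi (z + v) t) - F (phi z t) - 'D_(eta (z, v) t) F (phi z t)
      = 'D_(g t) F (phi z t) + (F (phi z t + w) - F (phi z t) - 'D_w F (phi z t)).
      by rewrite /g -/w derive_dirB // pw; vec cV.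
    apply: le_trans (ler_normD _ _) _; apply: lerD; first exact: hB (pM t tT).
    apply: le_trans (hC _ _ (pM t tT) _) _; first by rewrite -pw; exact: qM.
    rewrite -mulrA -exprMn; apply: ler_wpM2l; first exact: ltW.
    by apply: lerXn2r; rewrite ?nnegrE ?mulr_ge0 ?(ltW D0) //; exact: hdist.
  have e_ge0 : 0 <= C * D ^+ 2 * `|v| ^+ 2.
    by rewrite !mulr_ge0 ?exprn_ge0 ?(ltW C0) ?(ltW D0).
  have := gronwall cV B0 e_ge0 hg hdg T1; rewrite g0 normr0 add0r.
  have sw (a b c : R) : 2 * a * b * c = 2 * (a * c) * b by ring.
  by rewrite sw.
split=> [z Az|v]; first exact: (der z Az).1.
(* The induction hypothesis asks for one bound on all curves; restricting the tangent vector to a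
   ball that contains [v] provides it. *)
pose B := [set q : V * V | A q.1 /\ [set w : V | `|w| < `|v| + 1] q.2].
pose phi' (q : V * V) t := (phi q.1 t, eta q t).
have oB : open B by apply: open_prod => //; exact: open_ball_norm.
have cB : Ck k B (fun q => phi' q 1).
  apply: (IH _ (coordsys_prod cV cV) (tangent_field F) B
    (Num.max M (K * (`|v| + 1))) phi' (smooth_tangent_field cV sF) oB).
  move=> [z w] [/= Az wv]; have [p0 pc pM] := hphi z Az.
  have [e0 he] := heta (z, w) Az; split.
  - by rewrite /phi' /= p0 e0.
  - by move=> t tT; apply: is_derive_pair; [exact: pc|exact: he].
  - move=> t tT; rewrite norm_pair_le /= !le_max pM //=.
    apply/orP; right; apply: le_trans (etaK (z, w) t Az tT) _.
    by apply: ler_wpM2l; exact: ltW.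
have cA : Ck k A (fun z => (z, v)).
  by apply: Ck_pair => //; [exact: (smooth_onP _ _).1 (smooth_on_id oA) k|exact: Ck_cst].
apply: (Ck_ext oA (F := fun z => snd_lin (phi' (z, v) 1))) => [z Az|].
  by rewrite (der z Az).2.
apply: (Ck_lin oA (@snd_lin_continuous R V V)).
apply: (Ck_comp oA (coordsys_prod cV cV) (coordsys_prod cV cV)
  (B := B) (F := fun z => (z, v)) (G := fun q => phi' q 1)) => // z Az.
by split=> //=; rewrite ltrDl.
Qed.

Lemma smooth_time_one V (cV : coordsys V) (F : V -> V) (A : set V) (M : R)
    (phi : V -> R -> V) : smooth_on setT F -> open A ->
  (forall z, A z -> [/\ phi z 0 = z, is_curve F (phi z) &
     forall t : R, 0 <= t <= 1 -> `|phi z t| <= M]) ->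
  smooth_on A (fun z => phi z 1).
Proof.
by move=> sF oA hphi; apply/smooth_onP => k; exact: (Ck_time_one k cV sF oA hphi).
Qed.

End TimeOne.

(** * Local flows, their smoothness and group law *)

Section LocalFlow.
Context {R : realType} {V : normedModType R} (cV : coordsys V).

(** For [F := contact_vf H] this is [flow_rel H], and [vflow] is [flow H], by mere unfolding;
    results on general fields thus apply directly to the exact flows. *)
Definition flowto (F : V -> V) (t : R) (z w : V) : Prop :=
  exists g : R -> V, [/\ g 0 = z, g t = w &
    forall s : R, Num.min 0 t <= s <= Num.max 0 t -> is_derive s 1 g (F (g s))].

Definition vflow (F : V -> V) (t : R) (z : V) : V :=
  xget z [set w | flowto F t z w].

(** At t = 0 the equation is required at a single instant, so a straight line with the right
    velocity is a witness. *)
Lemma flowto0 F z : flowto F 0 z z.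
Proof.
exists (fun s => z + s *: F z); split; rewrite ?scale0r ?addr0 // => s.
rewrite minxx maxxx -eq_le => /eqP <-; rewrite scale0r addr0.
exact: is_derive_line.
Qed.

Lemma is_derive_reparam (g : R -> V) (a b s : R) dg :
  is_derive (a + b * s) 1 g dg -> is_derive s 1 (fun r : R => g (a + b * r)) (b *: dg).
Proof.
move=> hg; have dgt : differentiable g (a + b * s).
  by apply/derivable1_diffP; have [] := hg.
have hl : is_derive s (1 : R) (fun r : R => a + b * r) b.
  have h := is_deriveD (is_derive_cst a s (1 : R)) (is_derive_scale b (is_derive_id s (1 : R))).
  by apply: is_derive_eq h _; rewrite add0r mulr1.
have := is_derive_comp hl dgt.
have <- : 'D_(b *: (1 : R)) g (a + b * s) = b *: dg.
  by rewrite derive_dirZ // (@derive_val _ _ _ _ _ _ _ hg).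
by rewrite [b *: 1]mulr1.
Qed.

Lemma segment_mul (t s : R) : 0 <= s <= 1 -> Num.min 0 t <= t * s <= Num.max 0 t.
Proof.
move=> /andP[s0 s1]; have [t0|t0] := leP 0 t.
  by rewrite mulr_ge0 //= -[leRHS]mulr1 ler_wpM2l.
rewrite -[X in X <= _]mulr1 ler_wnM2l ?(ltW t0) //=.
by rewrite mulr_le0_ge0 // ltW.
Qed.

Lemma flowto_curve (F : V -> V) t z w : flowto F t z w ->
  exists g, [/\ g 0 = z, g 1 = w & is_curve (fun y => t *: F y) g].
Proof.
move=> [g [g0 gt hg]]; exists (fun s => g (0 + t * s)); split.
- by rewrite mulr0 addr0.
- by rewrite mulr1 add0r.
- move=> s sT; apply: is_derive_reparam; rewrite add0r; apply: hg.
  exact: segment_mul.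
Qed.

Lemma curve_flowto (F : V -> V) t g : is_curve (fun y => t *: F y) g ->
  flowto F t (g 0) (g 1).
Proof.
(* Time cannot be rescaled by 1 / t when t = 0; there the field t F is zero and the curve is
   constant. *)
move=> hg; have [t0|t0] := eqVneq t 0.
  rewrite t0.
  have -> : g 1 = g 0; last exact: flowto0.
  have T01 : 0 <= (1 : R) <= 1 by rewrite ler01 lexx.
  apply/eqP; rewrite -subr_eq0 -normr_le0.
  have hb (s : R) : 0 <= s <= 1 -> is_derive s (1 : R) (fun=> 0 : R) 0.
    by move=> _; exact: is_derive_cst.
  have hd (s : R) : 0 <= s <= 1 -> `|t *: F (g s)| <= 0.
    by rewrite t0 scale0r normr0.
  by have := mean_value_ineq cV ler01 hg hb hd; rewrite subrr.
exists (fun s => g (0 + t^-1 * s)); split.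
- by rewrite mulr0 addr0.
- by rewrite mulVf // add0r.
- move=> s hs; have -> : F (g (0 + t^-1 * s)) = t^-1 *: (t *: F (g (0 + t^-1 * s))).
    by rewrite scalerA mulVf // scale1r.
  apply: is_derive_reparam; apply: hg; rewrite add0r mulrC.
  move: hs; have [tp|tn] := ltP 0 t.
    move=> /andP[s0 st].
    by rewrite divr_ge0 ?(ltW tp) //= ler_pdivrMr // mul1r.
  have tn' : t < 0 by rewrite lt_neqAle t0.
  move=> /andP[ts s0].
  rewrite ler_ndivlMr // mul0r s0 /=.
  by rewrite ler_ndivrMr // mul1r.
Qed.

Lemma smooth_scaled (F : V -> V) t :
  smooth_on setT F -> smooth_on setT (fun y => t *: F y).
Proof.
move=> sF; have oT : open [set: V] by exact: openT.
by apply: (smooth_onZ cV) => //; exact: smooth_on_cst.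
Qed.

Lemma flowto_unique (F : V -> V) t z w w' : smooth_on setT F ->
  flowto F t z w -> flowto F t z w' -> w = w'.
Proof.
move=> sF /flowto_curve[g [g0 <- hg]] /flowto_curve[g' [g0' <- hg']].
by apply: (curve_unique cV (smooth_scaled t sF) hg hg'); rewrite ?g0 // ler01 lexx.
Qed.

Lemma vflow_eq (F : V -> V) t z w : smooth_on setT F ->
  flowto F t z w -> vflow F t z = w.
Proof.
move=> sF hw; apply: (flowto_unique (t := t) (z := z) sF _ hw).
by rewrite /vflow; case: xgetP => [y -> //|/(_ w)].
Qed.

Lemma vflow0 (F : V -> V) z : smooth_on setT F -> vflow F 0 z = z.
Proof. by move=> sF; apply: vflow_eq => //; exact: flowto0. Qed.

(** Retraction onto the ball of radius [M] that is 1-Lipschitz because the norm is the sup of the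
    coordinates; composing with it makes a smooth field globally Lipschitz. *)
Definition clampV (M : R) (v : V) : V := \sum_j clamp (- M) M (coord cV j v) *: cvec cV j.

Lemma coord_clampV M v j : coord cV j (clampV M v) = clamp (- M) M (coord cV j v).
Proof.
rewrite /clampV linear_sum (bigD1 j) //= big1 => [|i ij].
  by rewrite linearZ /= coord_vec eqxx addr0 [_ *: _]mulr1.
by rewrite linearZ /= coord_vec eq_sym (negbTE ij) scaler0.
Qed.

Lemma clampV_le M v : 0 <= M -> `|clampV M v| <= M.
Proof.
move=> M0; apply: (coord_norm cV) => // j; rewrite coord_clampV ler_norml.
by apply: clamp_itv; lra.
Qed.

Lemma clampV_id M v : `|v| <= M -> clampV M v = v.
Proof.
move=> vM; apply: (coord_inj (cV := cV)) => j; rewrite coord_clampV clamp_id //.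
by rewrite -ler_norml; apply: le_trans vM; exact: coord_le.
Qed.

Lemma clampV_lip M v w : `|clampV M v - clampV M w| <= `|v - w|.
Proof.
apply: (coord_norm cV) => // j; rewrite linearB /= !coord_clampV.
apply: le_trans (clamp_lip _ _ _ _) _; rewrite -linearB; exact: coord_le.
Qed.

(* Picard applies to the globally Lipschitz field [F \o clampV (M + 1)], whose
   curves stay for short times where the clamping is the identity. *)
Lemma local_curves (F : V -> V) (M : R) : smooth_on setT F -> 0 < M ->
  exists d : R, 0 < d /\ forall t z, `|t| < d -> `|z| <= M ->
  exists g : R -> V, [/\ g 0 = z, is_curve (fun y => t *: F y) g &
    forall s : R, 0 <= s <= 1 -> `|g s| <= M + 1].
Proof.
move=> sF M0.
have [L [L0 hL]] := lipschitz_ball cV cV (M + 1) sF.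
have [B [B0 hB]] : exists C : R, 0 < C /\ forall z, `|z| <= M + 1 -> `|F z| <= C.
  apply: (continuous_bounded_ball cV) => z _.
  exact: (smooth_on_continuous (A := setT)).
have M10 : 0 <= M + 1 by lra.
(* For |t| < 1 / B the field t F has norm at most 1 on the larger ball, so in unit time a curve
   moves by at most 1 and does not leave it. *)
exists B^-1; split=> [|t z td zM]; first by rewrite invr_gt0.
have tB : `|t| * B <= 1 by rewrite -ler_pdivlMr // mul1r ltW.
have K0 : 0 < B^-1 * L by rewrite mulr_gt0 // invr_gt0.
have [|| g [g0 hg]] := @picard R V cV (fun s y => t *: F (clampV (M + 1) y)) (B^-1 * L) z K0.
- move=> s x y; rewrite -scalerBr normrZ -mulrA.
  apply: ler_pM => //; first exact: ltW.
  apply: le_trans (hL _ _ (clampV_le _ M10) (clampV_le _ M10)) _.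
  by rewrite ler_pM2l // clampV_lip.
- move=> x cx s; apply: (@continuous_comp _ _ _ x (fun y => t *: F (clampV (M + 1) y))).
    exact: cx.
  apply: (@lip_continuous R V V _ (`|t| * L)) => a b.
  rewrite -scalerBr normrZ -mulrA; apply: ler_wpM2l => //.
  apply: le_trans (hL _ _ (clampV_le _ M10) (clampV_le _ M10)) _.
  by rewrite ler_pM2l // clampV_lip.
have gM (s : R) : 0 <= s <= 1 -> `|g s| <= M + 1.
  move=> /andP[s0 s1].
  have sub (r : R) : 0 <= r <= s -> 0 <= r <= 1.
    by move=> /andP[-> /le_trans ->].
  have hb (r : R) : 0 <= r <= s -> is_derive r (1 : R) (fun r : R => r * 1) 1.
    by move=> _; exact: is_derive_mulr_line.
  have hd (r : R) : 0 <= r <= s -> `|t *: F (clampV (M + 1) (g r))| <= 1.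
    move=> _; rewrite normrZ; apply: le_trans tB; apply: ler_wpM2l => //.
    by apply: hB; exact: clampV_le.
  have := mean_value_ineq cV s0 (fun r rs => hg r (sub r rs)) hb hd.
  rewrite g0 mul0r subr0 mulr1 => h.
  rewrite -[g s](subrK z); apply: le_trans (ler_normD _ _) _.
  by rewrite addrC; apply: lerD => //; exact: le_trans h s1.
exists g; split=> // s sT; have := hg s sT.
by rewrite clampV_id //; exact: gM.
Qed.

End LocalFlow.

Section FlowBox.
Context {R : realType} {V : normedModType R} (cV : coordsys V).
Variable F : V -> V.
Hypothesis sF : smooth_on setT F.

Definition flow_map (q : R * V) : V := vflow F q.1 q.2.

Definition box (d M : R) : set (R * V) := [set q | `|q.1| < d /\ `|q.2| < M].

Lemma open_box d M : open (box d M).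
Proof.
exact: (open_prod (@open_ball_norm R R d) (@open_ball_norm R V M)).
Qed.

(* The time-one map of this field is [(t, z) |-> (t, vflow F t z)]. *)
Lemma smooth_autonomous : smooth_on setT (fun q : R * V => (0 : R, q.1 *: F q.2)).
Proof.
have oT : open [set: R * V] by exact: openT.
apply: smooth_on_pair => //; first exact: smooth_on_cst.
apply: (smooth_onZ cV) => //; first exact: smooth_fst.
exact: (smooth_on_comp (F := fun q : R * V => q.2) cV cV (B := setT) oT _ (smooth_snd oT)).
Qed.

(** Carries the flow equation over to t = 0, where it is obtained as a limit. *)
Lemma continuous_punctured (W : normedModType R) (h : R -> W) :
  {for 0, continuous h} -> (\forall t \near (0 : R), t != 0 -> h t = 0) -> h 0 = 0.
Proof.
move=> ch hn; apply/eqP; rewrite -normr_le0 leNgt; apply/negP => h0.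
have /cvgrPdist_lt/(_ _ h0) h1 := ch.
have [e e0 he] := nbhs_ball_le (filterI hn h1).
have /he[h2 h3] : `|e - 0| <= e by rewrite subr0 ger0_norm // ltW.
by move: h3; rewrite /= h2 ?lt0r_neq0 // subr0 ltxx.
Qed.

(** The curves of the fields t F, put together, are the time-one map of the autonomous field above,
    which is smooth jointly in t and z. The differential equation in t then has to be read off from
    these rescaled curves. *)
Lemma flow_box (M : R) : 0 < M -> exists d : R, 0 < d /\
  [/\ forall (t : R) z, `|t| < d -> `|z| < M ->
        flowto F t z (vflow F t z) /\ `|vflow F t z| <= M + 1,
      smooth_on (box d M) flow_map &
      forall (t : R) z, `|t| < d -> `|z| < M ->
        is_derive t 1 (fun s => vflow F s z) (F (vflow F t z))].
Proof.
move=> M0; have [d [d0 hd]] := local_curves cV sF M0.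
have /choice[g hg] (q : R * V) : exists g : R -> V, `|q.1| < d -> `|q.2| < M ->
    [/\ g 0 = q.2, is_curve (fun y => q.1 *: F y) g &
      forall s : R, 0 <= s <= 1 -> `|g s| <= M + 1].
  have [[h1 /ltW h2]|nh] := pselect (`|q.1| < d /\ `|q.2| < M).
    by have [g hg] := hd _ _ h1 h2; exists g.
  by exists (fun=> 0) => h1 h2; case: nh.
have T1 : 0 <= (1 : R) <= 1 by rewrite ler01 lexx.
have gto (t : R) z (s : R) : `|t| < d -> `|z| < M -> 0 <= s <= 1 ->
    flowto F (t * s) z (g (t, z) s).
  move=> td zM /andP[s0 s1]; have [g0 gc gM] := hg (t, z) td zM.
  rewrite -[z in flowto _ _ z _]g0.
  have := @curve_flowto _ _ cV F (t * s) (fun r => g (t, z) (0 + s * r)).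
  rewrite mulr0 addr0 mulr1 add0r; apply=> r /andP[r0 r1].
  rewrite mulrC -scalerA; apply: is_derive_reparam; rewrite add0r; apply: gc.
  by rewrite mulr_ge0 //= -[leRHS]mulr1 ler_pM.
have gE (t : R) z (s : R) : `|t| < d -> `|z| < M -> 0 <= s <= 1 ->
    vflow F (t * s) z = g (t, z) s.
  by move=> td zM sT; apply: (vflow_eq cV sF); exact: gto.
have smooth : smooth_on (box d M) flow_map.
  have sm : smooth_on (box d M) (fun q => (q.1, g q 1)).
    apply: (smooth_time_one (phi := fun q s => (q.1, g q s)) (M := Num.max d (M + 1))
      (coordsys_prod (@coordsysR R) cV) smooth_autonomous (@open_box d M)).
    move=> [t z] [/= td zM]; have [g0 gc gM] := hg (t, z) td zM; split.
    - by rewrite g0.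
    - by move=> s sT; exact: is_derive_pair (is_derive_cst t s (1 : R)) (gc s sT).
    - by move=> s sT; rewrite norm_pair_le /= !le_max (ltW td) gM // orbT.
  have := smooth_on_lin (@open_box d M) (@snd_lin_continuous R R V) sm.
  apply: smooth_on_ext; first exact: open_box.
  by move=> [t z] [/= td zM]; rewrite /flow_map /= -gE // mulr1.
have derN0 (t : R) z : `|t| < d -> `|z| < M -> t != 0 ->
    is_derive t 1 (fun s => vflow F s z) (F (vflow F t z)).
  move=> td zM t0; have tp : 0 < `|t| by rewrite normr_gt0.
  (* A two-sided derivative at t needs the curve slightly beyond t, so t is placed inside the longer
     time c t; c is midway between 1 and d / |t|, which keeps |c t| < d. *)
  pose c := (1 + d / `|t|) / 2.
  have dt : 1 < d / `|t| by rewrite ltr_pdivlMr // mul1r.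
  have c1 : 1 < c by rewrite /c; lra.
  have c0 : 0 < c by lra.
  have cd : `|c * t| < d.
    have e : `|c * t| = (`|t| + d) / 2.
      by rewrite normrM (ger0_norm (ltW c0)) /c; field; rewrite lt0r_neq0.
    by rewrite e; lra.
  have ct0 : c * t != 0 by rewrite mulf_neq0 // lt0r_neq0.
  have [g0 gc _] := hg (c * t, z) cd zM.
  have ht : (c * t)^-1 * t = c^-1 by rewrite invfM -mulrA mulVf // mulr1.
  have h : is_derive t 1 (fun s => g (c * t, z) (0 + (c * t)^-1 * s)) (F (vflow F t z)).
    have -> : F (vflow F t z) = (c * t)^-1 *: ((c * t) *: F (vflow F t z)).
      by rewrite scalerA mulVf // scale1r.
    apply: is_derive_reparam; rewrite add0r ht.
    have cT : 0 <= c^-1 <= 1 by rewrite invr_ge0 (ltW c0) /= invf_le1 // ltW.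
    have -> : vflow F t z = g (c * t, z) c^-1.
      by rewrite -gE // mulrAC mulfV ?mul1r // lt0r_neq0.
    exact: gc.
  apply: (near_eq_is_derive _ h).
  have : \forall s \near t, (c * t)^-1 * s \in `]0, 1[.
    have cont : (c * t)^-1 * s @[s --> t] --> c^-1.
      by rewrite -ht; apply: cvgM; [exact: cvg_cst|exact: cvg_id].
    have : \forall x \near c^-1, x \in `]0, 1[.
      by apply: near_in_itvoo; rewrite in_itv /= invr_gt0 c0 invf_lt1.
    exact: cont.
  apply: filterS => s /[!in_itv]/= /andP[s0 s1].
  by rewrite add0r -gE ?mulrA ?mulfV ?mul1r // !ltW.
have derS (t : R) z : `|t| < d -> `|z| < M ->
    is_derive t 1 (fun s => vflow F s z) ('D_(1, 0) flow_map (t, z)).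
  move=> td zM.
  have h := is_derive_pair (is_derive_id t (1 : R)) (is_derive_cst z t (1 : R)).
  apply: (is_derive_comp (F := flow_map) h).
  by apply: (smooth_on_differentiable smooth).
exists d; split=> //; split=> // [t z td zM|t z td zM].
  have [g0 gc gM] := hg (t, z) td zM.
  have e : vflow F t z = g (t, z) 1 by rewrite -gE // mulr1.
  by have := gto t z 1 td zM T1; rewrite mulr1 e; split=> //; exact: gM.
(* No rescaled curve extends to both sides of time 0. Smoothness in (t, z) shows that the
   t-derivative exists there, and continuity gives its value. *)
have [t0|] := eqVneq t 0; last exact: derN0.
rewrite t0; suff <- : 'D_(1, 0) flow_map (0, z) = F (vflow F 0 z) by apply: derS; rewrite ?normr0.
apply/eqP; rewrite -subr_eq0; apply/eqP.
have b0 : box d M (0, z) by split=> //=; rewrite normr0.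
have cz : {for 0, continuous (fun t : R => (t, z))}.
  exact: is_derive_continuous (is_derive_pair (is_derive_id 0 (1 : R)) (is_derive_cst z 0 (1 : R))).
apply: (@continuous_punctured V (fun t => 'D_(1, 0) flow_map (t, z) - F (vflow F t z))).
  apply: continuousB.
    apply: (@continuous_comp _ _ _ (fun t : R => (t, z)) ('D_(1, 0) flow_map)) => //.
    exact: smooth_on_continuous (smooth_on_derive _ smooth) b0.
  apply: (@continuous_comp _ _ _ (fun t : R => (t, z)) (fun q => F (flow_map q))) => //.
  apply: (@continuous_comp _ _ _ flow_map F).
    exact: smooth_on_continuous smooth b0.
  exact: (smooth_on_continuous (A := setT)).
apply: (ball_le_nbhs (e := d / 2)); first by rewrite divr_gt0.
move=> s; rewrite subr0 => sd s0; have sd' : `|s| < d by lra.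
apply/eqP; rewrite subr_eq0; apply/eqP.
by rewrite -(@derive_val _ _ _ _ _ _ _ (derN0 s z sd' zM s0)) -(@derive_val _ _ _ _ _ _ _ (derS s z sd' zM)).
Qed.

(** s |-> vflow F (a + b s) z is a curve of b F that starts at vflow F a z, so uniqueness concludes;
    halving d keeps a + b s in the admissible range. *)
Lemma flow_group (M : R) : 0 < M -> exists d : R, 0 < d /\
  forall (a b : R) z, `|a| < d -> `|b| < d -> `|z| < M ->
  vflow F b (vflow F a z) = vflow F (a + b) z.
Proof.
move=> M0; have [d [d0 [hto _ hder]]] := flow_box M0.
exists (d / 2); split=> [|a b z ad bd zM]; first by rewrite divr_gt0.
apply: (vflow_eq cV sF).
have hc : is_curve (fun y => b *: F y) (fun s => vflow F (a + b * s) z).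
  move=> s /andP[s0 s1].
  apply: (is_derive_reparam (g := fun r => vflow F r z)); apply: hder => //.
  apply: le_lt_trans (ler_normD _ _) _; rewrite normrM (ger0_norm s0).
  by have := ler_wpM2l (normr_ge0 b) s1; lra.
by have := curve_flowto cV hc; rewrite mulr0 addr0 mulr1.
Qed.

End FlowBox.

(** * Expansions in powers of time *)

Section SmoothNear.
Context {R : realType}.
Implicit Types V W X : normedModType R.

(** How long flows exist depends on the starting point. Only some neighborhood of each point (0, z)
    matters, and this form is stable under composition without tracking domains. *)
Definition smooth_near V W (F : V -> W) (p : V) : Prop :=
  exists A : set V, [/\ open A, A p & smooth_on A F].

Lemma smooth_near_continuous V W (F : V -> W) p :
  smooth_near F p -> {for p, continuous F}.
Proof. by move=> [A [oA Ap sF]]; exact: smooth_on_continuous sF Ap. Qed.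

Lemma smooth_near_near V W (F : V -> W) p : smooth_near F p ->
  \forall q \near p, smooth_near F q.
Proof.
move=> [A [oA Ap sF]].
by apply: (near_open oA Ap) => q Aq; exists A; split.
Qed.

Lemma smooth_near_at V W (F : V -> W) p vs : smooth_near F p ->
  differentiable (iter_derive F vs) p.
Proof. by move=> [A [oA Ap sF]]; exact: sF. Qed.

Lemma smooth_near_on V W (A : set V) (F : V -> W) :
  (forall z, A z -> smooth_near F z) -> smooth_on A F.
Proof. by move=> h vs z /h; exact: smooth_near_at. Qed.

Lemma smooth_on_near V W (A : set V) (F : V -> W) p :
  open A -> A p -> smooth_on A F -> smooth_near F p.
Proof. by move=> oA Ap sF; exists A; split. Qed.

Lemma smooth_near_derive V W (F : V -> W) p v :
  smooth_near F p -> smooth_near ('D_v F) p.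
Proof. by move=> [A [oA Ap sF]]; exists A; split=> //; exact: smooth_on_derive. Qed.

Lemma open_preimage V W (A : set V) (B : set W) (F : V -> W) : open A -> open B ->
  (forall z, A z -> {for z, continuous F}) -> open [set z | A z /\ B (F z)].
Proof.
move=> oA oB cF; rewrite openE => z /= [Az Bz]; apply: filterI.
  exact: open_nbhs_nbhs.
by apply: (cF z Az); exact: open_nbhs_nbhs.
Qed.

Lemma smooth_near_comp V W X (cW : coordsys W) (cX : coordsys X) (F : V -> W)
    (G : W -> X) p :
  smooth_near F p -> smooth_near G (F p) -> smooth_near (fun z => G (F z)) p.
Proof.
move=> [A [oA Ap sF]] [B [oB Bp sG]].
have oAB : open [set z | A z /\ B (F z)].
  by apply: open_preimage => // z; exact: smooth_on_continuous sF.
exists [set z | A z /\ B (F z)]; split=> //.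
apply: (smooth_on_comp cW cX (B := B) oAB) => //; first by move=> z [].
by apply: smooth_onS sF => z [].
Qed.

Lemma smooth_near2 V W X (Y : normedModType R) (F : V -> W) (G : V -> X) (H : V -> Y) p :
  (forall A : set V, open A -> smooth_on A F -> smooth_on A G -> smooth_on A H) ->
  smooth_near F p -> smooth_near G p -> smooth_near H p.
Proof.
move=> h [A [oA Ap sF]] [B [oB Bp sG]]; exists (A `&` B).
have oAB := openI oA oB; split=> //; apply: h => //.
  by apply: smooth_onS sF => z [].
by apply: smooth_onS sG => z [].
Qed.

Lemma smooth_near_pair V W X (F : V -> W) (G : V -> X) p :
  smooth_near F p -> smooth_near G p -> smooth_near (fun z => (F z, G z)) p.
Proof. by apply: smooth_near2 => A oA; exact: smooth_on_pair. Qed.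

Lemma smooth_nearB V W (cW : coordsys W) (F G : V -> W) p :
  smooth_near F p -> smooth_near G p -> smooth_near (fun z => F z - G z) p.
Proof.
apply: smooth_near2 => A oA sF sG; apply: smooth_onD => //.
exact: smooth_onN.
Qed.

Lemma smooth_near_slice V W X (F : V * W -> X) (a : V) (w : W) (cV : coordsys V)
    (cW : coordsys W) (cX : coordsys X) :
  smooth_near F (a, w) -> smooth_near (fun z => F (a, z)) w.
Proof.
move=> sF; apply: (smooth_near_comp (coordsys_prod cV cW) cX
  (F := fun z => (a, z)) (G := F)) => //.
have oT : open [set: W] by exact: openT.
apply: (smooth_on_near oT) => //.
by apply: smooth_on_pair => //; [exact: smooth_on_cst|exact: smooth_on_id].
Qed.

Definition inr_lin V W (w : W) : V * W := (0, w).

Lemma inr_lin_is_linear V W : linear (@inr_lin V W).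
Proof. by move=> a u v; rewrite /inr_lin; congr pair; rewrite /= scaler0 addr0. Qed.

HB.instance Definition _ V W := GRing.isLinear.Build R W (V * W)%type *:%R
  (@inr_lin V W) (@inr_lin_is_linear V W).

Lemma slice_affine V W (t : V) (y : W) : (t, 0) + inr_lin V y = (t, y).
Proof. by congr pair; rewrite /= ?addr0 ?add0r. Qed.

Lemma iter_derive_slice V W X (F : V * W -> X) t vs y :
  iter_derive (fun y => F (t, y)) vs y = iter_derive F (map (@inr_lin V W) vs) (t, y).
Proof.
have -> : (fun y => F (t, y)) = (fun y => F ((t, 0) + inr_lin V y)).
  by apply/funext => x; rewrite slice_affine.
by rewrite iter_derive_affine slice_affine.
Qed.

Lemma derive_slice V W X (F : V * W -> X) t v y :
  'D_v (fun y => F (t, y)) y = 'D_(0, v) F (t, y).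
Proof. exact: (iter_derive_slice F t [:: v] y). Qed.

End SmoothNear.

Section Taylor.
Context {R : realType} {V : normedModType R} (cV : coordsys V).

Lemma derive_real (g : R -> V) (s t : R) dg :
  is_derive s 1 g dg -> differentiable g s /\ 'D_t g s = t *: dg.
Proof.
move=> h; have df : differentiable g s by apply/derivable1_diffP; have [] := h.
split=> //; have <- : 'D_(t *: (1 : R)) g s = t *: dg.
  by rewrite derive_dirZ // (@derive_val _ _ _ _ _ _ _ h).
by rewrite [t *: 1]mulr1.
Qed.

(** [f] lists the successive derivatives of a curve. The induction hypothesis for the shifted list
    estimates the derivative of the remainder, and the mean value theorem gains one power of t; the
    factorial in the remainder is dropped. *)
Lemma taylor_curve (m : nat) (f : nat -> R -> V) (e K : R) :
  (forall j (t : R), (j <= m)%N -> `|t| <= e -> is_derive t 1 (f j) (f j.+1 t)) ->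
  (forall t : R, `|t| <= e -> `|f m.+1 t| <= K) ->
  (forall j, (j < m)%N -> f j 0 = 0) ->
  forall t : R, `|t| <= e -> `|f 0%N t - (t ^+ m / m`!%:R) *: f m 0| <= K * `|t| ^+ m.+1.
Proof.
elim: m f => [|m IH] f hf hK h0 t te.
  rewrite expr0 fact0 divr1 scale1r expr1.
  have st (s : R) : 0 <= s <= 1 -> `|s *: t| <= e.
    move=> /andP[s0 s1]; rewrite normrZ ger0_norm //; apply: le_trans te.
    by rewrite -[leRHS]mul1r ler_wpM2r.
  have := @mean_value_segment R R V cV (f 0%N) 0 t (K * `|t|).
  rewrite add0r; apply=> s /st h; rewrite add0r;
    have [df e1] := derive_real t (hf 0%N _ (leqnn _) h) => //.
  rewrite e1 normrZ mulrC. by rewrite ler_wpM2r //; exact: hK.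
pose c (r : R) := r ^+ m.+1 / m.+1`!%:R.
have dc (r : R) : is_derive r (1 : R) c (r ^+ m / m`!%:R).
  have h := is_derive_scale (m.+1`!%:R^-1) (is_deriveX m.+1 (is_derive_id r (1 : R))).
  have -> : c = (fun s => m.+1`!%:R^-1 * (id ^+ m.+1) s).
    by apply/funext => s; rewrite /c mulrC exprfctE.
  apply: is_derive_eq h _; rewrite [_ *: 1]mulr1 /= factS natrM.
  have n1 : m.+1%:R != 0 :> R by rewrite pnatr_eq0.
  have n2 : m`!%:R != 0 :> R by rewrite pnatr_eq0 -lt0n fact_gt0.
  by move: (m.+1%:R : R) (m`!%:R : R) n1 n2 => a b n1 n2; field; rewrite ?n1 ?n2.
have dcv (r : R) : is_derive r 1 (fun s => c s *: f m.+1 0) ((r ^+ m / m`!%:R) *: f m.+1 0).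
  have lin : linear (fun a : R => a *: f m.+1 0).
    by move=> a u w; rewrite scalerDl scalerA.
  pose L : {linear R -> V} := HB.pack (fun a : R => a *: f m.+1 0)
    (GRing.isLinear.Build R R V *:%R _ lin).
  have cL : continuous L.
    by apply: (linear_le_continuous (C := `|f m.+1 0|)) => a; rewrite /= normrZ mulrC.
  exact: (is_derive_lin cL (dc r)).
have IH' := IH (fun j => f j.+1) (fun j t jm => hf j.+1 t jm) hK (fun j jm => h0 j.+1 jm).
pose g r := f 0%N r - c r *: f m.+1 0.
have dg (r : R) : `|r| <= e -> is_derive r 1 g (f 1%N r - (r ^+ m / m`!%:R) *: f m.+1 0).
  by move=> re; exact: (is_deriveB (hf 0%N r (leq0n _) re) (dcv r)).
have g0 : g 0 = 0 by rewrite /g /c expr0n mul0r scale0r subr0 h0.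
have stt (s : R) : 0 <= s <= 1 -> `|s *: t| <= `|t|.
  by move=> /andP[s0 s1]; rewrite normrZ ger0_norm // -[leRHS]mul1r ler_wpM2r.
have := @mean_value_segment R R V cV g 0 t (K * `|t| ^+ m.+2).
rewrite add0r g0 subr0; apply=> s /stt h;
  rewrite add0r; have st := le_trans h te;
  have [df e1] := derive_real t (dg _ st) => //.
rewrite e1 normrZ exprS mulrCA ler_wpM2l //.
apply: le_trans (IH' _ st) _; apply: ler_wpM2l; last exact: lerXn2r.
have := hK 0; rewrite normr0 => /(_ (le_trans (normr_ge0 _) te)).
by apply: le_trans.
Qed.

(** If all derivatives below j vanish at 0, Taylor's formula and the O(t^m) bound force t^j f_j(0) /
    j! to be O(t^(j+1)); dividing by t^j and letting t tend to 0 gives f_j(0) = 0. *)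
Lemma taylor_vanish (m : nat) (f : nat -> R -> V) (e C : R) : 0 < e ->
  (forall j (t : R), (j <= m)%N -> `|t| <= e -> is_derive t 1 (f j) (f j.+1 t)) ->
  (forall t : R, `|t| <= e -> `|f 0%N t| <= C * `|t| ^+ m) ->
  forall j, (j < m)%N -> f j 0 = 0.
Proof.
move=> e0 hf hC j; elim/ltn_ind: j => j IH jm.
have [K [K0 hK]] : exists K : R, 0 < K /\ forall t : R, `|t| <= e -> `|f j.+1 t| <= K.
  apply: (continuous_bounded_ball (@coordsysR R)) => t te.
  exact: is_derive_continuous (hf j.+1 t jm te).
have hT := taylor_curve (m := j) (fun i t ij => hf i t (leq_trans ij (ltnW jm))) hK
  (fun i ij => IH i ij (ltn_trans ij jm)).
apply/eqP; rewrite -normr_le0; apply/ler_addgt0Pl => x x0; rewrite addr0.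
pose C' := `|C| + K; have C'0 : 0 < C' by rewrite ltr_wpDl.
pose F := j`!%:R * C'; have F0 : 0 < F by rewrite mulr_gt0 // ltr0n fact_gt0.
(* t <= 1 turns t^m into at most t^(j+1), t <= e is the range of validity, and t <= x / F makes the
   resulting bound j! C' t on f_j(0) at most x. *)
pose t := Num.min (Num.min 1 e) (x / F).
have t0 : 0 < t by rewrite !lt_min ltr01 e0 divr_gt0.
have t1 : t <= 1 by rewrite !ge_min lexx.
have te : t <= e by rewrite !ge_min lexx orbT.
have tx : t * F <= x by rewrite -ler_pdivlMr // ge_min lexx orbT.
have te' : `|t| <= e by rewrite ger0_norm // ltW.
have := hT t te'; have := hC t te'; rewrite (ger0_norm (ltW t0)) => h1 h2.
have h3 : `|(t ^+ j / j`!%:R) *: f j 0| <= C' * t ^+ j.+1.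
  rewrite -[X in `|X|](subKr (f 0%N t)); apply: le_trans (ler_normB _ _) _.
  rewrite mulrDl; apply: lerD h2; apply: le_trans h1 _.
  apply: (@le_trans _ _ (`|C| * t ^+ m)).
    by apply: ler_wpM2r; [rewrite exprn_ge0 // ltW|exact: ler_norm].
  by apply: ler_wpM2l => //; apply: ler_wiXn2l => //; exact: ltW.
have tj : 0 < t ^+ j by rewrite exprn_gt0.
have j0 : 0 < j`!%:R :> R by rewrite ltr0n fact_gt0.
move: h3; rewrite normrZ ger0_norm ?divr_ge0 ?(ltW tj) ?(ltW j0) // exprSr.
have -> : C' * (t ^+ j * t) = t ^+ j / j`!%:R * (t * F).
  by rewrite /F; field; rewrite lt0r_neq0.
rewrite ler_pM2l ?divr_gt0 // => /le_trans; exact.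
Qed.

End Taylor.

Section Families.
Context {R : realType} {V : normedModType R} (cV : coordsys V).
Local Notation cRV := (coordsys_prod (@coordsysR R) cV).
Implicit Types (P Q F : R * V -> V) (e : V -> V) (z : V) (m : nat).

Lemma near_boxP z (P : R * V -> Prop) : (\forall q \near ((0 : R), z), P q) <->
  exists2 e : R, 0 < e & forall (t : R) w, `|t| <= e -> `|w - z| <= e -> P (t, w).
Proof.
split=> [/nbhs_ball_le[e e0 he]|[e e0 he]].
  by exists e => // t w te we; apply: he; rewrite norm_pair_le /= subr0 te.
apply: (ball_le_nbhs e0) => -[t w]; rewrite norm_pair_le /= subr0 => /andP[].
exact: he.
Qed.

Lemma near_forall (W : normedModType R) (I : finType) (S : I -> W -> Prop) (p : W) :
  (forall i, \forall q \near p, S i q) -> \forall q \near p, forall i, S i q.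
Proof. exact: filter_forall. Qed.

Lemma near_and (W : normedModType R) (S S' : W -> Prop) (p : W) :
  (\forall q \near p, S q) -> (\forall q \near p, S' q) ->
  \forall q \near p, S q /\ S' q.
Proof. exact: filterI. Qed.

(** Smooth local deformations of the identity, with time as the first variable. Flows with
    reparametrized time, words and targets all belong to this class. *)
Definition good P := (forall z, P (0, z) = z) /\ forall z, smooth_near P (0, z).

Lemma good_continuous P z : good P -> P q @[q --> ((0 : R), z)] --> z.
Proof.
by move=> [P0 sP]; rewrite -[X in _ --> X]P0; exact: smooth_near_continuous.
Qed.

Lemma cvg_fst0 z : q.1 @[q --> ((0 : R), z)] --> (0 : R).
Proof. exact: (@fst_lin_continuous R R V (0, z)). Qed.

Lemma good_continuous_pair P z : good P ->
  (q.1, P q) @[q --> ((0 : R), z)] --> ((0 : R), z).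
Proof. by move=> gP; exact: (cvg_pair (@cvg_fst0 z) (@good_continuous P z gP)). Qed.

Lemma good_snd : good (fun q => q.2).
Proof.
split=> // z; apply: (smooth_on_near (A := setT)) => //; first exact: openT.
by apply: smooth_snd; exact: openT.
Qed.

Definition fcomp P Q : R * V -> V := fun q => P (q.1, Q q).

Lemma good_fcomp P Q : good P -> good Q -> good (fcomp P Q).
Proof.
move=> [P0 sP] [Q0 sQ]; split=> [z|z]; first by rewrite /fcomp /= Q0; exact: P0.
apply: (smooth_near_comp cRV cV (F := fun q => (q.1, Q q))).
  apply: smooth_near_pair => //; apply: (smooth_on_near (A := setT)) => //.
    exact: openT.
  by apply: smooth_fst; exact: openT.
by rewrite /= Q0.
Qed.

Lemma good_reparam P (c : R -> R) : smooth_on setT c -> c 0 = 0 -> good P ->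
  good (fun q => P (c q.1, q.2)).
Proof.
move=> sc c0 [P0 sP]; split=> [z|z]; first by rewrite /= c0.
have oT : open [set: R * V] by exact: openT.
apply: (smooth_near_comp cRV cV (F := fun q : R * V => (c q.1, q.2))).
  apply: (smooth_on_near (A := setT)) => //; apply: smooth_on_pair => //.
    exact: (smooth_on_comp (F := fun q : R * V => q.1) (@coordsysR R) (@coordsysR R)
      (B := setT) oT _ (smooth_fst oT)).
  exact: smooth_snd.
by rewrite /= c0.
Qed.

Lemma good_flow_map (F : V -> V) : smooth_on setT F -> good (flow_map F).
Proof.
move=> sF; split=> [z|z]; first by rewrite /flow_map /= (vflow0 cV).
have M0 : 0 < `|z| + 1 by rewrite ltr_wpDl.
have [d [d0 [_ sm _]]] := flow_box cV sF M0.
apply: (smooth_on_near (A := box d (`|z| + 1))) => //; first exact: open_box.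
by split; rewrite /= ?normr0 // ltrDl.
Qed.

Lemma smooth_monomial (a : R) m : smooth_on setT (fun x : R => a * x ^+ m).
Proof.
have oT : open [set: R] by exact: openT.
elim: m => [|m IH]; first by under eq_fun do rewrite expr0; exact: smooth_on_cst.
apply: (smooth_on_ext (F := fun x : R => x *: (a * x ^+ m))) => // [x _|].
  by rewrite exprS mulrCA.
by apply: (smooth_onZ (@coordsysR R)) => //; exact: smooth_on_id.
Qed.

(** The neighborhood is one of (0, z) in time and space, so the constant also serves all base points
    close to z. *)
Definition bigO m F := forall z, exists C : R,
  \forall q \near ((0 : R), z), `|F q| <= C * `|q.1| ^+ m.

Lemma bigOD m F Q : bigO m F -> bigO m Q -> bigO m (fun q => F q + Q q).
Proof.
move=> hF hQ z; have [C1 h1] := hF z; have [C2 h2] := hQ z.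
exists (C1 + C2); apply: filterS2 h1 h2 => q h1 h2.
by rewrite mulrDl; apply: le_trans (ler_normD _ _) (lerD h1 h2).
Qed.

Lemma bigO_near m F Q : (forall z, \forall q \near ((0 : R), z), F q = Q q) ->
  bigO m F -> bigO m Q.
Proof.
move=> FQ hF z; have [C h] := hF z; exists C.
by apply: filterS2 h (FQ z) => q ? <-.
Qed.

Lemma bigO_ext m F Q : (forall q, F q = Q q) -> bigO m F -> bigO m Q.
Proof.
by move=> FQ; apply: bigO_near => z; apply: (near_open (A := setT) openT I).
Qed.

Lemma bigON m F : bigO m F -> bigO m (fun q => - F q).
Proof.
by move=> hF z; have [C h] := hF z; exists C; apply: filterS h => q; rewrite normrN.
Qed.

Lemma bigOW m F : bigO m.+1 F -> bigO m F.
Proof.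
move=> hF z; have [C h] := hF z; exists `|C|.
have h1 : \forall q \near ((0 : R), z), `|q.1| <= 1.
  by apply/near_boxP; exists 1.
apply: filterS2 h h1 => q h h1; apply: le_trans h _.
apply: (@le_trans _ _ (`|C| * `|q.1| ^+ m.+1)).
  by apply: ler_wpM2r; [exact: exprn_ge0|exact: ler_norm].
by apply: ler_wpM2l => //; apply: ler_wiXn2l.
Qed.

Lemma bigO_pow m k F : bigO k F -> bigO (m + k) (fun q => q.1 ^+ m *: F q).
Proof.
move=> hF z; have [C h] := hF z; exists C; apply: filterS h => q h.
by rewrite normrZ normrX exprD mulrCA ler_wpM2l // exprn_ge0.
Qed.

Lemma bigO0 F : (forall z, {for (0, z), continuous F}) -> bigO 0 F.
Proof.
move=> cF z; have [C _ h] := continuous_bounded_near (cF z).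
by exists C; apply: filterS h => q; rewrite expr0 mulr1.
Qed.

Lemma bigO_comp m F Q : bigO m F -> good Q -> bigO m (fun q => F (q.1, Q q)).
Proof.
move=> hF gQ z; have [C h] := hF z; exists C.
exact: (@good_continuous_pair Q z gQ) _ h.
Qed.

Lemma bigO_reparam m F (a : R) r : bigO m F ->
  bigO (r.+1 * m) (fun q => F (a * q.1 ^+ r.+1, q.2)).
Proof.
move=> hF z; have [C h] := hF z.
exists (`|C| * `|a| ^+ m).
have cc : {for 0, continuous (fun x : R => a * x ^+ r.+1)}.
  exact: (smooth_on_continuous (A := setT) (smooth_monomial a r.+1)).
have h1 : a * q.1 ^+ r.+1 @[q --> ((0 : R), z)] --> a * 0 ^+ r.+1.
  exact: (@continuous_comp _ _ _ (@fst_lin R R V) (fun x : R => a * x ^+ r.+1) (0, z)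
    (@fst_lin_continuous R R V (0, z)) cc).
rewrite expr0n mulr0 in h1.
have cvg : (a * q.1 ^+ r.+1, q.2) @[q --> ((0 : R), z)] --> ((0 : R), z).
  exact: (cvg_pair h1 (@snd_lin_continuous R R V (0, z))).
have h2 : \forall q \near ((0 : R), z),
    `|F (a * q.1 ^+ r.+1, q.2)| <= C * `|a * q.1 ^+ r.+1| ^+ m by exact: cvg _ h.
apply: filterS h2 => q hq; apply: le_trans hq _.
rewrite normrM exprMn normrX -exprM mulrA; apply: ler_wpM2r; first exact: exprn_ge0.
by apply: ler_wpM2r; [exact: exprn_ge0|exact: ler_norm].
Qed.

(** e o Q is locally Lipschitz in time and space together, and (t, w) is compared with (0, w), where
    Q is the identity. *)
Lemma bigO1_smooth e Q : smooth_on setT e -> good Q ->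
  bigO 1 (fun q => e (Q q) - e q.2).
Proof.
move=> se [Q0 sQ] z; pose G q := e (Q q).
have [A [oA Az sG]] : smooth_near G (0, z).
  apply: (smooth_near_comp cV cV (sQ z)).
  by apply: (smooth_on_near (A := setT)) => //; exact: openT.
have [L [d [L0 d0 hL]]] := lipschitz_near cRV cV oA Az sG.
exists L; apply/near_boxP; exists d => // t w td wd; rewrite expr1 /=.
have := hL (0, w) (t, w); rewrite !norm_pair_le /= !subr0 normr0 td wd (ltW d0).
move=> /(_ isT isT); rewrite /G Q0 => /le_trans; apply.
apply: ler_wpM2l; first exact: ltW.
by rewrite norm_pair_le /= subr0 lexx subrr normr0 /=.
Qed.

Lemma bigO1_good Q : good Q -> bigO 1 (fun q => Q q - q.2).
Proof.
by move=> gQ; apply: (bigO1_smooth (e := id)) => //; apply: smooth_on_id; exact: openT.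
Qed.

End Families.

(** * Leading coefficients of smooth families *)

Section Leading.
Context {R : realType} {V : normedModType R} (cV : coordsys V).
Implicit Types (P Q F : R * V -> V) (e : V -> V) (z : V) (m : nat).

Definition tderive j F : R * V -> V := iter j (fun G : R * V -> V => 'D_((1, 0) : R * V) G) F.

Lemma smooth_tderive (A : set (R * V)) j F : smooth_on A F -> smooth_on A (tderive j F).
Proof. by move=> sF; elim: j => //= j IH; exact: smooth_on_derive. Qed.

Lemma tderive_curve F z M : smooth_near F (0, z) -> exists d K : R, [/\ 0 < d,
  forall j (t : R) w, `|t| <= d -> `|w - z| <= d ->
    is_derive t 1 (fun s => tderive j F (s, w)) (tderive j.+1 F (t, w)) &
  forall (t : R) w, `|t| <= d -> `|w - z| <= d -> `|tderive M F (t, w)| <= K].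
Proof.
move=> [A [oA Az sF]].
have [K _ hK] := continuous_bounded_near (smooth_on_continuous (smooth_tderive M sF) Az).
have /near_boxP[d d0 hd] := near_and (open_nbhs_nbhs (conj oA Az)) hK.
exists d, K; split=> // [j t w td wd|t w td wd]; last by have [] := hd t w td wd.
have [Atw _] := hd t w td wd.
have h := is_derive_pair (is_derive_id t (1 : R)) (is_derive_cst w t (1 : R)).
apply: (is_derive_comp (F := tderive j F) h).
exact: (smooth_on_differentiable (smooth_tderive j sF) Atw).
Qed.

Section Vanishing.
Variables (F : R * V -> V) (m : nat).
Hypothesis sF : forall z, smooth_near F (0, z).
Hypothesis hF : bigO m F.

Lemma tderive_vanish j z : (j < m)%N -> tderive j F (0, z) = 0.
Proof.
move=> jm; have [d [_ [d0 hd _]]] := tderive_curve 0 (sF z).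
have [C /near_boxP[d' d'0 hC]] := hF z.
apply: (taylor_vanish cV (f := fun j s => tderive j F (s, z)) (m := m)
  (e := Num.min d d') (C := C)) => //.
- by rewrite lt_min d0.
- by move=> i t _; rewrite le_min => /andP[td _]; apply: hd; rewrite // subrr normr0 ltW.
- by move=> t; rewrite le_min => /andP[_ td]; apply: hC; rewrite // subrr normr0 ltW.
Qed.

Definition leading z : V := m`!%:R^-1 *: tderive m F (0, z).

Lemma smooth_leading : smooth_on setT leading.
Proof.
have oT : open [set: V] by exact: openT.
apply: (smooth_onZ cV) => //; first exact: smooth_on_cst.
apply: smooth_near_on => z _.
apply: (smooth_near_slice (F := tderive m F) (@coordsysR R) cV cV).
by have [A [oA Az sA]] := sF z; exists A; split=> //; exact: smooth_tderive.
Qed.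

Lemma leading_bigO : bigO m.+1 (fun q => F q - q.1 ^+ m *: leading q.2).
Proof.
move=> z; have [d [K [d0 hd hK]]] := tderive_curve m.+1 (sF z).
exists K; apply/near_boxP; exists d => // t w td wd /=.
rewrite /leading scalerA.
apply: (taylor_curve cV (f := fun j s => tderive j F (s, w)) (e := d)) => //.
- by move=> j s _ sd; exact: hd.
- by move=> s sd; exact: hK.
- by move=> j jm; exact: tderive_vanish.
Qed.

Lemma tderive_derive (A : set (R * V)) u j q : open A -> A q -> smooth_on A F ->
  tderive j ('D_u F) q = 'D_u (tderive j F) q.
Proof.
move=> oA + sA; elim: j q => //= j IH q Aq.
rewrite (near_eq_derive _ (near_open oA Aq IH)).
exact: (@schwarz R _ _ cV A (tderive j F) q u (1, 0) oA Aq (smooth_tderive j sA)).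
Qed.

(** The time derivatives of [F] below order m vanish at t = 0 for every z, hence so do their space
    derivatives; exchanging the order of differentiation and applying Taylor's formula gives O(t^m)
    again. *)
Lemma bigO_derive v : bigO m ('D_(0, v) F).
Proof.
have van z j : (j < m)%N -> tderive j ('D_(0, v) F) (0, z) = 0.
  move=> jm; have [A [oA Az sA]] := sF z.
  rewrite (tderive_derive _ _ oA Az sA) -derive_slice.
  rewrite (_ : (fun y => _) = fun=> 0) ?derive_cst //.
  by apply/funext => y; exact: tderive_vanish.
have sD z : smooth_near ('D_(0, v) F) (0, z) by exact: smooth_near_derive.
(* For m = 0 there is nothing to expand and continuity gives boundedness; otherwise Taylor is used
   at order m - 1, whose main term vanishes too. *)
case: m van => [_|k van].
  by apply: bigO0 => z; exact: smooth_near_continuous.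
move=> z; have [d [K [d0 hd hK]]] := tderive_curve k.+1 (sD z).
exists K; apply/near_boxP; exists d => // t w td wd /=.
have h : `|tderive 0 ('D_(0, v) F) (t, w) - (t ^+ k / k`!%:R) *:
    tderive k ('D_(0, v) F) (0, w)| <= K * `|t| ^+ k.+1.
  apply: (taylor_curve cV (f := fun j s => tderive j ('D_(0, v) F) (s, w)) (e := d)) => //.
  - by move=> j s _ sd; exact: hd.
  - by move=> s sd; exact: hK.
  - by move=> j jk; apply: van; exact: ltnW.
by rewrite van // scaler0 subr0 in h.
Qed.

End Vanishing.

(* The space derivatives of a smooth family that is [O(t^m)] are [O(t^m)] too,
   hence so is its Lipschitz constant in space. *)
Lemma bigO_lipschitz m F z : (forall z, smooth_near F (0, z)) -> bigO m F ->
  exists C d : R, [/\ 0 < C, 0 < d &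
  forall (t : R) y y', `|t| <= d -> `|y - z| <= d -> `|y' - z| <= d ->
  `|F (t, y') - F (t, y)| <= C * `|t| ^+ m * `|y' - y|].
Proof.
move=> sF hF; have [A [oA Az sA]] := sF z.
have [K [K0 hK]] : exists K : R, 0 < K /\ forall j, \forall q \near ((0 : R), z),
    `|'D_((0, cvec cV j) : R * V) F q| <= K * `|q.1| ^+ m.
  apply: (@finite_bound R (cidx cV) (fun j K => \forall q \near ((0 : R), z),
    `|'D_((0, cvec cV j) : R * V) F q| <= K * `|q.1| ^+ m)) => [j|j C C' CC'].
    have [C hC] := bigO_derive sF hF (cvec cV j) z.
    exists (`|C| + 1); split; first by rewrite ltr_wpDl.
    apply: filterS hC => q hq; apply: le_trans hq _.
    apply: ler_wpM2r; first exact: exprn_ge0.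
    by apply: le_trans (ler_norm C) _; rewrite lerDl.
  apply: filterS => q hq; apply: le_trans hq _.
  by apply: ler_wpM2r => //; exact: exprn_ge0.
have h := near_and (open_nbhs_nbhs (conj oA Az)) (near_forall hK).
have /near_boxP[d d0 hd] := h.
exists (#|cidx cV|%:R * K + 1), d; split=> //; first exact: mulrn_add1_gt0.
move=> t y y' td yd y'd.
apply: (@le_trans _ _ (#|cidx cV|%:R * (K * `|t| ^+ m) * `|y' - y|)).
  apply: (lipschitz_convex cV (F := fun y => F (t, y)) (C := K * `|t| ^+ m)
    (convex_ball cV (p := z) (e := d))) => //= [w wd|j w wd].
    apply: smooth_near_at [::] _.
    apply: (smooth_near_slice (@coordsysR R) cV cV).
    by apply: (smooth_on_near oA) => //; have [] := hd t w td wd.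
  by rewrite derive_slice; have [_] := hd t w td wd; exact.
apply: ler_wpM2r => //; rewrite mulrA; apply: ler_wpM2r; first exact: exprn_ge0.
by rewrite lerDl.
Qed.

(** F(t, .) has a Lipschitz constant of size t^m and its two arguments are t^k apart. *)
Lemma bigO_compB m k F P P' : (forall z, smooth_near F (0, z)) -> bigO m F ->
  good P -> good P' -> bigO k (fun q => P q - P' q) ->
  bigO (m + k) (fun q => F (q.1, P q) - F (q.1, P' q)).
Proof.
move=> sF hF gP gP' hP z; have [C [d [C0 d0 hd]]] := bigO_lipschitz z sF hF.
have [K hK] := hP z; exists (C * K).
have near_d (q : R * V -> V) : good q -> \forall p \near ((0 : R), z), `|q p - z| <= d.
  by move=> gq; have /cvgrPdist_le/(_ _ d0) := @good_continuous _ _ q z gq;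
     apply: filterS => p; rewrite distrC.
have t_d : \forall p \near ((0 : R), z), `|p.1| <= d by apply/near_boxP; exists d.
have h := near_and (near_and (near_d _ gP) (near_d _ gP')) t_d.
apply: filterS2 h hK => q [[h1 h2] h3] h4.
apply: le_trans (hd _ _ _ h3 h2 h1) _.
rewrite exprD mulrACA; apply: ler_wpM2l => //.
by rewrite mulr_ge0 ?exprn_ge0 // ltW.
Qed.

(** Q - id is O(t) with Lipschitz constant O(t), so Q transports a difference of size t^m unchanged
    up to one more order. *)
Lemma bigO_near_id m Q P P' : good Q -> good P -> good P' ->
  bigO m (fun q => P q - P' q) ->
  bigO m.+1 (fun q => Q (q.1, P q) - Q (q.1, P' q) - (P q - P' q)).
Proof.
move=> gQ gP gP' hP.
have sQ z : smooth_near (fun q => Q q - q.2) (0, z).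
  by apply: (smooth_nearB cV); [exact: gQ.2|exact: (@good_snd R V).2].
have := bigO_compB sQ (bigO1_good cV gQ) gP gP' hP.
by apply: bigO_ext => q /=; vec cV.
Qed.

Definition expand P Q m e :=
  bigO m.+1 (fun q => P q - Q q - q.1 ^+ m *: e q.2).

Lemma bigO0_snd e : smooth_on setT e -> bigO 0 (fun q => e q.2).
Proof.
move=> se; apply: bigO0 => z.
apply: (@continuous_comp _ _ _ (@snd_lin R R V) e).
  exact: snd_lin_continuous.
exact: (smooth_on_continuous (A := setT)).
Qed.

Lemma expand_bigO P Q m e : smooth_on setT e -> expand P Q m e ->
  bigO m (fun q => P q - Q q).
Proof.
move=> se h; have h1 := bigO_pow m (bigO0_snd se); rewrite addn0 in h1.
by apply: bigO_ext (bigOD (bigOW h) h1) => q; rewrite subrK.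
Qed.

(** Leading errors add. The three corrections are the expansion of [P2] evaluated at [P1], the shift
    of the base point of [e2], and the transport of P1 - Q1 by [Q2]; each is O(t^(m+1)). *)
Lemma expand_fcomp P1 Q1 P2 Q2 m e1 e2 : good P1 -> good Q1 -> good P2 -> good Q2 ->
  smooth_on setT e1 -> smooth_on setT e2 ->
  expand P1 Q1 m e1 -> expand P2 Q2 m e2 ->
  expand (fcomp P2 P1) (fcomp Q2 Q1) m (fun z => e1 z + e2 z).
Proof.
move=> gP1 gQ1 gP2 gQ2 se1 se2 h1 h2.
have k1 := bigO_comp h2 gP1.
have k2 := bigO_pow m (bigO1_smooth cV se2 gP1); rewrite addn1 in k2.
have k3 := bigO_near_id gQ2 gP1 gQ1 (expand_bigO se1 h1).
apply: bigO_ext (bigOD (bigOD k1 k2) (bigOD k3 h1)) => q /=.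
by rewrite /fcomp; vec cV.
Qed.

Lemma leading_expand P Q m : good P -> good Q -> bigO m (fun q => P q - Q q) ->
  exists e, smooth_on setT e /\ expand P Q m e.
Proof.
move=> gP gQ h; have sF z : smooth_near (fun q => P q - Q q) (0, z).
  by apply: (smooth_nearB cV); [exact: gP.2|exact: gQ.2].
exists (leading (fun q => P q - Q q) m); split; first exact: smooth_leading.
exact: leading_bigO.
Qed.

Lemma iter_derive_lincomb (W X : normedModType R) (I : finType) (A : set W)
    (G : I -> W -> X) (a : I -> R) (H : W -> X) vs :
  open A -> (forall i, smooth_on A (G i)) ->
  (forall q, A q -> H q = \sum_i a i *: G i q) ->
  forall q, A q -> iter_derive H vs q = \sum_i a i *: iter_derive (G i) vs q.
Proof.
move=> oA sG hH; elim: vs => //= v vs IH q Aq.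
rewrite (near_eq_derive _ (near_open oA Aq IH)).
have dG i : is_derive q v (fun x => a i *: iter_derive (G i) vs x)
    (a i *: 'D_v (iter_derive (G i) vs) q).
  have h : is_derive q v (iter_derive (G i) vs) ('D_v (iter_derive (G i) vs) q).
    by apply: DeriveDef => //; apply: diff_derivable; exact: sG.
  exact: (@is_deriveZ R W X (iter_derive (G i) vs) (a i) q v _ h).
apply: (@derive_val _ _ _ _ _ _ _ _).
elim: (index_enum _) => [|i s IHs].
  rewrite big_nil; have := is_derive_cst (0 : X) q v.
  by congr is_derive; apply/funext => x; rewrite big_nil.
rewrite big_cons; have := is_deriveD (dG i) IHs.
by congr is_derive; apply/funext => x; rewrite big_cons.
Qed.

(** One constant must serve all lists of directions in the unit ball, as the operator norm demands.
    Expanding the innermost direction in coordinates reduces to finitely many partial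
    derivatives. *)
Lemma bigO_iter_derive k F m : (forall z, smooth_near F (0, z)) -> bigO m F ->
  forall z, exists C : R, \forall q \near ((0 : R), z), forall vs : seq V,
    size vs = k -> (forall v, v \in vs -> `|v| <= 1) ->
    `|iter_derive F (map (@inr_lin R R V) vs) q| <= C * `|q.1| ^+ m.
Proof.
elim: k F => [|k IH] F sF hF z.
  have [C hC] := hF z; exists C; apply: filterS hC => q hq vs /size0nil -> _.
  exact: hq.
have [A [oA Az sA]] := sF z.
pose G j := 'D_((0, cvec cV j) : R * V) F.
have [C [C0 hC]] : exists C : R, 0 < C /\ forall j, \forall q \near ((0 : R), z),
    forall vs : seq V, size vs = k -> (forall v, v \in vs -> `|v| <= 1) ->
    `|iter_derive (G j) (map (@inr_lin R R V) vs) q| <= C * `|q.1| ^+ m.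
  apply: (@finite_bound R (cidx cV) (fun j C => \forall q \near ((0 : R), z),
    forall vs : seq V, size vs = k -> (forall v, v \in vs -> `|v| <= 1) ->
    `|iter_derive (G j) (map (@inr_lin R R V) vs) q| <= C * `|q.1| ^+ m)) => [j|j C C' CC'].
    have [C hC] := IH (G j) (fun z => smooth_near_derive _ (sF z)) (bigO_derive sF hF _) z.
    exists (`|C| + 1); split; first by rewrite ltr_wpDl.
    apply: filterS hC => q hq vs vk v1; apply: le_trans (hq vs vk v1) _.
    apply: ler_wpM2r; first exact: exprn_ge0.
    by apply: le_trans (ler_norm C) _; rewrite lerDl.
  apply: filterS => q hq vs vk v1; apply: le_trans (hq vs vk v1) _.
  by apply: ler_wpM2r => //; exact: exprn_ge0.
exists (#|cidx cV|%:R * C).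
have h := near_and (open_nbhs_nbhs (conj oA Az)) (near_forall hC).
(* The last entry of the list is the derivative taken first, the one for which the smooth family can
   be replaced by its partials. *)
apply: filterS h => q [Aq hq]; elim/last_ind => // vs v _.
rewrite size_rcons => -[vk] v1.
rewrite map_rcons iter_derive_rcons.
have v1' : `|v| <= 1 by apply: v1; rewrite mem_rcons mem_head.
rewrite (iter_derive_lincomb (G := G) (a := fun j => coord cV j v) _ oA _ _ Aq).
- apply: le_trans (ler_norm_sum _ _ _) _.
  apply: le_trans (_ : \sum_(j : cidx cV) C * `|q.1| ^+ m <= _); last first.
    by rewrite sumr_const -[leRHS]mulrA mulr_natl.
  apply: ler_sum => j _; rewrite normrZ -[leRHS]mul1r; apply: ler_pM => //.
    by apply: le_trans v1'; exact: coord_le.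
  by apply: hq => // w wvs; apply: v1; rewrite mem_rcons in_cons wvs orbT.
- by move=> j; exact: smooth_on_derive.
- move=> p Ap; have dF := smooth_on_differentiable sA Ap.
  rewrite deriveE // {1}(coord_sum cV v) linear_sum linear_sum /=.
  by apply: eq_bigr => j _; rewrite !linearZ /= /G deriveE.
Qed.

End Leading.

(** * Words of flows *)

Section Words.
Context {R : realType} {V : normedModType R} (cV : coordsys V).
Context {G : Type} (X : G -> V -> V) (Y : V -> V).
Hypothesis sX : forall g, smooth_on setT (X g).
Hypothesis sY : smooth_on setT Y.
Implicit Types (P Q F : R * V -> V) (e : V -> V) (z : V) (m : nat).

(* The letter [(g, a, r)] stands for the flow of [X g] for the time [a t^(r+1)]. *)
Definition letter := (G * R * nat)%type.

Definition ltime (l : letter) (t : R) : R := l.1.2 * t ^+ l.2.+1.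

Definition lmap (l : letter) (q : R * V) : V := vflow (X l.1.1) (ltime l q.1) q.2.

Definition wmap (w : seq letter) (q : R * V) : V :=
  foldl (fun y l => lmap l (q.1, y)) q.2 w.

Lemma good_lmap l : good (lmap l).
Proof.
case: l => [[g a] r]; apply: (good_reparam cV (P := flow_map (X g)) (c := fun x => a * x ^+ r.+1)).
- exact: smooth_monomial.
- by rewrite expr0n mulr0.
- exact: good_flow_map.
Qed.

Lemma wmap_cat w1 w2 : wmap (w1 ++ w2) = fcomp (wmap w2) (wmap w1).
Proof. by apply/funext => q; rewrite /wmap foldl_cat. Qed.

Lemma wmap_cons l w : wmap (l :: w) = fcomp (wmap w) (lmap l).
Proof. by apply/funext => -[t z]. Qed.

Lemma wmap1 l : wmap [:: l] = lmap l.
Proof. by apply/funext => -[t z]. Qed.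

Lemma good_wmap w : good (wmap w).
Proof.
elim: w => [|l w IH]; first exact: good_snd.
by rewrite wmap_cons; apply: good_fcomp => //; exact: good_lmap.
Qed.

Definition linv (l : letter) : letter := (l.1.1, - l.1.2, l.2).

Definition winv (w : seq letter) := rev (map linv w).

Lemma winvK : involutive winv.
Proof.
move=> w; rewrite /winv map_rev revK -map_comp -[RHS]map_id.
by apply: eq_map => -[[g a] r]; rewrite /linv /= opprK.
Qed.

Lemma flow_group_near (Z : V -> V) z (f h : R -> R) : smooth_on setT Z ->
  {for 0, continuous f} -> {for 0, continuous h} -> f 0 = 0 -> h 0 = 0 ->
  \forall q \near ((0 : R), z),
  vflow Z (h q.1) (vflow Z (f q.1) q.2) = vflow Z (f q.1 + h q.1) q.2.
Proof.
move=> sZ cf ch f0 h0.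
have M0 : 0 < `|z| + 2 by rewrite ltr_wpDl.
have [d [d0 hd]] := flow_group cV sZ M0.
have [e1 e10 he1] : exists2 e : R, 0 < e & forall t : R, `|t - 0| <= e -> `|f t| < d.
  apply: nbhs_ball_le; have /cvgrPdist_lt/(_ _ d0) := cf.
  by apply: filterS => t; rewrite f0 sub0r normrN.
have [e2 e20 he2] : exists2 e : R, 0 < e & forall t : R, `|t - 0| <= e -> `|h t| < d.
  apply: nbhs_ball_le; have /cvgrPdist_lt/(_ _ d0) := ch.
  by apply: filterS => t; rewrite h0 sub0r normrN.
apply/near_boxP; exists (Num.min 1 (Num.min e1 e2)); first by rewrite !lt_min ltr01 e10.
move=> t w; rewrite !le_min => /and3P[_ t1 t2] /and3P[w1 _ _].
apply: hd; [by apply: he1; rewrite subr0|by apply: he2; rewrite subr0|].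
rewrite -[w](subrK z); apply: le_lt_trans (ler_normD _ _) _; lra.
Qed.

Lemma continuous_ltime l : {for 0, continuous (ltime l)}.
Proof.
exact: (smooth_on_continuous (A := setT) (smooth_monomial l.1.2 l.2.+1)).
Qed.

Lemma ltime0 l : ltime l 0 = 0.
Proof. by rewrite /ltime expr0n mulr0. Qed.

Lemma lmap_inv l z : \forall q \near ((0 : R), z), lmap (linv l) (q.1, lmap l q) = q.2.
Proof.
have := flow_group_near z (sX l.1.1) (continuous_ltime (l:=l)) (continuous_ltime (l:=linv l))
  (ltime0 l) (ltime0 (linv l)).
apply: filterS => q; rewrite /lmap /= => ->.
by rewrite /ltime /= mulNr addrN (vflow0 cV).
Qed.

(** The group law holds only for short times, so the words are inverse to each other near each (0,
    z) rather than everywhere. *)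
Lemma wmap_inv w z : \forall q \near ((0 : R), z), wmap (winv w) (q.1, wmap w q) = q.2.
Proof.
elim: w z => [|l w IH] z; first exact: (near_open (A := setT) openT I).
have h1 : \forall q \near ((0 : R), z),
    wmap (winv w) (q.1, wmap w (q.1, lmap l q)) = lmap l q.
  exact: (@good_continuous_pair _ _ _ z (good_lmap l)) _ (IH z).
apply: filterS2 h1 (lmap_inv l z) => q h1 h2.
rewrite /winv /= rev_cons -cats1 wmap_cat -/(winv w) /fcomp wmap1 /=.
by rewrite wmap_cons /fcomp h1.
Qed.

Definition wscale (k : R) (w : seq letter) : seq letter :=
  map (fun l => (l.1.1, l.1.2 * k ^+ l.2.+1, l.2)) w.

Lemma wmap_scale k w q : wmap (wscale k w) q = wmap w (k * q.1, q.2).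
Proof.
case: q => t z; elim: w z => //= -[[g a] r] w IH z.
by rewrite !wmap_cons /fcomp /= IH /lmap /ltime /= -mulrA exprMn.
Qed.

(** The flow to be approximated, at time c t^2: quadratic because a commutator loop with times of
    size t advances by t^2. *)
Definition target (c : R) (q : R * V) : V := vflow Y (c * q.1 ^+ 2) q.2.

Lemma good_target c : good (target c).
Proof.
apply: (good_reparam cV (P := flow_map Y) (c := fun x => c * x ^+ 2)).
- exact: smooth_monomial.
- by rewrite expr0n mulr0.
- exact: good_flow_map.
Qed.

Lemma target_comp a b z : \forall q \near ((0 : R), z),
  target b (q.1, target a q) = target (a + b) q.
Proof.
have cont c : {for 0, continuous (fun x : R => c * x ^+ 2)}.
  exact: (smooth_on_continuous (A := setT) (smooth_monomial c 2)).
have c0 (c : R) : c * 0 ^+ 2 = 0 by rewrite expr0n mulr0.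
have := flow_group_near z sY (cont a) (cont b) (c0 a) (c0 b).
by apply: filterS => q; rewrite /target /= mulrDl.
Qed.

Lemma target0 q : target 0 q = q.2.
Proof. by rewrite /target mul0r (vflow0 cV). Qed.

Definition approx w c m e := expand (wmap w) (target c) m e.

Lemma approx_cat w1 w2 c1 c2 m e1 e2 : smooth_on setT e1 -> smooth_on setT e2 ->
  approx w1 c1 m e1 -> approx w2 c2 m e2 ->
  approx (w1 ++ w2) (c1 + c2) m (fun z => e1 z + e2 z).
Proof.
move=> s1 s2 h1 h2.
have := expand_fcomp cV (good_wmap w1) (good_target c1) (good_wmap w2) (good_target c2)
  s1 s2 h1 h2.
rewrite /approx wmap_cat; apply: bigO_near => z.
by apply: filterS (target_comp c1 c2 z) => q /=; rewrite /fcomp => ->.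
Qed.

Lemma approx_scale k w c m e : approx w c m e ->
  approx (wscale k w) (c * k ^+ 2) m (fun z => k ^+ m *: e z).
Proof.
move=> /(@bigO_reparam R V m.+1 _ k 0); rewrite mul1n; apply: bigO_ext => q.
rewrite wmap_scale /= expr1 /target /= exprMn mulrA; congr (_ - _).
by rewrite exprMn scalerA mulrC.
Qed.

Lemma smooth_scale (k : R) e : smooth_on setT e -> smooth_on setT (fun z => k *: e z).
Proof. exact: smooth_scaled. Qed.

(** Composing with the flow for -c t^2 turns the expansion of [w] into one around the identity.
    Evaluating it at the inverse word, where [w] cancels, exhibits that word with the opposite
    error, up to a shift of the base point of [e]. *)
Lemma approx_inv w c m e : smooth_on setT e -> approx w c m e ->
  approx (winv w) (- c) m (fun z => - e z).
Proof.
move=> se h; have oT : open [set: V] by exact: openT.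
have s0 : smooth_on setT (fun _ : V => 0 : V) by exact: smooth_on_cst.
have h0 : expand (target (- c)) (target (- c)) m (fun=> 0).
  move=> z; exists 0; apply: (near_open (A := setT) openT I) => q _.
  by rewrite subrr scaler0 subr0 normr0 mul0r.
have h1 := expand_fcomp cV (good_wmap w) (good_target c) (good_target (- c))
  (good_target (- c)) se s0 h h0.
have h2 := bigO_comp h1 (good_wmap (winv w)).
have h3 := bigO_pow m (bigO1_smooth cV se (good_wmap (winv w))); rewrite addn1 in h3.
apply: bigO_near (bigON (bigOD h2 h3)) => z.
have k1 := wmap_inv (winv w) z; rewrite winvK in k1.
have k2 : \forall q \near ((0 : R), z),
    target (- c) (q.1, target c (q.1, wmap (winv w) q)) = wmap (winv w) q.
  have k : \forall q \near ((0 : R), z), target (- c) (q.1, target c q) = q.2.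
    by apply: filterS (target_comp c (- c) z) => q ->; rewrite addrN target0.
  exact: (@good_continuous_pair _ _ _ z (good_wmap (winv w))) _ k.
apply: filterS2 k1 k2 => -[t y] /= k1 k2; rewrite /fcomp /= k1 k2.
by vec cV.
Qed.

Lemma approx_nseq n w c m e : smooth_on setT e -> approx w c m e ->
  approx (flatten (nseq n w)) (n%:R * c) m (fun z => n%:R *: e z).
Proof.
move=> se h; elim: n => [|n IH] /=.
  move=> z; exists 0; apply: (near_open (A := setT) openT I) => q _.
  by rewrite mul0r target0 scale0r scaler0 subrr subr0 normr0 mul0r.
rewrite -nat1r mulrDl mul1r.
have -> : (fun z => (1 + n%:R) *: e z) = (fun z => e z + n%:R *: e z).
  by apply/funext => z; rewrite scalerDl scale1r.
exact: approx_cat se (smooth_scale n%:R se) h IH.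
Qed.

(* [2^m] steps of length [k t] forward and one of length [2 k t] backward cancel
   the error of order [m]; the total time [(2^m - 4) (k t)^2] is nonzero for [m > 2]. *)
Lemma raise_order w m e : (2 < m)%N -> smooth_on setT e -> approx w 1 m e ->
  exists w' e', smooth_on setT e' /\ approx w' 1 m.+1 e'.
Proof.
move=> m2 se h.
have p4 : 0 < 2 ^+ m - 4 :> R.
  rewrite subr_gt0 (_ : 4 = 2 ^+ 2) ?ltr_eXn2l ?ltr1n //.
  by rewrite -natrX.
pose k : R := (Num.sqrt (2 ^+ m - 4))^-1.
have k2 : k ^+ 2 = (2 ^+ m - 4)^-1 by rewrite exprVn sqr_sqrtr // ltW.
pose w' := flatten (nseq (2 ^ m) (wscale k w)) ++ winv (wscale (2 * k) w).
have s1 := smooth_scale (k ^+ m) se.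
have s2 := smooth_scale ((2 * k) ^+ m) se.
have h1 := approx_nseq (2 ^ m) s1 (approx_scale k h).
have h2 := approx_inv s2 (approx_scale (2 * k) h).
have h3 := approx_cat (smooth_scale (2 ^ m)%:R s1) (smooth_onN cV openT s2) h1 h2.
(* Both sums of the construction are settled here: the times add up to 1, by the value of k^2, and
   the coefficients of t^m add up to 0, since (2 k)^m = 2^m k^m. *)
have h4 : bigO m.+1 (fun q => wmap w' q - target 1 q).
  apply: bigO_ext h3 => q; rewrite -/w'.
  have -> : (2 ^ m)%:R * (1 * k ^+ 2) + - (1 * (2 * k) ^+ 2) = 1 :> R.
    rewrite !mul1r exprMn k2 natrX.
    by move: p4 => /lt0r_neq0; move: (2 ^+ m) => x x0; field.
  have -> : (2 ^ m)%:R *: (k ^+ m *: e q.2) - (2 * k) ^+ m *: e q.2 = 0.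
    by rewrite scalerA natrX -exprMn subrr.
  by rewrite scaler0 subr0.
(* The improved word again differs from the target by a smooth family, so its next error has a
   smooth coefficient and the step can be repeated. *)
have [e' [se' he']] := leading_expand cV (good_wmap w') (good_target 1) h4.
by exists w', e'.
Qed.

Lemma raise_orders w m n e : (2 < m)%N -> smooth_on setT e -> approx w 1 m e ->
  exists w', bigO (m + n) (fun q => wmap w' q - target 1 q).
Proof.
elim: n w m e => [|n IH] w m e m2 se h.
  by exists w; rewrite addn0; exact: (expand_bigO se h).
have [w' [e' [se' h']]] := raise_order m2 se h.
by rewrite addnS -addSn; apply: IH h' => //; exact: ltnW.
Qed.

End Words.

(** * Commutator loops and the word of lowest order *)

Section BaseMethod.
Context {R : realType} {V : normedModType R} (cV : coordsys V).
Implicit Types (P Q F : R * V -> V) (e A B : V -> V) (z : V) (m : nat).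
Local Notation idfam := (fun q : R * V => q.2).

Definition lie_bracket A B z : V := 'D_(A z) B z - 'D_(B z) A z.

Lemma smooth_derive_field A B : smooth_on setT A -> smooth_on setT B ->
  smooth_on setT (fun z => 'D_(A z) B z).
Proof.
move=> sA sB; have oT : open [set: V] by exact: openT.
apply: (smooth_on_comp (F := fun z => (z, A z)) (G := fun q : V * V => 'D_(q.2) B q.1)
  (coordsys_prod cV cV) cV (B := setT) oT) => //.
  by apply: smooth_on_pair => //; exact: smooth_on_id.
exact: smooth_derive_dir.
Qed.

Lemma smooth_lie_bracket A B : smooth_on setT A -> smooth_on setT B ->
  smooth_on setT (lie_bracket A B).
Proof.
move=> sA sB; have oT : open [set: V] by exact: openT.
apply: smooth_onD => //; first exact: smooth_derive_field.
by apply: smooth_onN => //; exact: smooth_derive_field.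
Qed.

(** The time derivative at 0 of [e] along the flow of [A] is D_A e, which identifies the leading
    coefficient of the O(t) family e o Phi - e. *)
Lemma flow_taylor1 A e : smooth_on setT A -> smooth_on setT e ->
  bigO 2 (fun q => e (flow_map A q) - e q.2 - q.1 *: 'D_(A q.2) e q.2).
Proof.
move=> sA se; have gA := good_flow_map cV sA.
have oT : open [set: V] by exact: openT.
have sF z : smooth_near (fun q => e (flow_map A q) - e q.2) (0, z).
  apply: (smooth_nearB cV).
    by apply: (smooth_near_comp cV cV (gA.2 z)); exact: (smooth_on_near oT).
  apply: (smooth_near_comp cV cV ((@good_snd R V).2 z)).
  exact: (smooth_on_near oT).
have hF : bigO 1 (fun q => e (flow_map A q) - e q.2) by exact: bigO1_smooth.
apply: bigO_ext (leading_bigO cV sF hF) => q; rewrite expr1 /leading.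
have h : is_derive (0 : R) 1 (fun s : R => e (flow_map A (s, q.2)) - e q.2)
    ('D_(A q.2) e q.2).
  have M0 : 0 < `|q.2| + 1 by rewrite ltr_wpDl.
  have [d [d0 [_ _ hd]]] := flow_box cV sA M0.
  have := hd 0 q.2; rewrite normr0 => /(_ d0); rewrite ltrDl ltr01 => /(_ isT) h.
  have de : differentiable e (vflow A 0 q.2) by exact: field_differentiable.
  have := is_deriveB (is_derive_comp h de) (is_derive_cst (e q.2) (0 : R) (1 : R)).
  by rewrite subr0 (vflow0 cV).
have h' := is_derive_pair (is_derive_id (0 : R) (1 : R)) (is_derive_cst q.2 (0 : R) (1 : R)).
have dF : differentiable (fun q => e (flow_map A q) - e q.2) (0, q.2).
  exact: (smooth_near_at [::] (sF q.2)).
have h2 := is_derive_comp h' dF.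
have -> : tderive 1 (fun q => e (flow_map A q) - e q.2) (0, q.2) = 'D_(A q.2) e q.2.
  rewrite /tderive /=.
  by rewrite -(@derive_val _ _ _ _ _ _ _ h) -(@derive_val _ _ _ _ _ _ _ h2).
by rewrite (_ : 1`! = 1%N) // invr1 scale1r.
Qed.

Lemma flow_taylor A : smooth_on setT A ->
  bigO 2 (fun q => flow_map A q - q.2 - q.1 *: A q.2).
Proof.
move=> sA; have h := flow_taylor1 sA (smooth_on_id (@openT V)).
by apply: bigO_ext h => q; rewrite derive_id.
Qed.

(** At time t^2 the first-order expansion of the flow has an error O(t^4), of which only O(t^3) is
    kept. *)
Lemma expand_square A : smooth_on setT A ->
  expand (fun q => vflow A (1 * q.1 ^+ 2) q.2) idfam 2 A.
Proof.
move=> sA; have h := bigO_reparam 1 1 (flow_taylor sA).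
by apply: bigO_ext (bigOW h) => q; rewrite /flow_map /= mul1r.
Qed.

(** The two orders of composition share all terms except the mixed second-order ones, D_A B and D_B
    A; their difference is the bracket. *)
Lemma expand_swap A B : smooth_on setT A -> smooth_on setT B ->
  expand (fcomp (flow_map B) (flow_map A)) (fcomp (flow_map A) (flow_map B)) 2
    (lie_bracket A B).
Proof.
move=> sA sB.
(* The flow of D is split as id + t D plus a remainder O(t^2). Along the displacement O(t) made by C
   the remainder changes by O(t^3), while t D changes by t^2 D_C D. *)
have mixed (C D : V -> V) : smooth_on setT C -> smooth_on setT D -> bigO 3 (fun q =>
    flow_map D (q.1, flow_map C q) - flow_map D q - (flow_map C q - q.2)
    - q.1 ^+ 2 *: 'D_(C q.2) D q.2).
  move=> sC sD; have gC := good_flow_map cV sC; have gD := good_flow_map cV sD.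
  have oT : open [set: R * V] by exact: openT.
  have sR z : smooth_near (fun q => flow_map D q - q.2 - q.1 *: D q.2) (0, z).
    apply: (smooth_nearB cV); first by apply: (smooth_nearB cV (gD.2 z)); exact: (@good_snd R V).2.
    apply: (smooth_on_near oT) => //; apply: (smooth_onZ cV) => //; first exact: smooth_fst.
    exact: (smooth_on_comp (F := fun q : R * V => q.2) cV cV (B := setT) oT _ (smooth_snd oT)).
  have alg (a b x y z c d : V) (t : R) :
      a - x - t *: b - (y - z - t *: c) + t *: (b - c - t *: d)
      = a - y - (x - z) - (t * t) *: d by vec cV.
  have k1 := bigO_compB cV sR (flow_taylor sD) gC (@good_snd R V) (bigO1_good cV gC).
  have k2 := bigO_pow 1 (flow_taylor1 sC sD).
  apply: bigO_ext (bigOD k1 k2) => -[t z] /=.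
  by rewrite expr1 expr2; exact: alg.
have h1 := mixed A B sA sB; have h2 := mixed B A sB sA.
have alg (a b x y z c d : V) (t : R) :
    a - y - (x - z) - t *: c - (b - x - (y - z) - t *: d) = a - b - t *: (c - d).
  by vec cV.
by apply: bigO_ext (bigOD h1 (bigON h2)) => q; exact: alg.
Qed.

Section Generators.
Context {G : Type} (X : G -> V -> V).
Hypothesis sX : forall g, smooth_on setT (X g).

Lemma expand_id_cat w1 w2 e1 e2 : smooth_on setT e1 -> smooth_on setT e2 ->
  expand (wmap X w1) idfam 2 e1 -> expand (wmap X w2) idfam 2 e2 ->
  expand (wmap X (w1 ++ w2)) idfam 2 (fun z => e1 z + e2 z).
Proof.
move=> s1 s2 h1 h2; rewrite wmap_cat.
exact: (expand_fcomp cV (good_wmap cV sX w1) (@good_snd R V) (good_wmap cV sX w2)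
  (@good_snd R V) s1 s2 h1 h2).
Qed.

Lemma expand_letter g : expand (wmap X [:: (g, 1, 1%N)]) idfam 2 (X g).
Proof. by rewrite wmap1; exact: expand_square. Qed.

(** The loop is one order of composition followed by the inverse of the other, so the bracket
    measuring the failure to commute becomes its displacement from the identity. *)
Lemma expand_commutator g h :
  expand (wmap X [:: (g, 1, 0%N); (h, 1, 0%N); (g, -1, 0%N); (h, -1, 0%N)]) idfam 2
    (lie_bracket (X g) (X h)).
Proof.
have lE k : lmap X (k, 1, 0%N) = flow_map (X k).
  by apply/funext => q; rewrite /lmap /ltime /= mul1r expr1.
pose T := [:: (h, 1 : R, 0%N); (g, 1, 0%N)].
have -> : [:: (g, 1, 0%N); (h, 1, 0%N); (g, -1, 0%N); (h, -1, 0%N)] =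
  [:: (g, 1 : R, 0%N); (h, 1, 0%N)] ++ winv T by [].
rewrite wmap_cat.
have hE (u v : G) : wmap X [:: (u, 1, 0%N); (v, 1, 0%N)] = fcomp (flow_map (X v)) (flow_map (X u)).
  by rewrite wmap_cons wmap1 !lE.
have oT : open [set: V] by exact: openT.
have s0 : smooth_on setT (fun _ : V => 0 : V) by exact: smooth_on_cst.
have h0 : expand (wmap X (winv T)) (wmap X (winv T)) 2 (fun=> 0).
  move=> z; exists 0; apply: (near_open (A := setT) openT I) => q _.
  by rewrite subrr scaler0 subr0 normr0 mul0r.
have h1 := expand_swap (sX g) (sX h); rewrite -!hE in h1.
have := expand_fcomp cV (good_wmap cV sX _) (good_wmap cV sX T) (good_wmap cV sX (winv T))
  (good_wmap cV sX (winv T)) (smooth_lie_bracket (sX g) (sX h)) s0 h1 h0.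
apply: bigO_near => z; have := wmap_inv cV sX T z.
by apply: filterS => q e; rewrite {2}/fcomp e addr0.
Qed.

Lemma expand_commutators (J : Type) (a b : J -> G) (s : seq J) : exists w,
  expand (wmap X w) idfam 2 (fun z => \sum_(i <- s) lie_bracket (X (a i)) (X (b i)) z) /\
  smooth_on setT (fun z => \sum_(i <- s) lie_bracket (X (a i)) (X (b i)) z).
Proof.
have oT : open [set: V] by exact: openT.
elim: s => [|i s [w [hw sw]]].
  have -> : (fun z => \sum_(i <- [::]) lie_bracket (X (a i)) (X (b i)) z) = fun=> 0.
    by apply/funext => z; rewrite big_nil.
  exists [::]; split; last exact: smooth_on_cst.
  move=> z; exists 0; apply: (near_open (A := setT) openT I) => q _.
  by rewrite /wmap /= subrr scaler0 subr0 normr0 mul0r.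
have -> : (fun z => \sum_(i <- i :: s) lie_bracket (X (a i)) (X (b i)) z) =
    fun z => lie_bracket (X (a i)) (X (b i)) z + \sum_(i <- s) lie_bracket (X (a i)) (X (b i)) z.
  by apply/funext => z; rewrite big_cons.
have sb := smooth_lie_bracket (sX (a i)) (sX (b i)).
exists ([:: (a i, 1, 0%N); (b i, 1, 0%N); (a i, -1, 0%N); (b i, -1, 0%N)] ++ w); split.
  exact: expand_id_cat sb sw (expand_commutator _ _) hw.
exact: smooth_onD.
Qed.

Lemma second_order_word (J : finType) (g0 h0 : G) (a b : J -> G) (Y : V -> V) :
  smooth_on setT Y ->
  (forall z, Y z = X g0 z + X h0 z + \sum_i lie_bracket (X (a i)) (X (b i)) z) ->
  exists w e, smooth_on setT e /\ approx X Y w 1 3 e.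
Proof.
move=> sY YE; have [w [hw sw]] := expand_commutators a b (index_enum J).
have oT : open [set: V] by exact: openT.
have h1 := expand_id_cat (sX g0) (sX h0) (expand_letter g0) (expand_letter h0).
have h2 := expand_id_cat (smooth_onD oT (sX g0) (sX h0)) sw h1 hw.
set w' := _ ++ w in h2.
(* The word and the flow of Y for time t^2 have the same coefficient of t^2, namely Y. *)
have h3 : bigO 3 (fun q => wmap X w' q - target Y 1 q).
  apply: bigO_ext (bigOD h2 (bigON (expand_square sY))) => q.
  by rewrite -YE /target; vec cV.
have [e [se he]] := leading_expand cV (good_wmap cV sX w') (good_target cV sY 1) h3.
by exists w', e.
Qed.

End Generators.

End BaseMethod.

(** * Contact Hamiltonian vector fields *)

Section JetFields.
Context {R : realType} {n : nat}.
Local Notation jet := (jet1 R n).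
Implicit Types (A B F : jet -> R) (z v w : jet).

Definition jet_coords : coordsys jet :=
  coordsys_prod (coordsys_prod (@coordsys_rV R n) (@coordsysR R)) (@coordsys_rV R n).

Lemma smooth_d_x i F : smooth_on setT F -> smooth_on setT (d_x i F).
Proof. exact: smooth_on_derive. Qed.

Lemma smooth_d_u F : smooth_on setT F -> smooth_on setT (d_u F).
Proof. exact: smooth_on_derive. Qed.

Lemma smooth_d_p i F : smooth_on setT F -> smooth_on setT (d_p i F).
Proof. exact: smooth_on_derive. Qed.

Lemma d_xE i F : d_x i F = 'D_((delta_mx 0 i, 0, 0) : jet) F.
Proof. by []. Qed.

Lemma d_uE F : d_u F = 'D_((0, 1, 0) : jet) F.
Proof. by []. Qed.

Lemma d_pE i F : d_p i F = 'D_((0, 0, delta_mx 0 i) : jet) F.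
Proof. by []. Qed.

Lemma derive_jet F z v : differentiable F z ->
  'D_v F z = \sum_i v.1.1 0 i * d_x i F z + v.1.2 * d_u F z + \sum_i v.2 0 i * d_p i F z.
Proof.
move=> dF; rewrite (derive_coord jet_coords _ dF) !big_sumType /=.
congr (_ + _ + _).
by rewrite (bigD1 tt) //= big1 ?addr0 // => -[].
Qed.

#[local] Opaque derive d_x d_u d_p.

(** Contractions over indices are kept as single terms, so that identities between brackets become
    polynomial identities. *)
Definition dot (a b : 'I_n -> jet -> R) z : R := \sum_i a i z * b i z.

Lemma dotC a b z : dot a b z = dot b a z.
Proof. by apply: eq_bigr => i _; rewrite mulrC. Qed.

Definition pcoord (i : 'I_n) z : R := jp z 0 i.

Lemma contact_jacobiE A B z : contact_jacobi A B z =
  dot (fun i => d_p i A) (fun i => d_x i B) z - dot (fun i => d_x i A) (fun i => d_p i B) z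
  + d_u A z * (B z - dot pcoord (fun i => d_p i B) z)
  - d_u B z * (A z - dot pcoord (fun i => d_p i A) z).
Proof. by rewrite /contact_jacobi /poisson sumrB. Qed.

Lemma contact_jacobi_antisym A B z : contact_jacobi A B z = - contact_jacobi B A z.
Proof.
rewrite !contact_jacobiE (dotC (fun i => d_p i B)) (dotC (fun i => d_x i B)).
have alg (x y u v : R) : x - y + u - v = - (y - x + v - u) by ring.
exact: alg.
Qed.

Lemma derive_jet_comp F z v (vx vp : 'I_n -> R) (vu : R) : differentiable F z ->
  (forall i, v.1.1 0 i = vx i) -> v.1.2 = vu -> (forall i, v.2 0 i = vp i) ->
  'D_v F z = \sum_i vx i * d_x i F z + vu * d_u F z + \sum_i vp i * d_p i F z.
Proof.
move=> dF hx hu hp; rewrite (derive_jet _ dF) hu; congr (_ + _ + _).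
  by apply: eq_bigr => i _; rewrite hx.
by apply: eq_bigr => i _; rewrite hp.
Qed.

Lemma sum_opp_mul (a p c : 'I_n -> R) (u : R) :
  \sum_i - (a i + p i * u) * c i = - (\sum_i a i * c i) - u * \sum_i p i * c i.
Proof.
rewrite mulr_sumr -!sumrN -big_split /=; apply: eq_bigr => i _; ring.
Qed.

(** The bracket is not a derivation in its second argument: it is X_A plus multiplication by
    dA/du. *)
Lemma derive_contact_vf A B z : differentiable B z ->
  'D_(contact_vf A z) B z = contact_jacobi A B z - d_u A z * B z.
Proof.
move=> dB; rewrite (@derive_jet_comp B z _ (fun i => d_p i A z)
  (fun i => - (d_x i A z + pcoord i z * d_u A z))
  (dot pcoord (fun i => d_p i A) z - A z) dB) //; last 2 first.
- by move=> i; rewrite mxE.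
- by move=> i; rewrite mxE.
rewrite (sum_opp_mul (fun i => d_x i A z) (pcoord ^~ z) (fun i => d_p i B z)).
rewrite contact_jacobiE.
have alg (x pa a bu q au pb b : R) : x + (pa - a) * bu + (- q - au * pb) =
  x - q + au * (b - pb) - bu * (a - pa) - au * b by ring.
exact: alg.
Qed.

Lemma smooth_pcoord i : smooth_on setT (pcoord i).
Proof.
have oT : open [set: jet] by exact: openT.
exact: (smooth_on_lin oT (@continuous_coord R _ (@coordsys_rV R n) i) (smooth_snd oT)).
Qed.

Lemma smoothM F A : smooth_on setT F -> smooth_on setT A ->
  smooth_on setT (fun z => F z * A z).
Proof. by move=> sF sA; exact: (smooth_onZ (@coordsysR R) (@openT jet) sF sA). Qed.

Lemma smoothB F A : smooth_on setT F -> smooth_on setT A ->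
  smooth_on setT (fun z => F z - A z).
Proof.
move=> sF sA; apply: (smooth_onD (@openT jet) sF).
exact: (smooth_onN (@coordsysR R) (@openT jet) sA).
Qed.

Lemma smooth_dot a b : (forall i, smooth_on setT (a i)) -> (forall i, smooth_on setT (b i)) ->
  smooth_on setT (dot a b).
Proof.
by move=> sa sb; apply: (smooth_on_sum (@openT jet)) => i; exact: smoothM.
Qed.

Lemma smooth_contact_jacobi A B : smooth_on setT A -> smooth_on setT B ->
  smooth_on setT (contact_jacobi A B).
Proof.
move=> sA sB; rewrite (_ : contact_jacobi A B = (fun z =>
  dot (fun i => d_p i A) (fun i => d_x i B) z - dot (fun i => d_x i A) (fun i => d_p i B) z
  + d_u A z * (B z - dot pcoord (fun i => d_p i B) z)
  - d_u B z * (A z - dot pcoord (fun i => d_p i A) z))); last first.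
  by apply/funext => z; rewrite contact_jacobiE.
have sx C i : smooth_on setT C -> smooth_on setT (d_x i C) := @smooth_d_x i C.
have sp C i : smooth_on setT C -> smooth_on setT (d_p i C) := @smooth_d_p i C.
have term C D : smooth_on setT C -> smooth_on setT D ->
    smooth_on setT (fun z => d_u C z * (D z - dot pcoord (fun i => d_p i D) z)).
  move=> sC sD; apply: smoothM; first exact: smooth_d_u.
  by apply: smoothB => //; apply: smooth_dot => i; [exact: smooth_pcoord|exact: sp].
apply: smoothB; last exact: term.
apply: (smooth_onD (@openT jet)); last exact: term.
by apply: smoothB; apply: smooth_dot => i; [exact: sp|exact: sx|exact: sx|exact: sp].
Qed.

Lemma smooth_row (f : 'I_n -> jet -> R) : (forall i, smooth_on setT (f i)) ->
  smooth_on setT (fun z => \row_i f i z).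
Proof.
move=> sf; apply/(smooth_on_coord (@coordsys_rV R n) _ (@openT jet)) => i.
by apply: (smooth_on_ext (@openT jet) _ (sf i)) => z _; rewrite /= /rV_coord mxE.
Qed.

Lemma smooth_contact_vf A : smooth_on setT A -> smooth_on setT (contact_vf A).
Proof.
move=> sA; have oT : open [set: jet] by exact: openT.
apply: smooth_on_pair => //; last first.
  apply: smooth_row => i; apply: (smooth_onN (@coordsysR R) oT).
  apply: (smooth_onD oT); first exact: smooth_d_x.
  by apply: (smoothM (smooth_pcoord i)); exact: smooth_d_u.
apply: smooth_on_pair => //; first by apply: smooth_row => i; exact: smooth_d_p.
apply: smoothB => //; apply: smooth_dot => i; first exact: smooth_pcoord.
exact: smooth_d_p.
Qed.

Lemma smooth_is_derive F z w : smooth_on setT F -> is_derive z w F ('D_w F z).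
Proof.
move=> sF; apply: DeriveDef => //; apply: diff_derivable.
exact: (smooth_on_differentiable (A := setT)).
Qed.

Lemma is_derive_mul F A z w dF dA : is_derive z w F dF -> is_derive z w A dA ->
  is_derive z w (fun z => F z * A z) (dF * A z + F z * dA).
Proof.
move=> hF hA; have h := is_deriveM hF hA.
by apply: is_derive_eq h _; rewrite addrC [_ *: dF]mulrC.
Qed.

Lemma is_derive_dot a b z w (da db : 'I_n -> R) :
  (forall i, is_derive z w (a i) (da i)) -> (forall i, is_derive z w (b i) (db i)) ->
  is_derive z w (dot a b) (\sum_i da i * b i z + \sum_i a i z * db i).
Proof.
move=> ha hb; rewrite -big_split /= /dot.
have h := is_derive_sum (fun i => is_derive_mul (ha i) (hb i)).
by move: h; congr is_derive; apply/funext => y; rewrite fct_sumE.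
Qed.

Lemma is_derive_pcoord i z w : is_derive z w (pcoord i) (w.2 0 i).
Proof.
have -> : w.2 0 i = 'D_w (pcoord i) z; last exact/smooth_is_derive/smooth_pcoord.
have := derive_lin w (@continuous_coord R _ jet_coords (inr i))
  (smooth_on_differentiable (z := z) (smooth_on_id (@openT jet)) I).
by rewrite derive_id => h; exact: esym h.
Qed.

(** A derivative in a constant direction falls on both entries. The only explicit coefficient in the
    bracket is p, and differentiating it gives the last two sums. *)
Lemma contact_jacobi_leibniz A B z w : smooth_on setT A -> smooth_on setT B ->
  'D_w (contact_jacobi A B) z =
  contact_jacobi ('D_w A) B z + contact_jacobi A ('D_w B) z
  - d_u A z * (\sum_i w.2 0 i * d_p i B z) + d_u B z * (\sum_i w.2 0 i * d_p i A z).
Proof.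
move=> sA sB.
have sw F v y : smooth_on setT F -> 'D_w ('D_v F) y = 'D_v ('D_w F) y.
  by move=> sF; exact: (schwarz (@coordsysR R) (A := setT) v w openT I sF).
have hu F : smooth_on setT F -> is_derive z w (d_u F) (d_u ('D_w F) z).
  by move=> sF; rewrite !d_uE -sw //; exact/smooth_is_derive/smooth_on_derive.
have hx F i : smooth_on setT F -> is_derive z w (d_x i F) (d_x i ('D_w F) z).
  by move=> sF; rewrite !d_xE -sw //; exact/smooth_is_derive/smooth_on_derive.
have hp F i : smooth_on setT F -> is_derive z w (d_p i F) (d_p i ('D_w F) z).
  by move=> sF; rewrite !d_pE -sw //; exact/smooth_is_derive/smooth_on_derive.
have h1 := is_derive_dot (fun i => hp A i sA) (fun i => hx B i sB).
have h2 := is_derive_dot (fun i => hx A i sA) (fun i => hp B i sB).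
have hq F : smooth_on setT F -> is_derive z w
    (fun z => F z - dot pcoord (fun i => d_p i F) z)
    ('D_w F z - (\sum_i w.2 0 i * d_p i F z + \sum_i pcoord i z * d_p i ('D_w F) z)).
  move=> sF; apply: is_deriveB; first exact: smooth_is_derive.
  exact: (is_derive_dot (fun i => is_derive_pcoord i z w) (fun i => hp F i sF)).
have h3 := is_derive_mul (hu A sA) (hq B sB).
have h4 := is_derive_mul (hu B sB) (hq A sA).
have h := is_deriveB (is_deriveD (is_deriveB h1 h2) h3) h4.
have -> : contact_jacobi A B = (fun z =>
  dot (fun i => d_p i A) (fun i => d_x i B) z - dot (fun i => d_x i A) (fun i => d_p i B) z
  + d_u A z * (B z - dot pcoord (fun i => d_p i B) z)
  - d_u B z * (A z - dot pcoord (fun i => d_p i A) z)).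
  by apply/funext => y; rewrite contact_jacobiE.
rewrite (@derive_val _ _ _ _ _ _ _ h) !contact_jacobiE /dot.
have alg (s1 s2 s3 s4 au au' b b' pb pb' wb bu bu' a a' pa pa' wa : R) :
  s1 + s2 - (s3 + s4) + (au' * (b - pb) + au * (b' - (wb + pb')))
  - (bu' * (a - pa) + bu * (a' - (wa + pa')))
  = s1 - s3 + au' * (b - pb) - bu * (a' - pa')
  + (s2 - s4 + au * (b' - pb') - bu' * (a - pa)) - au * wb + bu * wa by ring.
exact: alg.
Qed.

End JetFields.

Section Bracket.
Context {R : realType} {n : nat}.
Local Notation jet := (jet1 R n).
Implicit Types (A B F : jet -> R) (z v w : jet).

#[local] Opaque derive d_x d_u d_p.

Lemma contact_vf_x F i : (fun y => coord jet_coords (inl (inl i)) (contact_vf F y)) = d_p i F.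
Proof. by apply/funext => y; rewrite /= /rV_coord mxE. Qed.

Lemma contact_vf_u F : (fun y => coord jet_coords (inl (inr tt)) (contact_vf F y))
  = (fun y => dot pcoord (fun i => d_p i F) y - F y).
Proof. by []. Qed.

Lemma contact_vf_p F i : (fun y => coord jet_coords (inr i) (contact_vf F y))
  = (fun y => - (d_x i F y + pcoord i y * d_u F y)).
Proof. by apply/funext => y; rewrite /= /rV_coord mxE. Qed.

Lemma contact_vf_dp F y i : (contact_vf F y).2 0 i = - (d_x i F y + pcoord i y * d_u F y).
Proof. by rewrite mxE. Qed.

#[local] Opaque contact_vf contact_jacobi dot.

Lemma smooth_diff F z : smooth_on setT F -> differentiable F z.
Proof. by move=> sF; exact: (smooth_on_differentiable (A := setT)). Qed.

Lemma derive_bracket A B z w : smooth_on setT A -> smooth_on setT B ->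
  'D_w (contact_jacobi A B) z =
  'D_(contact_vf A z) ('D_w B) z - 'D_(contact_vf B z) ('D_w A) z
  + d_u A z * ('D_w B z - \sum_i w.2 0 i * d_p i B z)
  - d_u B z * ('D_w A z - \sum_i w.2 0 i * d_p i A z).
Proof.
move=> sA sB; rewrite contact_jacobi_leibniz // (contact_jacobi_antisym ('D_w A)).
rewrite !derive_contact_vf; last 2 first.
- exact/smooth_diff/smooth_on_derive.
- exact/smooth_diff/smooth_on_derive.
have alg (x y au bu b a wb wa : R) : - x + y - au * wb + bu * wa =
  y - au * b - (x - bu * a) + au * (b - wb) - bu * (a - wa) by ring.
exact: alg.
Qed.

(** In a momentum direction w the sum over [w.2] is D_w itself, so both corrections in
    [derive_bracket] vanish. *)
Lemma d_p_bracket i A B z : smooth_on setT A -> smooth_on setT B ->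
  d_p i (contact_jacobi A B) z =
  'D_(contact_vf A z) (d_p i B) z - 'D_(contact_vf B z) (d_p i A) z.
Proof.
move=> sA sB; rewrite !d_pE (derive_bracket _ _ sA sB).
set w := (_, _, _).
have e F : \sum_(j < n) w.2 0 j * d_p j F z = 'D_w F z.
  rewrite (_ : 'D_w F z = d_p i F z); last by rewrite d_pE.
  rewrite (bigD1 i) //= big1 ?addr0 => [|j ji].
    by rewrite mxE !eqxx mul1r.
  by rewrite mxE (negbTE ji) andbF mul0r.
rewrite (e A) (e B).
have alg (x y au b bu a : R) : x - y + au * (b - b) - bu * (a - a) = x - y by ring.
exact: alg.
Qed.

Lemma sum_row0 F z : \sum_(j < n) (0 : 'rV[R]_n) 0 j * d_p j F z = 0.
Proof. by rewrite big1 // => j _; rewrite mxE mul0r. Qed.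

Lemma d_x_bracket i A B z : smooth_on setT A -> smooth_on setT B ->
  d_x i (contact_jacobi A B) z =
  'D_(contact_vf A z) (d_x i B) z - 'D_(contact_vf B z) (d_x i A) z
  + d_u A z * d_x i B z - d_u B z * d_x i A z.
Proof.
move=> sA sB; rewrite !d_xE (derive_bracket _ _ sA sB).
rewrite (sum_row0 A) (sum_row0 B).
have alg (x y au b bu a : R) : x - y + au * (b - 0) - bu * (a - 0) =
  x - y + au * b - bu * a by ring.
exact: alg.
Qed.

(** Here the two corrections are both equal to the product of dA/du and dB/du and cancel each
    other. *)
Lemma d_u_bracket A B z : smooth_on setT A -> smooth_on setT B ->
  d_u (contact_jacobi A B) z =
  'D_(contact_vf A z) (d_u B) z - 'D_(contact_vf B z) (d_u A) z.
Proof.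
move=> sA sB; rewrite !d_uE (derive_bracket _ _ sA sB).
rewrite (sum_row0 A) (sum_row0 B) !d_uE.
have alg (x y a b : R) : x - y + a * (b - 0) - b * (a - 0) = x - y by ring.
exact: alg.
Qed.

Lemma derive_contact_vf_coord A z v (j : cidx (@jet_coords R n)) : smooth_on setT A ->
  coord jet_coords j ('D_v (contact_vf A) z) =
  'D_v (fun y => coord jet_coords j (contact_vf A y)) z.
Proof.
move=> sA; rewrite (derive_lin v (@continuous_coord _ _ jet_coords j)) //.
exact: (smooth_on_differentiable (A := setT) (smooth_contact_vf sA)).
Qed.

Lemma lie_bracket_coord A B z (j : cidx (@jet_coords R n)) :
  smooth_on setT A -> smooth_on setT B ->
  coord jet_coords j (lie_bracket (contact_vf A) (contact_vf B) z) =
  'D_(contact_vf A z) (fun y => coord jet_coords j (contact_vf B y)) z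
  - 'D_(contact_vf B z) (fun y => coord jet_coords j (contact_vf A y)) z.
Proof.
move=> sA sB; rewrite /lie_bracket coordD coordN; congr (_ - _).
  exact: derive_contact_vf_coord.
exact: derive_contact_vf_coord.
Qed.

Lemma derive_contact_vf_u F G z : smooth_on setT G ->
  'D_(contact_vf F z) (fun y => dot pcoord (fun i => d_p i G) y - G y) z =
  - dot (fun i => d_x i F) (fun i => d_p i G) z
  - d_u F z * dot pcoord (fun i => d_p i G) z
  + \sum_i pcoord i z * 'D_(contact_vf F z) (d_p i G) z
  - (contact_jacobi F G z - d_u F z * G z).
Proof.
move=> sG; rewrite -derive_contact_vf; last exact: smooth_diff.
have h1 := is_derive_dot (fun i => is_derive_pcoord i z (contact_vf F z))
  (fun i => smooth_is_derive z (contact_vf F z) (smooth_d_p i sG)).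
have h := is_deriveB h1 (smooth_is_derive z (contact_vf F z) sG).
rewrite (@derive_val _ _ _ _ _ _ _ h); congr (_ + _ - _).
rewrite -(sum_opp_mul (fun i => d_x i F z) (pcoord ^~ z) (fun i => d_p i G z)).
by apply: eq_bigr => i _; rewrite contact_vf_dp.
Qed.

Lemma derive_contact_vf_p F G z i : smooth_on setT G ->
  'D_(contact_vf F z) (fun y => - (d_x i G y + pcoord i y * d_u G y)) z =
  - ('D_(contact_vf F z) (d_x i G) z + (- (d_x i F z + pcoord i z * d_u F z) * d_u G z
    + pcoord i z * 'D_(contact_vf F z) (d_u G) z)).
Proof.
move=> sG; have h1 := is_derive_mul (is_derive_pcoord i z (contact_vf F z))
  (smooth_is_derive z (contact_vf F z) (smooth_d_u sG)).
have h := is_deriveN (is_deriveD (smooth_is_derive z (contact_vf F z) (smooth_d_x i sG)) h1).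
by rewrite (@derive_val _ _ _ _ _ _ _ h) contact_vf_dp.
Qed.

(** Each coordinate of the Lie bracket is X_A applied to a component of X_B minus the reverse. The
    formulas for the derivatives of the bracket reduce the x, u and p components to ring
    identities. *)
Lemma contact_vf_bracket A B z : smooth_on setT A -> smooth_on setT B ->
  contact_vf (contact_jacobi A B) z = lie_bracket (contact_vf A) (contact_vf B) z.
Proof.
move=> sA sB; apply: (coord_inj (cV := jet_coords)) => j.
rewrite (lie_bracket_coord z j sA sB).
case: j => [[i|[]]|i].
- have -> := congr1 (@^~ z) (contact_vf_x (contact_jacobi A B) i).
  by rewrite !contact_vf_x; exact: d_p_bracket.
- have -> := congr1 (@^~ z) (contact_vf_u (contact_jacobi A B)).
  rewrite !contact_vf_u (derive_contact_vf_u _ _ sA) (derive_contact_vf_u _ _ sB).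
  have -> : dot pcoord (fun i => d_p i (contact_jacobi A B)) z =
      \sum_i pcoord i z * 'D_(contact_vf A z) (d_p i B) z
      - \sum_i pcoord i z * 'D_(contact_vf B z) (d_p i A) z.
    by rewrite -sumrB; apply: eq_bigr => i _; rewrite (d_p_bracket _ _ sA sB) mulrBr.
  rewrite (contact_jacobi_antisym B A) contact_jacobiE.
  rewrite (dotC (fun i => d_p i A) (fun i => d_x i B)).
  have alg (x y au bu xb xa pa pb b a : R) :
    x - y - (xa - xb + au * (b - pb) - bu * (a - pa)) =
    - xb - au * pb + x - (xa - xb + au * (b - pb) - bu * (a - pa) - au * b)
    - (- xa - bu * pa + y - (- (xa - xb + au * (b - pb) - bu * (a - pa)) - bu * a)) by ring.
  exact: alg.
- have -> := congr1 (@^~ z) (contact_vf_p (contact_jacobi A B) i).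
  rewrite !contact_vf_p (derive_contact_vf_p _ _ _ sA) (derive_contact_vf_p _ _ _ sB).
  rewrite (d_x_bracket _ _ sA sB) (d_u_bracket _ sA sB).
  have alg (xb xa ub ua au bu ax bx p : R) :
    - (xb - xa + au * bx - bu * ax + p * (ub - ua)) =
    - (xb + (- (ax + p * au) * bu + p * ub)) - - (xa + (- (bx + p * bu) * au + p * ua))
    by ring.
  exact: alg.
Qed.

End Bracket.

(** * Flows preserve the contact structure *)

Section Contact.
Context {R : realType} {n : nat}.
Local Notation jet := (jet1 R n).
Local Notation cJ := (@jet_coords R n).
Implicit Types (H : jet -> R) (z v w : jet) (P Q : R * jet -> jet).

#[local] Opaque derive d_x d_u d_p contact_vf.

(** This is the Lie derivative identity L_{X_H} alpha = -(dH/du) alpha at the point y; the left-hand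
    side is the rate of change of alpha on a vector carried by the linearized flow. *)
Lemma contact_form_infinitesimal H y v : smooth_on setT H ->
  ju ('D_v (contact_vf H) y)
  - (\sum_i (contact_vf H y).2 0 i * jx v 0 i
     + \sum_i pcoord i y * jx ('D_v (contact_vf H) y) 0 i)
  = - d_u H y * contact_form y v.
Proof.
move=> sH.
have xE i : jx ('D_v (contact_vf H) y) 0 i = 'D_v (d_p i H) y.
  by have := derive_contact_vf_coord y v (inl (inl i)) sH; rewrite contact_vf_x.
have uE : ju ('D_v (contact_vf H) y) =
    \sum_i v.2 0 i * d_p i H y + \sum_i pcoord i y * 'D_v (d_p i H) y - 'D_v H y.
  have := derive_contact_vf_coord y v (inl (inr tt)) sH; rewrite contact_vf_u => e.
  have h1 := is_derive_dot (fun i => is_derive_pcoord i y v)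
    (fun i => smooth_is_derive y v (smooth_d_p i sH)).
  have h := is_deriveB h1 (smooth_is_derive y v sH).
  by rewrite -(@derive_val _ _ _ _ _ _ _ h); exact: e.
rewrite uE (derive_jet v (smooth_diff y sH)).
have -> : \sum_i pcoord i y * jx ('D_v (contact_vf H) y) 0 i =
    \sum_i pcoord i y * 'D_v (d_p i H) y by apply: eq_bigr => i _; rewrite xE.
have -> : \sum_i (contact_vf H y).2 0 i * jx v 0 i =
    - (\sum_i v.1.1 0 i * d_x i H y) - d_u H y * \sum_i pcoord i y * jx v 0 i.
  have e : \sum_i v.1.1 0 i * d_x i H y = \sum_i d_x i H y * jx v 0 i.
    by apply: eq_bigr => i _; rewrite mulrC.
  rewrite e -(sum_opp_mul (fun i => d_x i H y) (pcoord ^~ y) (fun i => jx v 0 i)).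
  by apply: eq_bigr => i _; rewrite contact_vf_dp.
have alg (wp pd xs vu u px : R) :
  wp + pd - (xs + vu * u + wp) - (- xs - u * px + pd) = - u * (vu - px) by ring.
exact: alg.
Qed.

Lemma is_derive_jx (g : R -> jet) (s : R) dg i : is_derive s 1 g dg ->
  is_derive s (1 : R) (fun r => jx (g r) 0 i) (jx dg 0 i).
Proof.
move=> h; exact: (is_derive_lin (@continuous_coord _ _ cJ (inl (inl i))) h).
Qed.

Lemma is_derive_ju (g : R -> jet) (s : R) dg : is_derive s 1 g dg ->
  is_derive s (1 : R) (fun r => ju (g r)) (ju dg).
Proof.
move=> h; exact: (is_derive_lin (@continuous_coord _ _ cJ (inl (inr tt))) h).
Qed.

Lemma is_derive_jp (g : R -> jet) (s : R) dg i : is_derive s 1 g dg ->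
  is_derive s (1 : R) (fun r => jp (g r) 0 i) (jp dg 0 i).
Proof.
move=> h; exact: (is_derive_lin (@continuous_coord _ _ cJ (inr i)) h).
Qed.

Lemma is_derive_mul_line (f g : R -> R) (s df dg : R) :
  is_derive s (1 : R) f df -> is_derive s (1 : R) g dg ->
  is_derive s (1 : R) (fun r => f r * g r) (df * g s + f s * dg).
Proof.
move=> hf hg; have h := is_deriveM hf hg.
by apply: is_derive_eq h _; rewrite addrC [_ *: df]mulrC.
Qed.

Lemma is_derive_contact_form (g e : R -> jet) (s : R) dg de :
  is_derive s 1 g dg -> is_derive s 1 e de ->
  is_derive s (1 : R) (fun r => contact_form (g r) (e r))
    (ju de - (\sum_i jp dg 0 i * jx (e s) 0 i + \sum_i jp (g s) 0 i * jx de 0 i)).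
Proof.
move=> hg he; apply: is_deriveB; first exact: is_derive_ju.
rewrite -big_split /=.
have h := is_derive_sum (fun i => is_derive_mul_line (is_derive_jp i hg) (is_derive_jx i he)).
by move: h; congr is_derive; apply/funext => y; rewrite fct_sumE.
Qed.

Lemma derive0_const (c : R -> R) :
  (forall s : R, 0 <= s <= 1 -> is_derive s (1 : R) c 0) -> c 1 = c 0.
Proof.
move=> dc; have hb (s : R) : 0 <= s <= 1 -> is_derive s (1 : R) (fun=> 0 : R) 0.
  by move=> _; exact: is_derive_cst.
have h0 (s : R) : 0 <= s <= 1 -> `|0 : R| <= 0 by rewrite normr0.
have := mean_value_ineq (@coordsysR R) ler01 dc hb h0.
by rewrite subrr normr_le0 subr_eq0 => /eqP.
Qed.

Lemma mul_expRN_eq (a b x y : R) :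
  a * expR (- x) = b * expR (- y) -> y = 0 -> a = expR x * b.
Proof.
move=> E y0; move: E; rewrite y0 oppr0 expR0 mulr1 => <-.
by rewrite mulrCA -expRD addrN expR0 mulr1.
Qed.

(* Along the flow, [a = alpha(D Phi v)] solves [a' = - (dH/du) a]. *)
Lemma contact_form_flow H (M : R) : smooth_on setT H -> 0 < M ->
  exists d : R, 0 < d /\ forall (t : R) z, `|t| < d -> `|z| < M ->
  exists lam, forall v,
    contact_form (flow_map (contact_vf H) (t, z))
      ('D_((0, v) : R * jet) (flow_map (contact_vf H)) (t, z))
    = expR lam * contact_form z v.
Proof.
move=> sH M0; have sX := smooth_contact_vf sH.
have [d [d0 [_ sPhi hd]]] := flow_box cJ sX M0.
exists d; split=> // t z td zM.
pose Y := contact_vf H; pose Phi := flow_map Y.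
have box01 (s : R) : 0 <= s <= 1 -> box d M (0 + t * s, z).
  move=> /andP[s0 s1]; split=> //=; rewrite add0r normrM (ger0_norm s0).
  by apply: le_lt_trans td; rewrite -[leRHS]mulr1 ler_wpM2l.
pose g s := Phi (0 + t * s, z).
pose h s := - t * d_u H (g s).
have dg (s : R) : 0 <= s <= 1 -> is_derive s 1 g (t *: Y (g s)).
  move=> /box01[/= sd _].
  by apply: (is_derive_reparam (g := fun r => vflow Y r z)); exact: hd.
have ch : continuous (fun s => h (clamp 0 1 s)).
  apply: continuous_clamp ler01 _ => s sT.
  apply: (@continuous_comp _ _ _ g (fun y => - t * d_u H y)).
    exact: is_derive_continuous (dg s sT).
  apply: (smooth_on_continuous (A := setT)) => //.
  apply: (smoothM (A := d_u H)); first by apply: smooth_on_cst; exact: openT.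
  exact: smooth_d_u.
(* The exponent of the integrating factor: exp(-G) times alpha along the flow is constant, and G
   does not depend on v. *)
have [G [G0 hG]] := primitive ch.
exists (G 1) => v.
have oB := @open_box R jet d M.
pose e s := 'D_((0, v) : R * jet) Phi (0 + t * s, z).
(* Exchanging time and space derivatives of the flow map turns the flow equation into the
   variational equation for D Phi v. *)
have de (s : R) : 0 <= s <= 1 -> is_derive s 1 e (t *: 'D_(e s) Y (g s)).
  move=> /box01 Bs; apply: (is_derive_reparam (g := fun r => 'D_((0, v) : R * jet) Phi (r, z))).
  set r := 0 + t * s in Bs *.
  have hp := is_derive_pair (is_derive_id r (1 : R)) (is_derive_cst z r (1 : R)).
  have dD := smooth_on_differentiable (smooth_on_derive ((0, v) : R * jet) sPhi) Bs.
  apply: is_derive_eq (is_derive_comp hp dD) _.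
  rewrite (schwarz cJ _ _ oB Bs sPhi).
  have eqn q : box d M q -> 'D_((1, 0) : R * jet) Phi q = Y (Phi q).
    case: q => a y Bq; have [/= ad yM] := Bq.
    have hq := is_derive_pair (is_derive_id a (1 : R)) (is_derive_cst y a (1 : R)).
    have hq' := is_derive_comp hq (smooth_on_differentiable sPhi Bq).
    by rewrite -(@derive_val _ _ _ _ _ _ _ hq') (@derive_val _ _ _ _ _ _ _ (hd a y ad yM)).
  rewrite (near_eq_derive _ (near_open oB Bs eqn)).
  have dP := smooth_on_differentiable sPhi Bs.
  have dY : differentiable Y (Phi (r, z)) by exact: field_differentiable.
  rewrite -[LHS]/('D_((0, v) : R * jet) (Y \o Phi) (r, z)).
  rewrite (deriveE _ (differentiable_comp dP dY)) (diff_comp dP dY) /=.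
  by rewrite -!deriveE.
have da (s : R) : 0 <= s <= 1 -> is_derive s (1 : R)
    (fun r => contact_form (g r) (e r)) (h s * contact_form (g s) (e s)).
  move=> sT; apply: is_derive_eq (is_derive_contact_form (dg s sT) (de s sT)) _.
  have alg := contact_form_infinitesimal (g s) (e s) sH.
  have -> : h s * contact_form (g s) (e s) =
      t * (- d_u H (g s) * contact_form (g s) (e s)) by rewrite /h mulrA mulrN mulNr.
  rewrite -alg mulrBr mulrDr; congr (_ - (_ + _)).
    by rewrite mulr_sumr; apply: eq_bigr => i _; rewrite mulrA /jp mxE.
  by rewrite mulr_sumr; apply: eq_bigr => i _; rewrite mulrCA /jx mxE.
have dE (s : R) : 0 <= s <= 1 -> is_derive s (1 : R) (fun r => expR (- G r))
    (- h s * expR (- G s)).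
  move=> sT; have hGs := hG s sT; rewrite clamp_id // in hGs.
  have := @is_derive1_comp R expR (- G) s _ _ (is_derive_expR ((- G) s)) (is_deriveN hGs).
  by move=> k; apply: is_derive_eq k _; rewrite mulrC.
have dc (s : R) : 0 <= s <= 1 -> is_derive s (1 : R)
    (fun r => contact_form (g r) (e r) * expR (- G r)) 0.
  move=> sT; apply: is_derive_eq (is_derive_mul_line (da s sT) (dE s sT)) _.
  have alg (a b c : R) : a * b * c + b * (- a * c) = 0 by ring.
  exact: alg.
have E := mul_expRN_eq (derive0_const dc) G0.
have g0 : g 0 = z by rewrite /g mulr0 addr0 /Phi /flow_map /= (vflow0 cJ).
have e0 : e 0 = v.
  rewrite /e mulr0 addr0 -derive_slice.
  rewrite (_ : (fun y => Phi (0, y)) = id) ?derive_id //.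
  by apply/funext => y; rewrite /Phi /flow_map /= (vflow0 cJ).
have g1 : g 1 = Phi (t, z) by rewrite /g mulr1 add0r.
have e1 : e 1 = 'D_((0, v) : R * jet) Phi (t, z) by rewrite /e mulr1 add0r.
by rewrite -/Y -/Phi -g1 -e1 E g0 e0.
Qed.

Definition contact_family P := forall z0, \forall q \near ((0 : R), z0),
  exists lam, forall v, contact_form (P q) ('D_((0, v) : R * jet) P q)
    = expR lam * contact_form q.2 v.

(** By the chain rule the conformal factors multiply, so their exponents add. *)
Lemma contact_fcomp P Q : good P -> good Q -> contact_family P -> contact_family Q ->
  contact_family (fcomp P Q).
Proof.
move=> gP gQ cP cQ z0.
have h1 : \forall q \near ((0 : R), z0), (smooth_near P (q.1, Q q)) /\
    exists lam, forall v, contact_form (P (q.1, Q q)) ('D_((0, v) : R * jet) P (q.1, Q q))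
    = expR lam * contact_form (Q q) v.
  exact: (@good_continuous_pair _ _ Q z0 gQ) _
    (near_and (smooth_near_near (gP.2 z0)) (cP z0)).
have h2 := near_and (smooth_near_near (gQ.2 z0)) (cQ z0).
apply: filterS2 h1 h2 => -[t z] /= [sP [l1 e1]] [sQ [l2 e2]].
have dQ : differentiable (fun y => Q (t, y)) z.
  exact: (smooth_near_at [::] (smooth_near_slice (@coordsysR R) cJ cJ sQ)).
have dP : differentiable (fun y => P (t, y)) (Q (t, z)).
  exact: (smooth_near_at [::] (smooth_near_slice (@coordsysR R) cJ cJ sP)).
exists (l1 + l2) => v.
have key : 'D_((0, v) : R * jet) (fcomp P Q) (t, z) =
    'D_((0, 'D_((0, v) : R * jet) Q (t, z)) : R * jet) P (t, Q (t, z)).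
  have k1 := derive_slice (fcomp P Q) t v z.
  have k2 := derive_slice Q t v z.
  have k3 := derive_slice P t ('D_((0, v) : R * jet) Q (t, z)) (Q (t, z)).
  rewrite -k1 -k3 -k2.
  rewrite -[LHS]/('D_v ((fun y => P (t, y)) \o (fun y => Q (t, y))) z).
  rewrite (deriveE _ (differentiable_comp dQ dP)) (diff_comp dQ dP) /=.
  by rewrite (deriveE _ dP) (deriveE _ dQ).
have h := e1 ('D_((0, v) : R * jet) Q (t, z)); rewrite (e2 v) in h.
by rewrite key expRD -mulrA; exact: h.
Qed.

Lemma contact_wmap (G : Type) (Hg : G -> jet -> R) (w : seq (@letter R G)) :
  (forall g, smooth_on setT (Hg g)) ->
  contact_family (wmap (fun g => contact_vf (Hg g)) w).
Proof.
move=> sH; have sX g := smooth_contact_vf (sH g).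
elim: w => [|l w IH].
  move=> z0; apply: (near_open (A := setT) openT I) => -[t z] _.
  exists 0 => v; rewrite expR0 mul1r -derive_slice.
  by rewrite (_ : (fun y => wmap _ [::] (t, y)) = id) ?derive_id.
rewrite wmap_cons; apply: (contact_fcomp (good_wmap cJ sX w) (good_lmap cJ sX l) IH).
move=> z0; have M0 : 0 < `|z0| + 2 by rewrite ltr_wpDl.
have [d [d0 hd]] := contact_form_flow (sH l.1.1) M0.
have [e1 e10 he1] : exists2 e : R, 0 < e & forall t : R, `|t - 0| <= e -> `|ltime l t| < d.
  apply: nbhs_ball_le; have /cvgrPdist_lt/(_ _ d0) := @continuous_ltime R G l.
  by apply: filterS => t; rewrite ltime0 sub0r normrN.
apply/near_boxP; exists (Num.min 1 e1); first by rewrite lt_min ltr01.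
move=> t z; rewrite !le_min => /andP[_ t1] /andP[z1 _].
have td : `|ltime l t| < d by apply: he1; rewrite subr0.
have zM : `|z| < `|z0| + 2.
  by rewrite -[z](subrK z0); apply: le_lt_trans (ler_normD _ _) _; lra.
have [lam hl] := hd _ _ td zM; exists lam => v.
by have := hl v; rewrite -!derive_slice.
Qed.

End Contact.

(** * Uniformity on compact sets and the order estimate *)

Section Tube.
Context {R : realType} {V : normedModType R} (cV : coordsys V).

(** Compactness of the closed ball, with the pair (t, C) taken along the product of t near 0 and C
    near infinity; monotonicity in C makes the local constants eventually valid, and one covering
    argument yields both bounds. *)
Lemma tube (M : R) (S : R -> R * V -> Prop) :
  (forall C C' q, C <= C' -> S C q -> S C' q) ->
  (forall z : V, exists C : R, \forall q \near ((0 : R), z), S C q) ->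
  exists C d : R, 0 < d /\ forall (t : R) z, `|t| < d -> `|z| <= M -> S C (t, z).
Proof.
move=> mono hS.
have /compact_near_coveringP cov := @coord_compact R V cV M.
pose T (i : R * R) z := S i.2 (i.1, z).
have := cov (R * R)%type (filter_prod (nbhs (0 : R)) (pinfty_nbhs R)) T _.
have h (z : V) : `|z| <= M ->
    \forall z' \near z & i \near (filter_prod (nbhs (0 : R)) (pinfty_nbhs R)), T i z'.
  move=> _; have [C /near_boxP[e e0 he]] := hS z.
  exists ([set z' | `|z' - z| <= e], [set i : R * R | `|i.1| <= e /\ C <= i.2]).
    split=> /=; first exact: (ball_le_nbhs e0).
    exists ([set t : R | `|t| <= e], [set c : R | C <= c]).
      split=> /=; first by apply: (ball_le_nbhs e0) => t; rewrite subr0.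
      by exists C; split; [exact: num_real|move=> x /ltW].
    by case=> t c [].
  move=> [z' [t c]] [/= z'e [te Cc]].
  by apply: mono Cc _; exact: he.
move=> /(_ _ h) [[A B] [/= A0 Boo] hAB].
have [d d0 hd] := nbhs_ball_le A0.
have [C [_ hC]] : exists C : R, C \is Num.real /\ forall x, C < x -> B x by case: Boo => C [? ?]; exists C.
exists (C + 1), d; split=> // t z td zM.
apply: (hAB (t, C + 1)) => //; split=> /=; last by apply: hC; rewrite ltrDl.
by apply: hd; rewrite subr0 ltW.
Qed.

Lemma tube_prop (M : R) (S : R * V -> Prop) :
  (forall z : V, \forall q \near ((0 : R), z), S q) ->
  exists d : R, 0 < d /\ forall (t : R) z, `|t| < d -> `|z| <= M -> S (t, z).
Proof.
move=> hS; have [//|z|_ [d [d0 hd]]] := @tube M (fun _ => S); first by exists 0.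
by exists d.
Qed.

End Tube.

Section SumOfFields.
Context {R : realType} {n : nat}.
Local Notation jet := (jet1 R n).
Implicit Types (A B : jet -> R) (z : jet).

Lemma contact_vfD A B z : smooth_on setT A -> smooth_on setT B ->
  contact_vf (fun y => A y + B y) z = contact_vf A z + contact_vf B z.
Proof.
move=> sA sB; have dA := smooth_diff z sA; have dB := smooth_diff z sB.
have D v : 'D_v (fun y => A y + B y) z = 'D_v A z + 'D_v B z.
  by rewrite -[LHS]/('D_v (A \+ B) z) deriveD //; exact: diff_derivable.
have dpE i : d_p i (fun y => A y + B y) z = d_p i A z + d_p i B z := D _.
have dxE i : d_x i (fun y => A y + B y) z = d_x i A z + d_x i B z := D _.
have duE : d_u (fun y => A y + B y) z = d_u A z + d_u B z := D _.
rewrite /contact_vf; congr (_, _, _).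
- by apply/rowP => i; rewrite !mxE.
- have -> : \sum_i jp z 0 i * d_p i (fun y => A y + B y) z =
      \sum_i jp z 0 i * d_p i A z + \sum_i jp z 0 i * d_p i B z.
    by rewrite -big_split /=; apply: eq_bigr => i _; rewrite dpE mulrDr.
  by rewrite opprD addrACA.
- apply/rowP => i; rewrite !mxE dxE duE mulrDr -opprD; congr (- _).
  by rewrite addrACA.
Qed.

Lemma contact_vf_sum (J : Type) (s : seq J) (A : J -> jet -> R) z :
  (forall i, smooth_on setT (A i)) ->
  smooth_on setT (fun y => \sum_(i <- s) A i y) /\
  contact_vf (fun y => \sum_(i <- s) A i y) z = \sum_(i <- s) contact_vf (A i) z.
Proof.
move=> sA; have oT : open [set: jet] by exact: openT.
elim: s => [|i s [ss IH]].
  have -> : (fun y => \sum_(i <- [::]) A i y) = fun=> 0.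
    by apply/funext => y; rewrite big_nil.
  rewrite big_nil; split; first exact: smooth_on_cst.
  (* The field of the zero function vanishes because X_(0+0) = X_0 + X_0. *)
  have c0 := smooth_on_cst (0 : R) oT.
  have := contact_vfD z c0 c0; under eq_fun do rewrite addr0.
  by move=> e; apply: (addrI (contact_vf (fun=> 0) z)); rewrite -e addr0.
have -> : (fun y => \sum_(i <- i :: s) A i y) = (fun y => A i y + \sum_(i <- s) A i y).
  by apply/funext => y; rewrite big_cons.
split; first exact: (smooth_onD oT).
by rewrite big_cons contact_vfD // IH.
Qed.

Lemma pdiff_smooth A : pdiff A -> smooth_on setT A.
Proof.
have oT : open [set: jet] by exact: openT.
have cB := coordsys_prod (@coordsys_rV R n) (@coordsysR R).
have lift (f : 'rV[R]_n * R -> R) : smooth_on setT f -> smooth_on setT (fun z : jet => f (jxu z)).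
  move=> sf; apply: (smooth_on_comp (F := fun z : jet => z.1) (G := f) cB (@coordsysR R)
    (B := setT) oT) => //.
  exact: smooth_fst.
move=> [f [g [sf sg hA]]].
apply: (smooth_on_ext (F := fun z => f (jxu z) + \sum_(i < n) g i (jxu z) * jp z 0 i) oT).
  by move=> z _; rewrite hA.
apply: (smooth_onD oT (lift _ sf)); apply: (smooth_on_sum oT) => i.
apply: (smoothM (lift _ (sg i))); exact: smooth_pcoord.
Qed.

End SumOfFields.

Section OneSided.
Context {R : realType} {n : nat}.
Local Notation jet := (jet1 R n).
Local Notation cJ := (@jet_coords R n).
Context {G : Type} (Hg : G -> jet -> R) (H : jet -> R).
Hypothesis sHg : forall g, smooth_on setT (Hg g).
Hypothesis sH : smooth_on setT H.
Local Notation X := (fun g => contact_vf (Hg g)).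
Local Notation Y := (contact_vf H).

Definition hword (w : seq (@letter R G)) (t : R) : seq ((jet -> R) * R) :=
  map (fun l => (Hg l.1.1, ltime l t)) w.

Let sX g : smooth_on setT (X g). Proof. exact: smooth_contact_vf. Qed.

Let sY : smooth_on setT Y. Proof. exact: smooth_contact_vf. Qed.

Lemma flow_comp_cat (u v : seq ((jet -> R) * R)) z :
  flow_comp (u ++ v) z = flow_comp v (flow_comp u z).
Proof. exact: foldl_cat. Qed.

Lemma flow_comp_defined_cat (u v : seq ((jet -> R) * R)) z :
  flow_comp_defined u z -> flow_comp_defined v (flow_comp u z) ->
  flow_comp_defined (u ++ v) z.
Proof. by elim: u z => //= a u IH z [h1 h2] h3; split=> //; exact: IH. Qed.

Lemma flow_comp_hword w t z : flow_comp (hword w t) z = wmap X w (t, z).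
Proof. by elim: w z => //= l w IH z; rewrite IH wmap_cons. Qed.

Lemma wmap0 w z : wmap X w (0, z) = z.
Proof. exact: (good_wmap cJ sX w).1. Qed.

Lemma hword0_defined w z : flow_comp_defined (hword w 0) z.
Proof.
elim: w z => //= l w IH z; rewrite ltime0; split; last exact: IH.
by exists z; exact: flowto0.
Qed.

Lemma near_flow_defined (A : jet -> R) (f : R -> R) (z : jet) : smooth_on setT A ->
  {for 0, continuous f} -> f 0 = 0 ->
  \forall q \near ((0 : R), z), flow_defined A (f q.1) q.2.
Proof.
move=> sA cf f0; have M0 : 0 < `|z| + 2 by rewrite ltr_wpDl.
have [d [d0 [hd _ _]]] := flow_box cJ (smooth_contact_vf sA) M0.
have [e e0 he] : exists2 e : R, 0 < e & forall t : R, `|t - 0| <= e -> `|f t| < d.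
  apply: nbhs_ball_le; have /cvgrPdist_lt/(_ _ d0) := cf.
  by apply: filterS => t; rewrite f0 sub0r normrN.
apply/near_boxP; exists (Num.min 1 e); first by rewrite lt_min ltr01.
move=> t y; rewrite !le_min => /andP[_ t1] /andP[y1 _].
have td : `|f t| < d by apply: he; rewrite subr0.
have yM : `|y| < `|z| + 2.
  by rewrite -[y](subrK z); apply: le_lt_trans (ler_normD _ _) _; lra.
by exists (vflow (contact_vf A) (f t) y); have [] := hd _ _ td yM.
Qed.

Lemma near_hword_defined w (z : jet) :
  \forall q \near ((0 : R), z), flow_comp_defined (hword w q.1) q.2.
Proof.
elim: w z => [|l w IH] z; first exact: (near_open (A := setT) openT I).
have h1 : \forall q \near ((0 : R), z),
    flow_comp_defined (hword w q.1) (lmap X l q).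
  exact: (@good_continuous_pair _ _ _ z (good_lmap cJ sX l)) _ (IH z).
have h2 := near_flow_defined z (sHg l.1.1) (@continuous_ltime R G l) (ltime0 l).
by apply: filterS2 h1 h2.
Qed.

Lemma near_displacement (P : R * jet -> jet) (z : jet) : good P ->
  \forall q \near ((0 : R), z), `|P q - q.2| < 1.
Proof.
move=> gP; have sF : smooth_near (fun q => P q - q.2) (0, z).
  by apply: (smooth_nearB cJ); [exact: gP.2|exact: (@good_snd R jet).2].
have /cvgrPdist_lt/(_ 1 ltr01) := smooth_near_continuous sF.
by apply: filterS => q; rewrite gP.1 subrr sub0r normrN.
Qed.

(** The inverse is the inverse word at the same t. Points move by less than 1, so estimates on the
    ball of radius M + 1 cover both the domain and its image. *)
Lemma contactomorphism_wmap w (M : R) : exists d : R, 0 < d /\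
  forall t : R, `|t| < d ->
  local_contactomorphism [set z : jet | `|z| < M] (fun z => wmap X w (t, z)).
Proof.
pose P := wmap X w; pose Q := wmap X (winv w).
have gP : good P := good_wmap cJ sX w; have gQ : good Q := good_wmap cJ sX (winv w).
have kQP z := wmap_inv cJ sX w z.
have kPQ z := wmap_inv cJ sX (winv w) z.
have [d [d0 hd]] := tube_prop cJ (M + 1) (fun z : jet =>
  near_and (near_and (near_and (kQP z) (kPQ z)) (near_displacement z gP))
    (near_and (near_and (smooth_near_near (gP.2 z)) (smooth_near_near (gQ.2 z)))
      (contact_wmap w sHg z))).
exists d; split=> // t td.
have le1 (z : jet) : `|z| < M -> `|z| <= M + 1 by lra.
have oV : open [set z : jet | `|z| < M] by exact: open_ball_norm.
have oB : open [set z : jet | `|z| < M + 1] by exact: open_ball_norm.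
have sl (F : R * jet -> jet) y : smooth_near F (t, y) -> smooth_near (fun z => F (t, z)) y.
  exact: (smooth_near_slice (@coordsysR R) cJ cJ).
(* Describing the image as a preimage under the continuous inverse shows that it is open, without an
   inverse function theorem. *)
have imE : (fun z => P (t, z)) @` [set z : jet | `|z| < M] =
    [set y : jet | `|y| < M + 1 /\ [set z : jet | `|z| < M] (Q (t, y))].
  apply/seteqP; split=> [_ /= [z zM <-]|y /= [yM Qy]].
    have [[[e1 _] e2] _] := hd t z td (le1 z zM); move: e1 e2 => /= e1 e2.
    rewrite /Q e1; split=> //; rewrite -[P (t, z)](subrK z).
    by apply: le_lt_trans (ler_normD _ _) _; move: e2 zM; rewrite /P; lra.
  have [[[_ e1] _] _] := hd t y td (ltW yM).
  by exists (Q (t, y)) => //; move: e1; rewrite winvK.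
have cQ y : `|y| < M + 1 -> smooth_near (fun z => Q (t, z)) y.
  by move=> yM; have [_ [[_ s2] _]] := hd t y td (ltW yM); exact: sl.
have sP : smooth_on [set z : jet | `|z| < M] (fun z => P (t, z)).
  apply: smooth_near_on => z zM.
  by have [_ [[s1 _] _]] := hd t z td (le1 z zM); exact: sl.
split; first split => //.
- rewrite imE; apply: open_preimage => // y yM.
  exact: (smooth_near_continuous (cQ y yM)).
- exists (fun y => Q (t, y)); split=> [|z zM].
    by rewrite imE; apply: smooth_near_on => y [yM _]; exact: cQ.
  by have [[[e1 _] _] _] := hd t z td (le1 z zM).
have /choice[lam hlam] (z : jet) : exists lam : R, `|z| < M -> forall v,
    contact_form (P (t, z)) ('D_((0, v) : R * jet) P (t, z)) = expR lam * contact_form z v.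
  have [zM|zM] := pselect (`|z| < M); last by exists 0.
  by have [_ [_ [lam hl]]] := hd t z td (le1 z zM); exists lam.
exists lam => z v zM.
have dP := smooth_on_differentiable sP zM.
by rewrite -(hlam z zM v) -derive_slice -deriveE.
Qed.

Lemma flow_regular (c M : R) : exists d : R, 0 < d /\ forall t : R, `|t| < d ->
  (forall z : jet, `|z| < M -> flow_defined H (c * t ^+ 2) z) /\
  smooth_on [set z : jet | `|z| < M] (flow H (c * t ^+ 2)).
Proof.
have cc : {for 0, continuous (fun x : R => c * x ^+ 2)}.
  exact: (smooth_on_continuous (A := setT) (smooth_monomial c 2)).
have c0 : c * 0 ^+ 2 = 0 by rewrite expr0n mulr0.
have gT := good_target cJ sY c.
have [d [d0 hd]] := tube_prop cJ M (fun z : jet =>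
  near_and (near_flow_defined z sH cc c0) (smooth_near_near (gT.2 z))).
exists d; split=> // t td; split=> [z zM|]; first by have [] := hd t z td (ltW zM).
apply: smooth_near_on => z zM; have [_ s] := hd t z td (ltW zM).
exact: (smooth_near_slice (F := target Y c) (@coordsysR R) cJ cJ s).
Qed.

Lemma Cr_norm_bigO (F : R * jet -> jet) m (M : R) (U : set jet) r :
  (forall z : jet, U z -> `|z| <= M) ->
  (forall z, smooth_near F (0, z)) -> bigO m F ->
  exists C d : R, [/\ 0 <= C, 0 < d & forall t : R, `|t| < d ->
    (Cr_norm r U (fun z => F (t, z)) <= (C * `|t| ^+ m)%:E)%E].
Proof.
move=> UM sF hF.
have /choice[C hC] (k : 'I_r.+1) : exists C : R, exists d : R, 0 < d /\
    forall (t : R) (z : jet), `|t| < d -> `|z| <= M -> forall vs : seq jet,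
    size vs = k -> (forall v, v \in vs -> `|v| <= 1) ->
    `|iter_derive F (map (@inr_lin R R jet) vs) (t, z)| <= C * `|t| ^+ m.
  have := @tube R jet cJ M (fun C q => forall vs : seq jet,
    size vs = k -> (forall v, v \in vs -> `|v| <= 1) ->
    `|iter_derive F (map (@inr_lin R R jet) vs) q| <= C * `|q.1| ^+ m).
  apply=> [C C' q CC' h vs vk v1|z]; last exact: (bigO_iter_derive cJ k sF hF z).
  apply: le_trans (h vs vk v1) _; apply: ler_wpM2r => //; exact: exprn_ge0.
have /choice[d hd] := hC.
(* Finitely many orders of differentiation enter the norm: the smallest of the time ranges and the
   sum of the constants serve all of them. *)
pose D := \big[Num.min/1]_k d k; pose B := \sum_k `|C k|.
have B0 : 0 <= B by apply: sumr_ge0.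
exists B, D; split=> //.
  by rewrite /D; elim/big_ind: _ => // [x y x0 y0|k _]; [rewrite lt_min x0|have [] := hd k].
move=> t tD.
have X0 : (0 <= (B * `|t| ^+ m)%:E)%E by rewrite lee_fin mulr_ge0 // exprn_ge0.
rewrite /Cr_norm; elim/big_ind: _ => // [x y xX yX|k _]; first by rewrite ge_max xX.
apply: ge_ereal_sup => _ [z Uz <-].
apply: ge_ereal_sup => _ [vs [vk v1] <-]; rewrite lee_fin iter_derive_slice.
have tk : `|t| < d k by apply: lt_le_trans tD _; rewrite /D; exact: bigmin_le_cond.
have [_ h] := hd k; apply: le_trans (h t z tk (UM z Uz) vs vk v1) _.
apply: ler_wpM2r; first exact: exprn_ge0.
apply: le_trans (ler_norm _) _; rewrite /B (bigD1 k) //= lerDl.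
exact: sumr_ge0.
Qed.

End OneSided.

Section Assembly.
Context {R : realType} {n : nat}.
Local Notation jet := (jet1 R n).
Local Notation cJ := (@jet_coords R n).

Lemma contact_vf_decomposition (I : finType) (H : jet -> R) (s d : option I -> jet -> R) :
  (forall i, smooth_on setT (s i)) -> (forall i, smooth_on setT (d i)) ->
  (forall z, H z = s None z + d None z
     + \sum_(i : I) contact_jacobi (s (Some i)) (d (Some i)) z) ->
  smooth_on setT H /\
  forall z, contact_vf H z = contact_vf (s None) z + contact_vf (d None) z
    + \sum_i lie_bracket (contact_vf (s (Some i))) (contact_vf (d (Some i))) z.
Proof.
move=> ss sd /funext ->; have oT : open [set: jet] by exact: openT.
have sb i : smooth_on setT (contact_jacobi (s (Some i)) (d (Some i))).
  exact: smooth_contact_jacobi.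
have [sS _] := contact_vf_sum (index_enum I) (0 : jet) sb.
have sD := smooth_onD oT (ss None) (sd None).
split=> [|z]; first exact: (smooth_onD oT sD sS).
rewrite (contact_vfD z sD sS) (contact_vfD z (ss None) (sd None)).
rewrite (contact_vf_sum (index_enum I) z sb).2; congr (_ + _).
by apply: eq_bigr => i _; exact: contact_vf_bracket.
Qed.

(** The inverse word follows the flow of H for time -t^2 with the same order, which is what negative
    step sizes require. Its estimate needs the leading error of the forward word to be named
    first. *)
Lemma high_order_word (I : finType) (H : jet -> R) (s d : option I -> jet -> R)
    (m : nat) :
  (forall i, smooth_on setT (s i)) -> (forall i, smooth_on setT (d i)) ->
  (forall z, H z = s None z + d None z
     + \sum_(i : I) contact_jacobi (s (Some i)) (d (Some i)) z) ->
  let X g := contact_vf (generator s d g) in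
  exists w, bigO (3 + m) (fun q => wmap X w q - target (contact_vf H) 1 q) /\
    bigO (3 + m) (fun q => wmap X (winv w) q - target (contact_vf H) (-1) q).
Proof.
move=> ss sd hH X; have [sH YE] := contact_vf_decomposition ss sd hH.
have sX g : smooth_on setT (X g).
  by apply: smooth_contact_vf; case: g => i; [exact: ss|exact: sd].
have sY := smooth_contact_vf sH.
have {}YE z : contact_vf H z = X (inl None) z + X (inr None) z
    + \sum_i lie_bracket (X (inl (Some i))) (X (inr (Some i))) z by exact: YE.
clearbody X; have [w0 [e0 [se0 h0]]] := second_order_word cJ sX (g0 := inl None) (h0 := inr None)
  (a := fun i => inl (Some i)) (b := fun i => inr (Some i)) sY YE.
have [w h] := raise_orders cJ sX sY m (isT : (2 < 3)%N) se0 h0.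
have [e [se he]] := leading_expand cJ (good_wmap cJ sX w) (good_target cJ sY 1) h.
have h' : approx X (contact_vf H) w 1 (3 + m) e by exact: he.
have i' := approx_inv cJ sX sY se h'.
exists w; split; first exact: h.
exact: expand_bigO (smooth_onN cJ openT se) i'.
Qed.

(** The factor 4 makes the root at most e / 2, which turns a non-strict bound on h into a strict
    one; for negative h the root is 0. *)
Lemma sqrt_lt (h e : R) : 0 < e -> `|h| <= e ^+ 2 / 4 -> Num.sqrt h < e.
Proof.
move=> e0 he; apply: (@le_lt_trans _ _ (Num.sqrt ((e / 2) ^+ 2))).
  apply: ler_wsqrtr; apply: le_trans (ler_norm h) (le_trans he _).
  by rewrite expr_div_n; have -> : 2 ^+ 2 = 4 :> R by rewrite -natrX.
by rewrite sqrtr_sqr ger0_norm ?divr_ge0 ?(ltW e0) //; lra.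
Qed.

Lemma near_dnbhs (P : R -> Prop) (e : R) : 0 < e ->
  (forall h, `|h| <= e ^+ 2 / 4 -> 0 < h -> P h) ->
  (forall h, `|h| <= e ^+ 2 / 4 -> h < 0 -> P h) ->
  \forall h \near (0 : R)^', P h.
Proof.
move=> e0 hp hn; have e4 : 0 < e ^+ 2 / 4 by rewrite divr_gt0 // exprn_gt0.
rewrite /dnbhs; apply: (ball_le_nbhs e4) => h; rewrite subr0 => he h0.
by have [hlt|hgt|heq] := ltgtP h 0; [exact: hn|exact: hp|rewrite heq eqxx in h0].
Qed.

End Assembly.

Theorem proposition4p3 (R : realType) (n N : nat) (I : finType)
  (H : jet1 R n -> R) (s d : option I -> jet1 R n -> R)
  (U W K : set (jet1 R n))
  (Hpoly : poly_in_p N H)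
  (s_scont : forall i, scont (s i))
  (d_pdiff : forall i, pdiff (d i))
  (H_dec : forall z, H z = s None z + d None z
     + \sum_(i : I) contact_jacobi (s (Some i)) (d (Some i)) z)
  (U_compact : compact U)
  (W_open : open W) (UW : U `<=` W)
  (K_compact : compact K) (KW : K `<=` W)
  (subflows_defined : \forall t \near (0 : R), forall g z,
     W z -> flow_defined (generator s d g) t z)
  (compositions_stay : forall (m : nat) (g : 'I_m -> option I + option I),
     exists2 delta : R, 0 < delta & forall t : 'I_m -> R,
       (forall j, `|t j| < delta) ->
       forall (l : nat) z, U z ->
         K (flow_comp
              (take l [seq (generator s d (g j), t j) | j <- enum 'I_m]) z)) :
  forall k : nat,
  exists (m : nat) (g : 'I_m -> option I + option I) (tau : 'I_m -> R -> R)
         (Psi : R -> jet1 R n -> jet1 R n),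
  let word h := [seq (generator s d (g j), tau j h) | j <- enum 'I_m] in
  [/\ forall j, tau j h @[h --> (0 : R)^'] --> (0 : R),
      forall h z, Psi h z = flow_comp (word h) z,
      exists V : set (jet1 R n), U `<=` V /\
        \forall h \near (0 : R)^',
          [/\ forall z, V z -> flow_comp_defined (word h) z,
              local_contactomorphism V (Psi h),
              forall z, V z -> flow_defined H h z &
              smooth_on V (flow H h)] &
      forall r : nat, exists C : R, \forall h \near (0 : R)^',
        (Cr_norm r U (fun z => Psi h z - flow H h z)%R
           <= (C * `|h| ^+ k.+1)%:E)%E].
Proof.
move=> k.
have ss i : smooth_on setT (s i) by have [] := s_scont i.
have sd i : smooth_on setT (d i) := pdiff_smooth (d_pdiff i).
have sG g : smooth_on setT (generator s d g).
  by case: g => i; [exact: ss|exact: sd].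
have [sH _] := contact_vf_decomposition ss sd H_dec.
have sX g : smooth_on setT (contact_vf (generator s d g)) := smooth_contact_vf (sG g).
have sY := smooth_contact_vf sH.
have cJ := @jet_coords R n.
(* Order 3 + 2 k in t is weakened to 2 k + 2 = 2 (k + 1), which is k + 1 in |h| = t^2. *)
have [w [/bigOW hp /bigOW hn]] := high_order_word (2 * k) ss sd H_dec.
(* The forward word runs at [sqrt h] and the backward word at [sqrt (- h)];
   since [sqrt] vanishes on negative numbers, only one of them moves. *)
pose L : seq (@letter R (option I + option I) * bool) :=
  map (pair^~ true) w ++ map (pair^~ false) (winv w).
pose root (p : @letter R (option I + option I) * bool) (h : R) : R :=
  Num.sqrt (if p.2 then h else - h).
pose t (j : 'I_(size L)) := tnth (in_tuple L) j.
exists (size L), (fun j => (t j).1.1.1), (fun j h => ltime (t j).1 (root (t j) h)).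
pose word h := hword (generator s d) w (Num.sqrt h)
  ++ hword (generator s d) (winv w) (Num.sqrt (- h)).
exists (fun h => flow_comp (word h)).
have wordE h : [seq (generator s d (t j).1.1.1, ltime (t j).1 (root (t j) h))
    | j <- enum 'I_(size L)] = word h.
  rewrite (map_comp (fun p : @letter R (option I + option I) * bool =>
    (generator s d p.1.1.1, ltime p.1 (root p h))) t) /t.
  rewrite (map_tnth_enum (in_tuple L)) /= /L map_cat -!map_comp.
  by congr (_ ++ _).
have wpos h : 0 < h -> flow_comp (word h) =
    fun z => wmap (fun g => contact_vf (generator s d g)) w (Num.sqrt h, z).
  move=> h0; apply/funext => z; rewrite /word flow_comp_cat !flow_comp_hword.
  by rewrite (@ler0_sqrtr _ (- h)) ?oppr_le0 ?ltW // (wmap0 sG).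
have wneg h : h < 0 -> flow_comp (word h) =
    fun z => wmap (fun g => contact_vf (generator s d g)) (winv w) (Num.sqrt (- h), z).
  move=> h0; apply/funext => z; rewrite /word flow_comp_cat !flow_comp_hword.
  by rewrite (@ler0_sqrtr _ h) ?ltW // (wmap0 sG).
have hpos (h : R) : 0 < h -> h = 1 * Num.sqrt h ^+ 2 by move=> /ltW h0; rewrite mul1r sqr_sqrtr.
have hneg (h : R) : h < 0 -> h = -1 * Num.sqrt (- h) ^+ 2.
  by move=> /ltW h0; rewrite sqr_sqrtr ?oppr_ge0 // mulN1r opprK.
have [M0 [_ hM0]] := compact_bounded U_compact.
pose M := `|M0| + 1.
have UM z : U z -> `|z| <= M by apply: hM0; rewrite ltr_pwDr // ler_norm.
split=> //.
(* The times are monomials in sqrt(h) or sqrt(-h), continuous and zero at h = 0; the limit there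
   restricts to the punctured neighborhood. *)
- move=> j; apply: cvg_within_filter.
  have c1 : {for 0, continuous (root (t j))}.
    rewrite /root; case: (t j).2; first exact: sqrt_continuous.
    apply: (@continuous_comp _ _ _ (fun h : R => - h) Num.sqrt).
      exact: opp_continuous.
    exact: sqrt_continuous.
  have c2 : {for 0, continuous (fun h => ltime (t j).1 (root (t j) h))}.
    apply: (@continuous_comp _ _ _ (root (t j)) (ltime (t j).1) 0 c1).
    exact: (smooth_on_continuous (A := setT) (smooth_monomial _ _)).
  have e : ltime (t j).1 (root (t j) 0) = 0.
    by rewrite /root; case: (t j).2; rewrite ?oppr0 sqrtr0 ltime0.
  have c3 : ltime (t j).1 (root (t j) h) @[h --> (0 : R)] -->
    ltime (t j).1 (root (t j) 0) := c2.
  by rewrite e in c3.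
- by move=> h z; rewrite wordE.
(* U lies in the closed ball of radius M, so the open ball of radius M + 1 is a common domain that
   does not depend on h. *)
- exists [set z | `|z| < M + 1]; split; first by move=> z /UM /= ?; lra.
  have [d1 [d10 k1]] := contactomorphism_wmap sG w (M + 1).
  have [d2 [d20 k2]] := contactomorphism_wmap sG (winv w) (M + 1).
  have [d3 [d30 k3]] := flow_regular sH 1 (M + 1).
  have [d4 [d40 k4]] := flow_regular sH (-1) (M + 1).
  have [d5 [d50 k5]] := tube_prop cJ (M + 1) (near_hword_defined sG w).
  have [d6 [d60 k6]] := tube_prop cJ (M + 1) (near_hword_defined sG (winv w)).
  pose e := Num.min (Num.min d1 (Num.min d3 d5)) (Num.min d2 (Num.min d4 d6)).
  have e0 : 0 < e by rewrite !lt_min d10 d20 d30 d40 d50 d60.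
  apply: (near_dnbhs e0) => h he h0; rewrite wordE.
    have := sqrt_lt e0 he; rewrite !lt_min => /andP[/and3P[t1 t3 t5] _].
    have a0 : `|Num.sqrt h| = Num.sqrt h by rewrite ger0_norm // sqrtr_ge0.
    rewrite -a0 in t1 t3 t5; have [f1 f2] := k3 _ t3; rewrite -hpos // in f1 f2.
    split=> // [z zM|]; last by rewrite wpos //; exact: k1.
    (* For h > 0 all times of the second half are 0, and a flow at time 0 is always defined. *)
    apply: flow_comp_defined_cat; first exact: (k5 _ _ t5 (ltW zM)).
    by rewrite (@ler0_sqrtr _ (- h)) ?oppr_le0 ?ltW //; exact: hword0_defined.
  have := sqrt_lt e0 (_ : `|- h| <= _); rewrite normrN => /(_ he).
  rewrite !lt_min => /andP[_ /and3P[t2 t4 t6]].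
  have a0 : `|Num.sqrt (- h)| = Num.sqrt (- h) by rewrite ger0_norm // sqrtr_ge0.
  rewrite -a0 in t2 t4 t6; have [f1 f2] := k4 _ t4; rewrite -hneg // in f1 f2.
  split=> // [z zM|]; last by rewrite wneg //; exact: k2.
  rewrite /word (@ler0_sqrtr _ h) ?ltW //.
  apply: flow_comp_defined_cat; first exact: hword0_defined.
  by rewrite flow_comp_hword (wmap0 sG) //; exact: (k6 _ _ t6 (ltW zM)).
move=> r; have gd c v z : smooth_near (fun q => wmap (fun g => contact_vf (generator s d g)) v q
    - target (contact_vf H) c q) (0, z).
  by apply: (smooth_nearB cJ); [exact: (good_wmap cJ sX v).2|exact: (good_target cJ sY c).2].
have [C1 [d1 [C10 d10 k1]]] := Cr_norm_bigO r UM (gd 1 w) hp.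
have [C2 [d2 [C20 d20 k2]]] := Cr_norm_bigO r UM (gd (-1) (winv w)) hn.
pose e := Num.min d1 d2; have e0 : 0 < e by rewrite lt_min d10.
exists (C1 + C2); apply: (near_dnbhs e0) => h he h0.
  have := sqrt_lt e0 he; rewrite lt_min => /andP[t1 _].
  have a0 : `|Num.sqrt h| = Num.sqrt h by rewrite ger0_norm // sqrtr_ge0.
  (* Writing h as 1 times sqrt(h)^2 turns the flow of H at h into the target family at t =
     sqrt(h). *)
  have E : flow H h = fun z => target (contact_vf H) 1 (Num.sqrt h, z).
    by rewrite [in LHS](hpos h h0).
  rewrite wpos // E.
  rewrite -a0 in t1; apply: le_trans (k1 _ t1) _; rewrite lee_fin.
  have -> : `|Num.sqrt h| ^+ (2 * k).+2 = `|h| ^+ k.+1.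
    rewrite -[(2 * k).+2]/(2 + 2 * k)%N -mulnS exprM a0 sqr_sqrtr ?ltW //.
    by rewrite gtr0_norm.
  by apply: ler_wpM2r; [exact: exprn_ge0|rewrite lerDl].
have := sqrt_lt e0 (_ : `|- h| <= _); rewrite normrN => /(_ he).
rewrite lt_min => /andP[_ t2].
have a0 : `|Num.sqrt (- h)| = Num.sqrt (- h) by rewrite ger0_norm // sqrtr_ge0.
have E : flow H h = fun z => target (contact_vf H) (-1) (Num.sqrt (- h), z).
  by rewrite [in LHS](hneg h h0).
rewrite wneg // E.
rewrite -a0 in t2; apply: le_trans (k2 _ t2) _; rewrite lee_fin.
have -> : `|Num.sqrt (- h)| ^+ (2 * k).+2 = `|h| ^+ k.+1.
  rewrite -[(2 * k).+2]/(2 + 2 * k)%N -mulnS exprM a0 sqr_sqrtr ?oppr_ge0 ?ltW //.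
  by rewrite ltr0_norm.
by apply: ler_wpM2r; [exact: exprn_ge0|rewrite lerDr].
Qed.
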